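(* Under the standing assumptions below, let $K$ be the kernel $K(m_1,m_2)=\frac{1}{(2\pi i)^2}\oint_C\frac{dz}{z}\oint_D\frac{dw}{w}g(z,w;m_1,m_2)$ and $L(m_1,m_2)=\frac{1}{(2\pi i)^2}\oint_C\frac{dz}{z}\oint_{\bar D}\frac{dw}{w}g(z,w;m_1,m_2)$. Then \[\det(1-fK)_{\ell^2(\mathbb{Z})}=\det(1+fL)_{\ell^2(\mathbb{Z})}.\]
   Context: Standing assumptions: $0<q<1$, $N\ge1$, $a_1,\dots,a_N,b_1,\dots,b_N\in(0,1)$ distinct with $a_1>a_2>\dots>a_N$ and $a_1/a_N<q^{-1/2+\epsilon}$ for a fixed $\epsilon\in(0,1/2)$; $t>0$, $k\in\mathbb{Z}_{\ge0}$. $(x;q)_\infty=\prod_{j\ge0}(1-xq^j)$. $f(m)=\frac{tq^{1/2+k+m}}{1+tq^{1/2+k+m}}$, $m\in\mathbb{Z}$, acting by multiplication. $g(z,w;m_1,m_2)=\frac{w^{m_2}}{z^{m_1}}\frac{w}{z-w}\prod_{i=1}^N\frac{(a_iz;q)_\infty}{(a_iw;q)_\infty}\prod_{j=1}^N\frac{(b_j/w;q)_\infty}{(b_j/z;q)_\infty}$. $C$ is the positively oriented circle $|z|=r$ with $\max_j b_j<r<1/a_1$. $D$ is a positively oriented contour lying outside $C$ enclosing $w=1/a_i$, $i=1,\dots,N$, and no other singularity of $g$ in $w$ (not $0$, not $1/(a_iq^j)$ for $j\ge1$). $\bar D$ is a positively oriented contour enclosing $C$ and no point $1/(a_iq^j)$,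 $j\ge0$. *)

(* Defs.v *)
From Stdlib Require Import Reals ZArith.
From Coquelicot Require Import Coquelicot.
Open Scope R_scope.

Fixpoint prodC (n : nat) (F : nat -> C) : C :=
  match n with
  | O => RtoC 1
  | S n' => Cmult (prodC n' F) (F n')
  end.

Definition zpowC (z : C) (m : Z) : C :=
  match m with
  | Z0 => RtoC 1
  | Zpos p => Cpow z (Pos.to_nat p)
  | Zneg p => Cinv (Cpow z (Pos.to_nat p))
  end.

Definition limC (u : nat -> C) : C :=
  (real (Lim_seq (fun n => fst (u n))), real (Lim_seq (fun n => snd (u n)))).

Definition qpoch (x : C) (q : R) : C :=
  limC (fun n => prodC n (fun j => Cminus (RtoC 1) (Cmult x (RtoC (q ^ j))))).

Definition fcoef (q t : R) (k : nat) (m : Z) : C :=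
  let e := t * Rpower q (/2 + INR k + IZR m) in RtoC (e / (1 + e)).

Definition gfun (q : R) (N : nat) (a b : nat -> R) (z w : C) (m1 m2 : Z) : C :=
  Cmult (Cmult (Cdiv (zpowC w m2) (zpowC z m1)) (Cdiv w (Cminus z w)))
   (Cmult
     (prodC N (fun i => Cdiv (qpoch (Cmult (RtoC (a i)) z) q)
                             (qpoch (Cmult (RtoC (a i)) w) q)))
     (prodC N (fun j => Cdiv (qpoch (Cdiv (RtoC (b j)) w) q)
                             (qpoch (Cdiv (RtoC (b j)) z) q)))).

Definition closed_C1_curve (gam dgam : R -> C) : Prop :=
  (forall s, is_derive gam s (dgam s)) /\
  (forall s, continuous dgam s) /\
  gam 0 = gam 1.

Definition cint (gam dgam : R -> C) (h : C -> C) : C :=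
  RInt (V := C_R_CompleteNormedModule)
       (fun s => Cmult (h (gam s)) (dgam s)) 0 1.

Definition winding (gam dgam : R -> C) (p : C) : C :=
  Cdiv (cint gam dgam (fun w => Cinv (Cminus w p))) (Cmult (RtoC (2 * PI)) Ci).

Definition circ (r : R) (s : R) : C :=
  (r * cos (2 * PI * s), r * sin (2 * PI * s)).
Definition dcirc (r : R) (s : R) : C :=
  (- (2 * PI * r) * sin (2 * PI * s), (2 * PI * r) * cos (2 * PI * s)).

Definition kernel (q : R) (N : nat) (a b : nat -> R) (r : R)
  (gam dgam : R -> C) (m1 m2 : Z) : C :=
  Cdiv
    (cint (circ r) (dcirc r) (fun z =>
       Cdiv (cint gam dgam (fun w => Cdiv (gfun q N a b z w m1 m2) w)) z))
    (Cmult (Cmult (RtoC (2 * PI)) Ci) (Cmult (RtoC (2 * PI)) Ci)).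

Fixpoint detC (n : nat) (A : nat -> nat -> C) : C :=
  match n with
  | O => RtoC 1
  | S n' =>
      sum_n (fun j =>
        Cmult (Cmult (RtoC ((-1) ^ j)) (A O j))
              (detC n' (fun i l => A (S i) (if Nat.ltb l j then l else S l)))) n'
  end.

(* sum of F x over all x : nat -> Z with x i in [-M, M] for i < n
   (only x 0, ..., x (n-1) matter) *)
Fixpoint boxsum {G : AbelianMonoid} (n : nat) (M : nat) (F : (nat -> Z) -> G) : G :=
  match n with
  | O => F (fun _ => 0%Z)
  | S n' =>
      sum_n (fun k =>
        boxsum n' M (fun x => F (fun i => match i with
                                        | O => (Z.of_nat k - Z.of_nat M)%Z
                                        | S i' => x i'
                                        end))) (2 * M)
  end.

Definition fred_minor (A : Z -> Z -> C) (n : nat) (x : nat -> Z) : C :=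
  detC n (fun i j => A (x i) (x j)).

(* d = det(1 + A)_{l^2(Z)} given by the absolutely convergent Fredholm
   expansion  sum_{n>=0} 1/n! sum_{x in Z^n} det[A(x_i,x_j)]_{i,j<n}. *)
Definition is_fredholm_det (A : Z -> Z -> C) (d : C) : Prop :=
  (forall n, ex_finite_lim_seq
               (fun M => boxsum n M (fun x => Cmod (fred_minor A n x)))) /\
  ex_series (fun n => real (Lim_seq
               (fun M => boxsum n M (fun x => Cmod (fred_minor A n x)))) / INR (fact n)) /\
  exists T : nat -> C,
    (forall n, filterlim (fun M => boxsum n M (fred_minor A n))
                         eventually (locally (T n))) /\
    is_series (fun n => Cmult (RtoC (/ INR (fact n))) (T n)) d.

(* Main.v *)
(* Put Phi(z) = prod_i (a_i z)_oo / (b_i/z)_oo and psi = 1/Phi, so that g = w^(m2+1) z^(-m1) Phi(z) psi(w) / (z-w).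
   Since |w| > |z|, expanding 1/(z-w) in powers of z/w factors both kernels through the half line l >= 0:
   with phi_n, psi_n the Laurent coefficients of Phi, psi in b < |w| < 1/a_1, and psi'_n those of psi in
   1/a_N < |w| < 1/(q a_1),
     L(m,m') = - sum_l phi_(m-l) psi_(l-m'),   K(m,m') = sum_l phi_(m-l) (psi - psi')_(l-m').
   The first annulus is left of the poles 1/a_i and the second one right of them, the difference being the
   contribution of D; the gap exists because q a_1 < a_N.  By Sylvester's identity the two sides become the
   determinants over l, l' >= 0 of 1 - Psi f Phi and 1 - (Psi - Psi') f Phi.
   The link is the q-difference equation psi(w) = rho(w) psi(qw), where
   rho(w) = prod_i 1/((1 - a_i w)(1 - b_i/(qw))) vanishes at infinity.  Comparing coefficients in the outer
   annulus, psi'_k = sum_(s>=1) rho_s q^(k+s) psi_(k+s).  With tau q^m (1 - f(m)) = f(m) and Psi Phi = 1, this says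
     1 - (Psi - Psi') f Phi = (1 + U) (1 - Psi f Phi),   U_(l,k) = tau rho_(k-l) q^k for k > l,
   and 1 + U is upper unitriangular.  All of this is done on finite truncations; the error terms are controlled by
   geometric bounds on the Laurent coefficients.
   No residue theorem is used: an integral along D is reduced to circles because a combination of closed curves
   that has winding number 0 about the origin and about each pole integrates w^k psi(w) to 0 (partial fractions). *)
Require Import Defs.
From HB Require Import structures.
From mathcomp Require all_boot all_algebra boolp.
From Stdlib Require Import Reals ZArith Lra Lia List FinFun Classical IndefiniteDescription FunctionalExtensionality.
From Coquelicot Require Import Coquelicot.

(** * Finite determinants *)

(** All operators are known through their entries only, and a determinant is its sum of minors. What
    replaces trace norms is a bound p_i^2 w_j^2 on the entries with sum p_i w_i finite: it dominates
    the Fredholm series and makes finite determinants of every size Lipschitz in their entries with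
    a single constant. Since f(m) tends to 1 as m goes to -oo, decay there has to come from the
    kernel; conjugation by s0^m, s0 a radius of the inner annulus, makes the coefficients of Phi
    bounded and those of psi decay in both directions. The algebra behind the link: Psi Phi = 1
    gives 1 - Psi f Phi = Psi (1 - f) Phi, and the q-difference equation gives U Psi (1 - f) Phi =
    Psi' f Phi. The obstacle is that Psi Phi = 1 fails on a finite box, by a residual which grows
    like (s0 / s2)^k in row k, s2 < s0 being a smaller inner radius. It is met by U, whose column k
    decays like (q rr / s0)^k, rr being the outer radius. So q rr < s2 is required: the outer circle
    must be carried by w -> q w back into the inner annulus, below s2. All the radii are chosen
    around this condition. *)

Fixpoint csum (n : nat) (F : nat -> C) : C :=
  match n with O => RtoC 0 | S n' => Cplus (csum n' F) (F n') end.

Definition dltC (i j : nat) : C := if Nat.eqb i j then RtoC 1 else RtoC 0.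

Module DetAlg.
Import all_boot all_algebra boolp.
Import GRing.Theory.
Set Implicit Arguments.
Unset Strict Implicit.
Unset Printing Implicit Defensive.

(** * Determinant identities over a commutative ring *)

Section ComRing.
Local Open Scope ring_scope.
Variable R : comNzRingType.

(** Both sides are the determinant of the block matrix [[[1, -X], [Y, 1]]], factored with [[[1, 0],
    [Y, 1]]] on the left or on the right. No inverse is taken, so any commutative ring will do. *)
Lemma det_1_mulmxC m n (X : 'M[R]_(m, n)) (Y : 'M[R]_(n, m)) :
  \det (1%:M + X *m Y) = \det (1%:M + Y *m X).
Proof.
have e1 : block_mx 1%:M 0 Y 1%:M *m block_mx 1%:M (- X) 0 (1%:M + Y *m X)
    = block_mx (1%:M + X *m Y) (- X) 0 1%:M *m block_mx 1%:M 0 Y 1%:M :> 'M[R]_(m + n).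
  rewrite !mulmx_block !(mulmx0, mul0mx, mulmx1, mul1mx, addr0, add0r, mulNmx, mulmxN).
  by rewrite addrK [- _ + _]addrC addrK.
have := congr1 determinant e1.
by rewrite !det_mulmx !det_lblock !det_ublock !det1 !mul1r !mulr1 => ->.
Qed.

(** Its determinant is the principal minor of [A] on [I]; keeping the full size [m] lets all subsets
    be summed in one type. *)
Definition rowmix m (I : {set 'I_m}) (A : 'M[R]_m) : 'M[R]_m :=
  \matrix_(i, j) if i \in I then A i j else (i == j)%:R.

(** Multilinearity in the rows: each row of [1 + A] is split into its two summands inside the
    Leibniz formula. *)
Lemma det_1D m (A : 'M[R]_m) :
  \det (1%:M + A) = \sum_(I : {set 'I_m}) \det (rowmix I A).
Proof.
rewrite /determinant exchange_big /=; apply: eq_bigr => s _.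
rewrite -big_distrr /=; congr (_ * _).
under eq_bigr => i _ do rewrite !mxE addrC.
rewrite bigA_distr /=; apply: eq_bigr => I _; apply: eq_bigr => i _.
by rewrite !mxE.
Qed.

(** The mixed matrix is [1 + X Y], where [X] is the 0-1 matrix of [x] and [Y] consists of the
    selected rows of [A - 1]; Sylvester's identity brings it down to size [n]. *)
Lemma det_rowmix m n (x : 'I_n -> 'I_m) (A : 'M[R]_m) : injective x ->
  \det (rowmix [set x i | i : 'I_n] A) = \det (\matrix_(i < n, j < n) A (x i) (x j)).
Proof.
move=> xI; pose X : 'M[R]_(m, n) := \matrix_(i, k) (i == x k)%:R.
pose Y : 'M[R]_(n, m) := \matrix_(k, j) (A (x k) j - (x k == j)%:R).
have -> : rowmix [set x i | i : 'I_n] A = 1%:M + X *m Y.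
  apply/matrixP => i j; rewrite !mxE.
  case: imsetP => [[k _ ->]|nk].
    rewrite (bigD1 k) //= big1 => [|k' /negbTE nk'].
      by rewrite !mxE eqxx mul1r addr0 addrC subrK.
    by rewrite !mxE (inj_eq xI) eq_sym nk' mul0r.
  rewrite big1 ?addr0 // => k _; rewrite !mxE.
  by case: eqP => [e|]; rewrite ?mul0r //; case: nk; exists k.
rewrite det_1_mulmxC; congr determinant; apply/matrixP => i j; rewrite !mxE.
rewrite (bigD1 (x j)) //= big1 => [|k /negbTE nk]; last first.
  by rewrite !mxE nk mulr0.
by rewrite !mxE eqxx mulr1 addr0 (inj_eq xI) addrC subrK.
Qed.

Lemma det_noninj m n (x : 'I_n -> 'I_m) (A : 'M[R]_m) : ~ injective x ->
  \det (\matrix_(i < n, j < n) A (x i) (x j)) = 0.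
Proof.
move=> /injectiveP /injectivePn[i [j nij eij]].
by apply: (determinant_alternate nij) => k; rewrite !mxE eij.
Qed.

(** A non-injective [x] repeats a row. The injective ones are grouped by their image, and each [I]
    of size [n] is the image of [n!] of them. *)
Lemma sum_principal m n (A : 'M[R]_m) :
  \sum_(x : {ffun 'I_n -> 'I_m}) \det (\matrix_(i < n, j < n) A (x i) (x j))
  = n`!%:R * \sum_(I : {set 'I_m} | #|I| == n) \det (rowmix I A).
Proof.
rewrite (bigID (fun x : {ffun 'I_n -> 'I_m} => injectiveb x)) /= [X in _ + X]big1 ?addr0; last first.
  by move=> x /injectiveP xI; apply: det_noninj.
rewrite big_distrr /=.
rewrite (partition_big (fun x : {ffun 'I_n -> 'I_m} => [set x i | i : 'I_n])
           (fun I => #|I| == n)) /=; last first.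
  by move=> x /injectiveP xI; rewrite card_imset // card_ord.
apply: eq_bigr => I /eqP cI.
transitivity (\sum_(x : {ffun 'I_n -> 'I_m} | injectiveb x && ([set x i | i : 'I_n] == I))
   \det (rowmix I A)).
  apply: eq_bigr => x /andP[/injectiveP xI /eqP <-].
  by rewrite det_rowmix.
rewrite sumr_const -[LHS]mulr_natl; congr (_%:R * _).
have -> : n`! = #|I| ^_ #|'I_n| by rewrite cI card_ord ffactnn.
rewrite -card_inj_ffuns_on; apply: eq_card => x; rewrite [LHS]unfold_in [RHS]inE andbC.
case: (injectiveP x) => xI; rewrite ?andbF ?andbT //.
rewrite eqEcard card_imset // card_ord cI leqnn andbT.
apply/subsetP/ffun_onP => [h i|h y /imsetP[i _ ->]]; last exact: h.
by apply: h; apply/imsetP; exists i.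
Qed.

(** [c n] collects the principal minors of size [n]. The factorial stays on the right-hand side
    because it cannot be inverted in a general ring. *)
Lemma det_1D_principal m (A : 'M[R]_m) :
  exists c : nat -> R, (forall n,
  \sum_(x : {ffun 'I_n -> 'I_m}) \det (\matrix_(i < n, j < n) A (x i) (x j)) = n`!%:R * c n)
  /\ (forall n, (m < n)%N -> c n = 0) /\ \det (1%:M + A) = \sum_(n < m.+1) c n.
Proof.
exists (fun n => \sum_(I : {set 'I_m} | #|I| == n) \det (rowmix I A)); split=> [n|].
  by rewrite sum_principal.
split=> [n mn|].
  rewrite big1 // => I /eqP cI; move: mn; rewrite -cI ltnNge.
  by rewrite -[X in (_ <= X)%N](card_ord m) max_card.
rewrite det_1D (partition_big (fun I : {set 'I_m} => inord #|I| : 'I_m.+1) xpredT) //=.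
apply: eq_bigr => n _; apply: eq_bigl => I.
rewrite -val_eqE /= inordK // ltnS -[X in (_ <= X)%N](card_ord m).
exact: max_card.
Qed.

Lemma det_conj_diag m (A : 'M[R]_m) (u v : 'I_m -> R) : (forall i, u i * v i = 1) ->
  \det (\matrix_(i, j) (u i * A i j * v j)) = \det A.
Proof.
move=> uv; pose U := diag_mx (\row_i u i); pose V := diag_mx (\row_i v i).
have -> : \matrix_(i, j) (u i * A i j * v j) = U *m A *m V.
  by apply/matrixP => i j; rewrite mul_mx_diag mul_diag_mx !mxE.
rewrite !det_mulmx mulrC mulrA !det_diag -big_split /= big1 ?mul1r // => i _.
by rewrite !mxE mulrC uv.
Qed.

Lemma det_uunitrig m (A : 'M[R]_m) : (forall i j : 'I_m, (j < i)%N -> A i j = 0) ->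
  (forall i, A i i = 1) -> \det A = 1.
Proof.
move=> A0 A1; rewrite -det_tr det_trig; first by rewrite big1 // => i _; rewrite mxE.
by apply/is_trig_mxP => i j ij; rewrite mxE A0.
Qed.

(** Separates the value at index 0, to follow the recursion of [boxsum]. *)
Lemma big_ffunS (T : finType) n (F : {ffun 'I_n.+1 -> T} -> R) :
  \sum_x F x = \sum_(k : T) \sum_(y : {ffun 'I_n -> T})
     F [ffun i => if unlift ord0 i is Some j then y j else k].
Proof.
rewrite pair_bigA /=.
rewrite (reindex (fun p : T * {ffun 'I_n -> T} =>
   [ffun i => if unlift ord0 i is Some j then p.2 j else p.1])) //=.
exists (fun x : {ffun 'I_n.+1 -> T} => (x ord0, [ffun j => x (lift ord0 j)])).
  move=> [k y] _; congr pair; first by rewrite ffunE unlift_none.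
  by apply/ffunP => j; rewrite !ffunE liftK.
move=> x _; apply/ffunP => i; rewrite ffunE /=.
by case: unliftP => [j ->|->]; rewrite ?ffunE.
Qed.

End ComRing.

(* Coquelicot's [C] unfolds to [R * R], on which MathComp would infer pointwise operations. *)
Definition CC : Type := C.
HB.instance Definition _ := gen_eqMixin CC.
HB.instance Definition _ := gen_choiceMixin CC.

Lemma CC_addA : associative (Cplus : CC -> CC -> CC).
Proof. exact: Cplus_assoc. Qed.
Lemma CC_addC : commutative (Cplus : CC -> CC -> CC).
Proof. exact: Cplus_comm. Qed.
Lemma CC_add0 : left_id (RtoC 0 : CC) Cplus.
Proof. exact: Cplus_0_l. Qed.
Lemma CC_addN : left_inverse (RtoC 0 : CC) Copp Cplus.
Proof. by move=> x; rewrite CC_addC; apply: Cplus_opp_r. Qed.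
HB.instance Definition _ := GRing.isZmodule.Build CC CC_addA CC_addC CC_add0 CC_addN.

Lemma CC_mulA : associative (Cmult : CC -> CC -> CC).
Proof. exact: Cmult_assoc. Qed.
Lemma CC_mulC : commutative (Cmult : CC -> CC -> CC).
Proof. exact: Cmult_comm. Qed.
Lemma CC_mul1 : left_id (RtoC 1 : CC) Cmult.
Proof. exact: Cmult_1_l. Qed.
Lemma CC_mulDl : left_distributive (Cmult : CC -> CC -> CC) Cplus.
Proof. by move=> x y z; apply: Cmult_plus_distr_r. Qed.
Lemma CC_1_neq0 : (RtoC 1 : CC) != RtoC 0.
Proof. by apply/eqP => -[]; apply: R1_neq_R0. Qed.
HB.instance Definition _ :=
  GRing.Zmodule_isComNzRing.Build CC CC_mulA CC_mulC CC_mul1 CC_mulDl CC_1_neq0.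

Local Open Scope ring_scope.

(** * Transfer to [detC] and to box sums *)

Definition tomx m n (A : nat -> nat -> C) : 'M[CC]_(m, n) := \matrix_(i, j) A i j.

Lemma csumE n (F : nat -> C) : csum n F = \sum_(i < n) (F i : CC).
Proof. by elim: n => [|n IH]; rewrite ?big_ord0 // big_ord_recr /= IH. Qed.

Lemma sum_n_csum n (F : nat -> C) : sum_n F n = csum n.+1 F.
Proof.
elim: n => [|n IH]; first by rewrite sum_O /= Cplus_0_l.
by rewrite sum_Sn IH.
Qed.

Lemma sum_nE n (F : nat -> C) : sum_n F n = \sum_(i < n.+1) (F i : CC).
Proof. by rewrite sum_n_csum csumE. Qed.

Lemma CC_sign j : (RtoC (pow (IZR (-1)) j) : CC) = (-1) ^+ j.
Proof.
elim: j => [|j IH] //=; rewrite exprS -IH.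
have -> : (-1 : CC) = RtoC (IZR (-1)) by rewrite (RtoC_opp 1).
by rewrite RtoC_mult.
Qed.

Lemma CC_nat n : (n%:R : CC) = RtoC (INR n).
Proof.
elim: n => [|n IH] //; rewrite S_INR mulrS IH RtoC_plus addrC //.
Qed.

Lemma detCE n A : detC n A = \det (tomx n n A).
Proof.
elim: n A => [|n IH] A; first by rewrite det_mx00.
rewrite (expand_det_row _ ord0) /= sum_nE; apply: eq_bigr => j _.
rewrite mxE /cofactor /= add0n -CC_sign.
transitivity ((A 0%N j : CC) * ((RtoC (pow (IZR (-1)) j) : CC) * detC n
   (fun i l => A i.+1 (if Nat.ltb l j then l else l.+1)) : CC)).
  by rewrite mulrA [_ * (RtoC _ : CC)]mulrC.
have e : row' ord0 (col' j (tomx n.+1 n.+1 A))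
    = tomx n n (fun i l => A i.+1 (if Nat.ltb l j then l else l.+1)).
  apply/matrixP => i l; rewrite !mxE /=; congr (A _ _); rewrite /bump.
  case: PeanoNat.Nat.ltb_spec => [/ltP h|/leP h]; first by rewrite leqNgt h.
  by rewrite h.
by rewrite IH e.
Qed.

Lemma dltC_mx n : tomx n n dltC = 1%:M.
Proof.
apply/matrixP => i j; rewrite !mxE /dltC -val_eqE /=.
by case: PeanoNat.Nat.eqb_spec => [->|/eqP/negbTE ->]; rewrite ?eqxx.
Qed.

Lemma detC_ext n A B :
  (forall i j, lt i n -> lt j n -> A i j = B i j) -> detC n A = detC n B.
Proof.
move=> AB; rewrite !detCE; apply: (congr1 (@determinant CC _)); apply/matrixP => i j; rewrite !mxE.
by apply: AB; apply/ltP.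
Qed.

Lemma detC_conj n A u v : (forall i, lt i n -> Cmult (u i) (v i) = RtoC 1) ->
  detC n (fun i j => Cmult (Cmult (u i) (A i j)) (v j)) = detC n A.
Proof.
move=> uv; rewrite !detCE.
rewrite -(det_conj_diag (tomx n n A) (u := fun i => u i) (v := fun i => v i)).
  by apply: (congr1 (@determinant CC _)); apply/matrixP => i j; rewrite !mxE.
by move=> i; apply: uv; apply/ltP.
Qed.

Lemma detC_unitri_mul n U H : (forall i j, lt j i -> lt i n -> U i j = RtoC 0) ->
  (forall i, lt i n -> U i i = RtoC 1) ->
  detC n (fun i j => csum n (fun k => Cmult (U i k) (H k j))) = detC n H.
Proof.
move=> U0 U1; rewrite !detCE.
have -> : tomx n n (fun i j => csum n (fun k => Cmult (U i k) (H k j)))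
   = tomx n n U *m tomx n n H.
  apply/matrixP => i j; rewrite !mxE csumE; apply: eq_bigr => k _.
  by rewrite !mxE.
rewrite det_mulmx (det_uunitrig (A := tomx n n U)) ?mul1r //.
  by move=> i j ij; rewrite mxE U0 //; apply/ltP.
by move=> i; rewrite mxE U1 //; apply/ltP.
Qed.

Lemma detC_sylvester m n X Y :
  detC m (fun i j => Cplus (dltC i j) (csum n (fun k => Cmult (X i k) (Y k j))))
  = detC n (fun i j => Cplus (dltC i j) (csum m (fun k => Cmult (Y i k) (X k j)))).
Proof.
have e p r (A B : nat -> nat -> C) :
  tomx p p (fun i j => Cplus (dltC i j) (csum r (fun k => Cmult (A i k) (B k j))))
  = 1%:M + tomx p r A *m tomx r p B.
  rewrite -dltC_mx; apply/matrixP => i j; rewrite !mxE csumE; congr (_ + _).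
  by apply: eq_bigr => k _; rewrite !mxE.
by rewrite !detCE !e det_1_mulmxC.
Qed.

Lemma detC_repeat n A i j : lt i j -> lt j n ->
  (forall k, lt k n -> A i k = A j k) -> detC n A = RtoC 0.
Proof.
move=> /ltP ij /ltP jn Aij; rewrite detCE.
have ii : (i < n)%N by apply: ltn_trans ij jn.
suff : \det (tomx n n A) = 0 by [].
apply: (determinant_alternate (i1 := Ordinal ii) (i2 := Ordinal jn)).
  by rewrite -val_eqE /= ltn_eqF.
by move=> k; rewrite !mxE /=; apply: Aij; apply/ltP.
Qed.

(** The two sides build their argument functions differently; the hypothesis on [F] allows these to
    be compared on their first [n] values only. *)
Lemma boxsum_ffun n M (F : (nat -> Z) -> C) :
  (forall x y, (forall i, lt i n -> x i = y i) -> F x = F y) ->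
  boxsum (G := C_AbelianMonoid) n M F
  = \sum_(x : {ffun 'I_n -> 'I_(2 * M).+1})
      (F (fun i => if insub i is Some k then Z.sub (Z.of_nat (x k)) (Z.of_nat M) else Z0) : CC).
Proof.
elim: n F => [|n IH] F Fext.
  rewrite (big_pred1 [ffun i : 'I_0 => ord0]) /=.
    by apply: Fext => i /ltP.
  by move=> x; apply/esym/eqP/ffunP => -[].
rewrite big_ffunS /= sum_nE; apply: eq_bigr => k _.
rewrite IH => [|x y xy]; last first.
  by apply: Fext => -[//|i] /ltP h; apply: xy; apply/ltP.
apply: eq_bigr => y _; apply: Fext => -[|i] /ltP h.
  case: insubP => [u _ uE|]; last by rewrite ltn0Sn.
  rewrite ffunE; have -> : u = ord0 by apply/val_inj.
  by rewrite unlift_none.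
have h' : (i < n)%N by [].
case: insubP => [u _ uE|]; last by rewrite h'.
case: insubP => [v _ vE|]; last by rewrite h.
rewrite ffunE; have -> : v = lift ord0 u by apply/val_inj; rewrite /= vE uE.
by rewrite liftK.
Qed.

(** Von Koch's formula on the box [-M, M], with [c n] the sum of the principal minors of size [n].
    The box has 2M+1 points, hence the 2M+2 terms n = 0, ..., 2M+1. *)
Lemma von_koch M (A : Z -> Z -> C) : exists c : nat -> C,
  (forall n, boxsum (G := C_AbelianMonoid) n M (fred_minor A n)
     = Cmult (RtoC (INR (fact n))) (c n))
  /\ (forall n, lt (Nat.add (Nat.mul 2 M) 1) n -> c n = RtoC 0)
  /\ detC (Nat.add (Nat.mul 2 M) 1) (fun i j => Cplus (dltC i j)
       (A (Z.sub (Z.of_nat i) (Z.of_nat M)) (Z.sub (Z.of_nat j) (Z.of_nat M)))) = csum (Nat.add (Nat.mul 2 M) 2) c.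
Proof.
pose B : 'M[CC]_((2 * M).+1) := tomx _ _ (fun i j =>
   A (Z.sub (Z.of_nat i) (Z.of_nat M)) (Z.sub (Z.of_nat j) (Z.of_nat M))).
have [c [c1 [c2 c3]]] := det_1D_principal B.
have factE n : fact n = n`! by elim: n => //= n ->.
exists c; split=> [n|].
  rewrite boxsum_ffun; last first.
    by move=> x y xy; apply: detC_ext => i j hi hj; rewrite !xy.
  transitivity (n`!%:R * c n); last by rewrite CC_nat factE.
  rewrite -c1; apply: eq_bigr => x _; rewrite /fred_minor detCE; apply: (congr1 (@determinant CC _)).
  by apply/matrixP => i j; rewrite !mxE !valK.
split=> [n /ltP h|]; first by apply: c2; rewrite plusE addn1 in h.
have e1 : Nat.add (Nat.mul 2 M) 1 = (2 * M).+1 by rewrite plusE addn1.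
have e2 : Nat.add (Nat.mul 2 M) 2 = (2 * M).+2 by rewrite plusE addn2.
rewrite e1 e2 csumE -c3 detCE; apply: (congr1 (@determinant CC _)).
by rewrite -dltC_mx; apply/matrixP => i j; rewrite !mxE.
Qed.
End DetAlg.

Open Scope R_scope.

(** * Comparison of determinants *)

Fixpoint rsum (n : nat) (F : nat -> R) : R :=
  match n with O => 0 | S n' => rsum n' F + F n' end.

(** Peels off the first factor, as the expansion of [detC] along its first row does. *)
Fixpoint rprod (n : nat) (F : nat -> R) : R :=
  match n with O => 1 | S n' => F O * rprod n' (fun i => F (S i)) end.

Lemma rsum_ext n F G : (forall i, (i < n)%nat -> F i = G i) -> rsum n F = rsum n G.
Proof.
  induction n as [|n IH]; intros H; simpl; [easy|].
  rewrite IH, (H n); auto; intros; apply H; lia.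
Qed.

Lemma rsum_le n F G : (forall i, (i < n)%nat -> F i <= G i) -> rsum n F <= rsum n G.
Proof.
  induction n as [|n IH]; intros H; simpl; [lra|].
  apply Rplus_le_compat; [apply IH; intros; apply H; lia | apply H; lia].
Qed.

Lemma rsum_0 n : rsum n (fun _ => 0) = 0.
Proof. induction n; simpl; lra. Qed.

Lemma rsum_ge0 n F : (forall i, (i < n)%nat -> 0 <= F i) -> 0 <= rsum n F.
Proof. intros H; rewrite <- (rsum_0 n); now apply rsum_le. Qed.

Lemma rsum_scal n c F : rsum n (fun i => c * F i) = c * rsum n F.
Proof. induction n as [|n IH]; simpl; [|rewrite IH]; ring. Qed.

Lemma rsum_plus n F G : rsum n (fun i => F i + G i) = rsum n F + rsum n G.
Proof. induction n as [|n IH]; simpl; [|rewrite IH]; ring. Qed.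

Lemma rsum_head n F : rsum (S n) F = F O + rsum n (fun i => F (S i)).
Proof.
  induction n as [|n IH]; [simpl; ring|].
  change (rsum (S n) F + F (S n) = F O + (rsum n (fun i => F (S i)) + F (S n))).
  rewrite IH; ring.
Qed.

Lemma rsum_incr n m F : (forall i, 0 <= F i) -> (n <= m)%nat -> rsum n F <= rsum m F.
Proof.
  intros H nm; induction nm as [|m nm IH]; [lra|].
  simpl; specialize (H m); lra.
Qed.

(** The index [if l < j then l else S l] enumerates the columns of the minor of [detC] that omits
    column [j]. *)
Lemma rsum_skip n j F : (j <= n)%nat ->
  rsum n (fun l => F (if Nat.ltb l j then l else S l)) + F j = rsum (S n) F.
Proof.
  induction n as [|n IH]; intros jn.
  - assert (j = O) by lia; subst; simpl; ring.
  - change (rsum (S n) F) with (rsum n F + F n) in IH |- *.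
    destruct (Nat.eq_dec j (S n)) as [->|ne].
    + change (rsum (S (S n)) F) with (rsum (S n) F + F (S n)). f_equal.
      apply rsum_ext; intros i hi.
      destruct (Nat.ltb_spec i (S n)); [easy|lia].
    + change (rsum (S (S n)) F) with (rsum n F + F n + F (S n)).
      rewrite <- IH by lia; simpl rsum.
      destruct (Nat.ltb_spec n j); [lia|]. ring.
Qed.

Lemma rprod_ge0 n F : (forall i, (i < n)%nat -> 0 <= F i) -> 0 <= rprod n F.
Proof.
  revert F; induction n as [|n IH]; intros F H; simpl; [lra|].
  apply Rmult_le_pos; [apply H; lia | apply IH; intros; apply H; lia].
Qed.

Lemma rprod_exp n F : (forall i, (i < n)%nat -> 0 <= F i) ->
  rprod n (fun i => 1 + F i) <= exp (rsum n F).
Proof.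
  revert F; induction n as [|n IH]; intros F H.
  - simpl; rewrite exp_0; lra.
  - rewrite rsum_head, exp_plus; simpl.
    apply Rmult_le_compat.
    + specialize (H O); specialize (H (Nat.lt_0_succ n)); lra.
    + apply rprod_ge0; intros i hi; specialize (H (S i)).
      assert (0 <= F (S i)) by (apply H; lia); lra.
    + apply exp_ineq1_le.
    + apply IH; intros; apply H; lia.
Qed.

Lemma csum_ext n F G : (forall i, (i < n)%nat -> F i = G i) -> csum n F = csum n G.
Proof.
  induction n as [|n IH]; intros H; simpl; [easy|].
  rewrite IH, (H n); auto; intros; apply H; lia.
Qed.

Lemma csum_0 n : csum n (fun _ => RtoC 0) = RtoC 0.
Proof. induction n as [|n IH]; simpl; [easy|]. rewrite IH; ring. Qed.

Lemma csum_plus n F G : csum n (fun i => F i + G i)%C = (csum n F + csum n G)%C.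
Proof. induction n as [|n IH]; simpl; [|rewrite IH]; ring. Qed.

Lemma csum_scal n c F : csum n (fun i => c * F i)%C = (c * csum n F)%C.
Proof. induction n as [|n IH]; simpl; [|rewrite IH]; ring. Qed.

Lemma csum_scal_r n c F : csum n (fun i => F i * c)%C = (csum n F * c)%C.
Proof. induction n as [|n IH]; simpl; [|rewrite IH]; ring. Qed.

Lemma csum_minus n F G : csum n (fun i => F i - G i)%C = (csum n F - csum n G)%C.
Proof. induction n as [|n IH]; simpl; [|rewrite IH]; ring. Qed.

Lemma csum_head n F : csum (S n) F = (F O + csum n (fun i => F (S i)))%C.
Proof.
  induction n as [|n IH]; [simpl; ring|].
  change (csum (S n) F + F (S n) = F O + (csum n (fun i => F (S i)) + F (S n)))%C.
  rewrite IH; ring.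
Qed.

Lemma csum_swap n m (F : nat -> nat -> C) :
  csum n (fun i => csum m (fun j => F i j)) = csum m (fun j => csum n (fun i => F i j)).
Proof.
  induction n as [|n IH]; simpl.
  - now rewrite csum_0.
  - rewrite IH; symmetry; apply csum_plus.
Qed.

Lemma Cmod_csum n F : Cmod (csum n F) <= rsum n (fun i => Cmod (F i)).
Proof.
  induction n as [|n IH]; simpl; [rewrite Cmod_0; lra|].
  eapply Rle_trans; [apply Cmod_triangle|]. lra.
Qed.

Lemma Cmod_csum_le n F G : (forall i, (i < n)%nat -> Cmod (F i) <= G i) ->
  Cmod (csum n F) <= rsum n G.
Proof.
  intros H; eapply Rle_trans; [apply Cmod_csum|]. now apply rsum_le.
Qed.

Lemma sum_n_rsum n (F : nat -> R) : sum_n F n = rsum (S n) F.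
Proof.
  induction n as [|n IH]; [rewrite sum_O; simpl; ring|].
  rewrite sum_Sn, IH; reflexivity.
Qed.

Lemma detC_S n A : detC (S n) A = csum (S n) (fun j =>
  (RtoC ((-1) ^ j) * A O j * detC n (fun i l => A (S i) (if Nat.ltb l j then l else S l)))%C).
Proof. exact (@DetAlg.sum_n_csum n _). Qed.

Lemma Cmod_sign j z : Cmod (RtoC ((-1) ^ j) * z)%C = Cmod z.
Proof. rewrite Cmod_mult, Cmod_R, pow_1_abs; ring. Qed.

Lemma rowsum_minor n (F : nat -> R) r j : (forall l, 0 <= F l) -> (j <= n)%nat ->
  rsum (S n) F <= r -> rsum n (fun l => F (if Nat.ltb l j then l else S l)) <= r.
Proof.
  intros F0 jn H; rewrite <- (rsum_skip n j F jn) in H; specialize (F0 j); lra.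
Qed.

(** Expansion along the first row: omitting a column can only lower the absolute sums of the
    remaining rows. The bound is weaker than Hadamard's but asks for nothing beyond row sums. *)
Lemma detC_le n : forall A r, (forall i, (i < n)%nat -> rsum n (fun j => Cmod (A i j)) <= r i) ->
  Cmod (detC n A) <= rprod n r.
Proof.
  induction n as [|n IH]; intros A r H.
  - simpl; rewrite Cmod_1; lra.
  - rewrite detC_S.
    assert (r0 : forall i, (i < S n)%nat -> 0 <= r i).
    { intros i hi; eapply Rle_trans; [|apply H, hi].
      apply rsum_ge0; intros; apply Cmod_ge_0. }
    eapply Rle_trans; [apply (Cmod_csum_le _ _ (fun j => rprod n (fun i => r (S i)) * Cmod (A O j)))|].
    + intros j hj. rewrite <- Cmult_assoc, Cmod_sign, Cmod_mult, Rmult_comm.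
      apply Rmult_le_compat_r; [apply Cmod_ge_0|].
      apply IH; intros i hi.
      apply (rowsum_minor n (fun l => Cmod (A (S i) l))); [intros; apply Cmod_ge_0|lia|apply H; lia].
    + rewrite rsum_scal; simpl rprod; rewrite Rmult_comm.
      apply Rmult_le_compat_r; [apply rprod_ge0; intros; apply r0; lia|].
      apply H; lia.
Qed.

(** Rows are exchanged one at a time. A product in which one row has become a difference lacks a
    factor [r i], and [1 <= r i] lets the full product stand for it. *)
Lemma detC_diff n : forall A B r d,
  (forall i, (i < n)%nat -> 1 <= r i) ->
  (forall i, (i < n)%nat -> rsum n (fun j => Cmod (A i j)) <= r i) ->
  (forall i, (i < n)%nat -> rsum n (fun j => Cmod (B i j)) <= r i) ->
  (forall i, (i < n)%nat -> rsum n (fun j => Cmod (A i j - B i j)) <= d i) ->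
  Cmod (detC n A - detC n B) <= rsum n d * rprod n r.
Proof.
  induction n as [|n IH]; intros A B r d r1 HA HB HD.
  - simpl. replace (RtoC 1 - RtoC 1)%C with (RtoC 0) by ring. rewrite Cmod_0; lra.
  - rewrite !detC_S, <- csum_minus.
    set (P := rprod n (fun i => r (S i))).
    assert (P0 : 0 <= P).
    { apply rprod_ge0; intros i hi; assert (1 <= r (S i)) by (apply r1; lia); lra. }
    assert (d0 : 0 <= rsum n (fun i => d (S i))).
    { apply rsum_ge0; intros i hi; eapply Rle_trans; [|apply (HD (S i)); lia].
      apply rsum_ge0; intros; apply Cmod_ge_0. }
    eapply Rle_trans; [apply (Cmod_csum_le _ _ (fun j =>
       (rsum n (fun i => d (S i)) * P) * Cmod (A O j) + P * Cmod (A O j - B O j)))|].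
    + intros j hj.
      set (DA := detC n (fun i l => A (S i) (if Nat.ltb l j then l else S l))).
      set (DB := detC n (fun i l => B (S i) (if Nat.ltb l j then l else S l))).
      replace (RtoC ((-1) ^ j) * A O j * DA - RtoC ((-1) ^ j) * B O j * DB)%C
        with (RtoC ((-1) ^ j) * (A O j * (DA - DB) + (A O j - B O j) * DB))%C by ring.
      rewrite Cmod_sign. eapply Rle_trans; [apply Cmod_triangle|]. rewrite !Cmod_mult.
      apply Rplus_le_compat.
      * rewrite Rmult_comm. apply Rmult_le_compat_r; [apply Cmod_ge_0|].
        apply IH.
        -- intros; apply r1; lia.
        -- intros i hi; apply (rowsum_minor n (fun l => Cmod (A (S i) l)));
             [intros; apply Cmod_ge_0|lia|apply HA; lia].
        -- intros i hi; apply (rowsum_minor n (fun l => Cmod (B (S i) l)));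
             [intros; apply Cmod_ge_0|lia|apply HB; lia].
        -- intros i hi; apply (rowsum_minor n (fun l => Cmod (A (S i) l - B (S i) l)));
             [intros; apply Cmod_ge_0|lia|apply HD; lia].
      * rewrite Rmult_comm. apply Rmult_le_compat_r; [apply Cmod_ge_0|].
        apply detC_le; intros i hi.
        apply (rowsum_minor n (fun l => Cmod (B (S i) l)));
             [intros; apply Cmod_ge_0|lia|apply HB; lia].
    + rewrite rsum_plus, !rsum_scal, (rsum_head n d).
      assert (h1 := HA O (Nat.lt_0_succ n)). assert (h2 := HD O (Nat.lt_0_succ n)).
      assert (h3 := r1 O (Nat.lt_0_succ n)). simpl rprod; fold P.
      assert (h4 : 0 <= d O).
      { eapply Rle_trans; [|apply h2]. apply rsum_ge0; intros; apply Cmod_ge_0. }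
      set (dd := rsum n (fun i => d (S i))) in *.
      assert (dd * P * rsum (S n) (fun i => Cmod (A O i)) <= dd * P * r O)
        by (apply Rmult_le_compat_l; [apply Rmult_le_pos|]; assumption).
      assert (P * rsum (S n) (fun i => Cmod (A O i - B O i)) <= P * d O)
        by (apply Rmult_le_compat_l; assumption).
      assert (P * d O * 1 <= P * d O * r O)
        by (apply Rmult_le_compat_l; [apply Rmult_le_pos|]; assumption).
      lra.
Qed.

(* Conjugating by the diagonal matrix [w/p] makes the bound [p_i^2 w_j^2] symmetric:
   [s_i s_j] with [s = p w]. *)
Definition balance (p w : nat -> R) (A : nat -> nat -> C) (i j : nat) : C :=
  (RtoC (w i / p i) * A i j * RtoC (p j / w j))%C.

Lemma detC_balance n A (p w : nat -> R) :
  (forall i, (i < n)%nat -> 0 < p i) -> (forall i, (i < n)%nat -> 0 < w i) ->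
  detC n (balance p w A) = detC n A.
Proof.
  intros p0 w0.
  apply (@DetAlg.detC_conj n A (fun i => RtoC (w i / p i)) (fun i => RtoC (p i / w i))).
  intros i hi; specialize (p0 i hi); specialize (w0 i hi).
  rewrite <- RtoC_mult; f_equal; field; lra.
Qed.

Lemma Cmod_balance p w A i j : 0 < p i -> 0 < w i -> 0 < p j -> 0 < w j ->
  Cmod (balance p w A i j) = w i / p i * (p j / w j) * Cmod (A i j).
Proof.
  intros; unfold balance.
  rewrite !Cmod_mult, !Cmod_R, !Rabs_pos_eq; [ring| |];
    apply Rlt_le, Rdiv_lt_0_compat; auto.
Qed.

Lemma balance_dltC p w i j : 0 < p j -> 0 < w j -> balance p w dltC i j = dltC i j.
Proof.
  intros; unfold balance, dltC; destruct (Nat.eqb_spec i j) as [->|]; [|ring].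
  rewrite Cmult_1_r, <- RtoC_mult; f_equal; field; lra.
Qed.

Lemma balance_le p1 w1 p2 w2 x e : 0 < p1 -> 0 < w1 -> 0 < p2 -> 0 < w2 ->
  x <= e * (p1 ^ 2 * w2 ^ 2) -> w1 / p1 * (p2 / w2) * x <= e * (p1 * w1) * (p2 * w2).
Proof.
  intros h1 h2 h3 h4 H.
  replace (e * (p1 * w1) * (p2 * w2)) with (w1 / p1 * (p2 / w2) * (e * (p1 ^ 2 * w2 ^ 2)))
    by (field; lra).
  apply Rmult_le_compat_l; [|assumption].
  apply Rlt_le, Rmult_lt_0_compat; apply Rdiv_lt_0_compat; assumption.
Qed.

Lemma rsum_dltC n i : (i < n)%nat -> rsum n (fun j => Cmod (dltC i j)) = 1.
Proof.
  assert (z : forall m, (m <= i)%nat -> rsum m (fun j => Cmod (dltC i j)) = 0).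
  { intros m hm; rewrite <- (rsum_0 m); apply rsum_ext; intros j hj.
    unfold dltC; destruct (Nat.eqb_spec i j); [lia|apply Cmod_0]. }
  induction n as [|n IH]; intros hi; [lia|]. simpl.
  destruct (Nat.eq_dec i n) as [->|].
  - rewrite z by lia. unfold dltC; rewrite Nat.eqb_refl, Cmod_1; ring.
  - rewrite IH by lia. unfold dltC; destruct (Nat.eqb_spec i n); [lia|]. rewrite Cmod_0; ring.
Qed.

(** After balancing, row i has absolute sum at most 1 + s_i s, and the product of these is at most
    exp (s s). The constant does not depend on [n], so truncations of growing size can be
    compared. *)
Lemma detC_compare n A B (p w : nat -> R) s e : 0 <= e ->
  (forall i, (i < n)%nat -> 0 < p i) -> (forall i, (i < n)%nat -> 0 < w i) ->
  (forall i j, (i < n)%nat -> (j < n)%nat -> Cmod (A i j) <= p i ^ 2 * w j ^ 2) ->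
  (forall i j, (i < n)%nat -> (j < n)%nat -> Cmod (B i j) <= p i ^ 2 * w j ^ 2) ->
  (forall i j, (i < n)%nat -> (j < n)%nat -> Cmod (A i j - B i j) <= e * (p i ^ 2 * w j ^ 2)) ->
  rsum n (fun i => p i * w i) <= s ->
  Cmod (detC n (fun i j => dltC i j + A i j)%C - detC n (fun i j => dltC i j + B i j)%C)
    <= e * (s * s * exp (s * s)).
Proof.
  intros e0 p0 w0 HA HB HD Hs.
  rewrite <- (detC_balance n (fun i j => dltC i j + A i j)%C p w p0 w0).
  rewrite <- (detC_balance n (fun i j => dltC i j + B i j)%C p w p0 w0).
  set (si := fun i => p i * w i).
  assert (si0 : forall i, (i < n)%nat -> 0 <= si i).
  { intros i hi; apply Rlt_le, Rmult_lt_0_compat; auto. }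
  assert (s0 : 0 <= s) by (eapply Rle_trans; [apply rsum_ge0, si0|exact Hs]).
  assert (row : forall X c, 0 <= c -> (forall i j, (i < n)%nat -> (j < n)%nat ->
      Cmod (X i j) <= c * (p i ^ 2 * w j ^ 2)) ->
      forall i, (i < n)%nat -> rsum n (fun j => Cmod (balance p w X i j)) <= c * si i * s).
  { intros X c c0 HX i hi.
    eapply Rle_trans; [apply (rsum_le _ _ (fun j => c * si i * si j))|].
    - intros j hj; rewrite Cmod_balance by auto. apply balance_le; auto.
    - rewrite rsum_scal. apply Rmult_le_compat_l; [apply Rmult_le_pos; auto|exact Hs]. }
  assert (row1 : forall X, (forall i j, (i < n)%nat -> (j < n)%nat ->
      Cmod (X i j) <= p i ^ 2 * w j ^ 2) ->
      forall i, (i < n)%nat -> rsum n (fun j => Cmod (balance p w (fun i j => dltC i j + X i j)%C i j))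
        <= 1 + si i * s).
  { intros X HX i hi.
    eapply Rle_trans; [apply (rsum_le _ _ (fun j => Cmod (dltC i j) + Cmod (balance p w X i j)))|].
    - intros j hj. rewrite <- (balance_dltC p w i j) by auto. eapply Rle_trans; [|apply Cmod_triangle].
      right; f_equal. unfold balance; ring.
    - rewrite rsum_plus, rsum_dltC by assumption.
      assert (h := row X 1 ltac:(lra)). apply Rplus_le_compat_l.
      replace (si i * s) with (1 * si i * s) by ring. apply h; auto.
      intros; rewrite Rmult_1_l; auto. }
  eapply Rle_trans; [apply (detC_diff n _ _ (fun i => 1 + si i * s) (fun i => e * si i * s))|].
  - intros i hi; specialize (si0 i hi); assert (0 <= si i * s) by (apply Rmult_le_pos; lra); lra.
  - apply row1, HA.
  - apply row1, HB.
  - intros i hi. rewrite (rsum_ext _ _ (fun j => Cmod (balance p w (fun i j => A i j - B i j)%C i j))).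
    + apply row; auto.
    + intros j hj; f_equal; unfold balance; ring.
  - rewrite (rsum_ext _ _ (fun i => (e * s) * si i)) by (intros; ring). rewrite rsum_scal.
    replace (e * (s * s * exp (s * s))) with ((e * s * s) * exp (s * s)) by ring.
    assert (es : 0 <= e * s) by (apply Rmult_le_pos; assumption).
    apply Rmult_le_compat.
    + apply Rmult_le_pos; [assumption|apply rsum_ge0, si0].
    + apply rprod_ge0; intros i hi; specialize (si0 i hi).
      assert (0 <= si i * s) by (apply Rmult_le_pos; lra); lra.
    + apply Rmult_le_compat_l; assumption.
    + eapply Rle_trans; [apply rprod_exp; intros i hi; apply Rmult_le_pos; auto|].
      rewrite (rsum_ext _ _ (fun i => s * si i)) by (intros; ring). rewrite rsum_scal.
      assert (h : s * rsum n si <= s * s) by (apply Rmult_le_compat_l; assumption).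
      destruct h as [h|h]; [left; now apply exp_increasing|right; now rewrite h].
Qed.

(** * Fredholm determinants as limits of box determinants *)

(** Stated with [Cmod] to keep estimates elementary; [Clim_filterlim] gives the filter form that
    [is_fredholm_det] asks for. *)
Definition Clim (u : nat -> C) (l : C) : Prop :=
  forall eps, 0 < eps -> exists N, forall n, (N <= n)%nat -> Cmod (u n - l) < eps.

Lemma Clim_filterlim u l : Clim u l -> filterlim u eventually (locally l).
Proof.
  intros H P [eps HP]. destruct (H eps (cond_pos eps)) as [N HN].
  exists N; intros n hn. apply HP. apply C_NormedModule_mixin_compat1.
  exact (HN n hn).
Qed.

Lemma Clim_ext u v l : (forall n, u n = v n) -> Clim u l -> Clim v l.
Proof.
  intros E H eps he; destruct (H eps he) as [N HN]; exists N; intros n hn.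
  rewrite <- E; auto.
Qed.

Lemma Clim_const l : Clim (fun _ => l) l.
Proof.
  intros eps he; exists O; intros n _.
  replace (l - l)%C with (RtoC 0) by ring; now rewrite Cmod_0.
Qed.

Lemma Clim_plus u v l m : Clim u l -> Clim v m -> Clim (fun n => u n + v n)%C (l + m)%C.
Proof.
  intros Hu Hv eps he.
  destruct (Hu (eps / 2) ltac:(lra)) as [N1 H1]. destruct (Hv (eps / 2) ltac:(lra)) as [N2 H2].
  exists (max N1 N2); intros n hn.
  replace (u n + v n - (l + m))%C with ((u n - l) + (v n - m))%C by ring.
  eapply Rle_lt_trans; [apply Cmod_triangle|].
  specialize (H1 n ltac:(lia)). specialize (H2 n ltac:(lia)). lra.
Qed.

Lemma Clim_scal c u l : Clim u l -> Clim (fun n => c * u n)%C (c * l)%C.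
Proof.
  intros H eps he.
  assert (c0 := Cmod_ge_0 c).
  destruct (H (eps / (Cmod c + 1))) as [N HN]; [apply Rdiv_lt_0_compat; lra|].
  exists N; intros n hn.
  replace (c * u n - c * l)%C with (c * (u n - l))%C by ring.
  rewrite Cmod_mult. specialize (HN n hn).
  apply (Rle_lt_trans _ (Cmod c * (eps / (Cmod c + 1)))).
  - apply Rmult_le_compat_l; lra.
  - apply (Rmult_lt_reg_r (Cmod c + 1)); [lra|].
    field_simplify; [|lra]. nra.
Qed.

Lemma Clim_csum n (F : nat -> nat -> C) l : (forall i, (i < n)%nat -> Clim (fun M => F M i) (l i)) ->
  Clim (fun M => csum n (F M)) (csum n l).
Proof.
  induction n as [|n IH]; intros H; simpl; [apply Clim_const|].
  apply Clim_plus; [apply IH; intros; apply H; lia|apply H; lia].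
Qed.

Lemma Clim_unique u l m : Clim u l -> Clim u m -> l = m.
Proof.
  intros Hl Hm. destruct (classic (l = m)) as [|ne]; [assumption|exfalso].
  assert (d : 0 < Cmod (l - m)).
  { apply Cmod_gt_0; intros E; apply ne.
    replace l with ((l - m) + m)%C by ring; rewrite E; ring. }
  destruct (Hl (Cmod (l - m) / 2) ltac:(lra)) as [N1 H1].
  destruct (Hm (Cmod (l - m) / 2) ltac:(lra)) as [N2 H2].
  specialize (H1 (max N1 N2) ltac:(lia)). specialize (H2 (max N1 N2) ltac:(lia)).
  set (x := u (max N1 N2)) in *.
  assert (Cmod (l - m) <= Cmod (x - m) + Cmod (x - l)).
  { replace (l - m)%C with ((x - m) + - (x - l))%C by ring.
    eapply Rle_trans; [apply Cmod_triangle|]. rewrite Cmod_opp; lra. }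
  lra.
Qed.

Lemma Clim_le u l B : Clim u l -> (exists N, forall n, (N <= n)%nat -> Cmod (u n) <= B) -> Cmod l <= B.
Proof.
  intros H [N0 HB]. apply le_epsilon; intros eps he.
  destruct (H eps he) as [N HN]. specialize (HN (max N0 N) ltac:(lia)).
  specialize (HB (max N0 N) ltac:(lia)). set (x := u (max N0 N)) in *.
  replace l with (x + - (x - l))%C by ring.
  eapply Rle_trans; [apply Cmod_triangle|]. rewrite Cmod_opp; lra.
Qed.

Lemma Clim_squeeze u l (B : nat -> R) : (forall n, Cmod (u n - l) <= B n) ->
  is_lim_seq B 0 -> Clim u l.
Proof.
  intros H HB eps he. apply is_lim_seq_spec in HB. destruct (HB (mkposreal eps he)) as [N HN].
  exists N; intros n hn. specialize (HN n hn). simpl in HN.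
  rewrite Rminus_0_r in HN. eapply Rle_lt_trans; [apply H|].
  eapply Rle_lt_trans; [apply Rle_abs|exact HN].
Qed.

Lemma Cmod_le_parts z : Cmod z <= Rabs (fst z) + Rabs (snd z).
Proof.
  replace z with ((RtoC (fst z)) + (RtoC (snd z)) * Ci)%C
    by (unfold RtoC, Ci, Cplus, Cmult; destruct z; simpl; f_equal; ring).
  eapply Rle_trans; [apply Cmod_triangle|].
  rewrite Cmod_mult, Cmod_Ci, !Cmod_R; unfold RtoC, Ci, Cplus, Cmult; simpl.
  right; f_equal; [f_equal; ring|rewrite Rmult_1_r; f_equal; ring].
Qed.

Lemma Clim_parts (u : nat -> C) (l : C) : is_lim_seq (fun n => fst (u n)) (fst l) ->
  is_lim_seq (fun n => snd (u n)) (snd l) -> Clim u l.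
Proof.
  intros H1 H2. apply (Clim_squeeze _ _ (fun n => Rabs (fst (u n) - fst l) + Rabs (snd (u n) - snd l))).
  - intros n; apply (Cmod_le_parts (u n - l)%C).
  - replace (Finite 0) with (Rbar_plus (Rabs 0) (Rabs 0)) by (rewrite Rabs_R0; simpl; f_equal; ring).
    apply is_lim_seq_plus'; apply is_lim_seq_abs with (l := Finite 0).
    + replace 0 with (fst l - fst l) by ring. apply is_lim_seq_minus'; [exact H1|apply is_lim_seq_const].
    + replace 0 with (snd l - snd l) by ring. apply is_lim_seq_minus'; [exact H2|apply is_lim_seq_const].
Qed.

Lemma boxsum_S_R n M (F : (nat -> Z) -> R) : boxsum (S n) M F = rsum (2 * M + 1) (fun k =>
  boxsum n M (fun x => F (fun i => match i with
     | O => (Z.of_nat k - Z.of_nat M)%Z | S i' => x i' end))).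
Proof. replace (2 * M + 1)%nat with (S (2 * M)) by lia. exact (sum_n_rsum _ _). Qed.

Lemma boxsum_S_C n M (F : (nat -> Z) -> C) : boxsum (G := C_AbelianMonoid) (S n) M F =
  csum (2 * M + 1) (fun k =>
  boxsum (G := C_AbelianMonoid) n M (fun x => F (fun i => match i with
     | O => (Z.of_nat k - Z.of_nat M)%Z | S i' => x i' end))).
Proof. replace (2 * M + 1)%nat with (S (2 * M)) by lia. exact (@DetAlg.sum_n_csum _ _). Qed.

Lemma boxsum_le n M : forall (F G : (nat -> Z) -> R),
  (forall x, (forall i, (i < n)%nat -> (- Z.of_nat M <= x i <= Z.of_nat M)%Z) -> F x <= G x) ->
  boxsum n M F <= boxsum n M G.
Proof.
  induction n as [|n IH]; intros F G H; [apply H; lia|].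
  rewrite !boxsum_S_R. apply rsum_le; intros k hk. apply IH; intros x hx. apply H.
  intros [|i] hi; [lia|apply hx; lia].
Qed.

Lemma boxsum_ge0 n M (F : (nat -> Z) -> R) : (forall x, 0 <= F x) -> 0 <= boxsum n M F.
Proof.
  revert F; induction n as [|n IH]; intros F H; [apply H|].
  rewrite boxsum_S_R. apply rsum_ge0; intros; apply IH; auto.
Qed.

Lemma boxsum_plus n M : forall (F G : (nat -> Z) -> R),
  boxsum n M (fun x => F x + G x) = boxsum n M F + boxsum n M G.
Proof.
  induction n as [|n IH]; intros F G; [easy|].
  rewrite !boxsum_S_R, <- rsum_plus. apply rsum_ext; intros; apply IH.
Qed.

Lemma boxsum_scal n M c : forall (F : (nat -> Z) -> R),
  boxsum n M (fun x => c * F x) = c * boxsum n M F.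
Proof.
  induction n as [|n IH]; intros F; [easy|].
  rewrite !boxsum_S_R, <- rsum_scal. apply rsum_ext; intros; apply IH.
Qed.

Lemma boxsum_incr n : forall M (F : (nat -> Z) -> R), (forall x, 0 <= F x) ->
  boxsum n M F <= boxsum n (S M) F.
Proof.
  induction n as [|n IH]; intros M F H; [simpl; lra|].
  rewrite !boxsum_S_R. replace (2 * S M + 1)%nat with (S (S (2 * M + 1))) by lia.
  rewrite rsum_head.
  match goal with |- _ <= ?a + rsum (S ?m) ?G => change (rsum (S m) G) with (rsum m G + G m) end.
  match goal with |- _ <= ?a + (_ + ?b) => assert (0 <= a /\ 0 <= b) as [h1 h2] by
    (split; apply boxsum_ge0; auto) end.
  match goal with |- ?l <= ?a + (?m + ?b) => enough (l <= m) by lra end.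
  apply rsum_le; intros k hk.
  replace (Z.of_nat (S k) - Z.of_nat (S M))%Z with (Z.of_nat k - Z.of_nat M)%Z by lia.
  apply IH; auto.
Qed.

Lemma boxsum_fst n M : forall F : (nat -> Z) -> C,
  fst (boxsum (G := C_AbelianMonoid) n M F) = boxsum n M (fun x => fst (F x)).
Proof.
  induction n as [|n IH]; intros F; [easy|].
  rewrite boxsum_S_R, boxsum_S_C. generalize (2 * M + 1)%nat; intros m.
  induction m as [|m IHm]; simpl; [easy|]. now rewrite IHm, IH.
Qed.

Lemma boxsum_snd n M : forall F : (nat -> Z) -> C,
  snd (boxsum (G := C_AbelianMonoid) n M F) = boxsum n M (fun x => snd (F x)).
Proof.
  induction n as [|n IH]; intros F; [easy|].
  rewrite boxsum_S_R, boxsum_S_C. generalize (2 * M + 1)%nat; intros m.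
  induction m as [|m IHm]; simpl; [easy|]. now rewrite IHm, IH.
Qed.

Lemma boxsum_Cmod n M : forall F : (nat -> Z) -> C,
  Cmod (boxsum (G := C_AbelianMonoid) n M F) <= boxsum n M (fun x => Cmod (F x)).
Proof.
  induction n as [|n IH]; intros F; [simpl; lra|].
  rewrite boxsum_S_R, boxsum_S_C. apply Cmod_csum_le; intros; apply IH.
Qed.

Definition box (M : nat) (g : Z -> R) : R :=
  rsum (2 * M + 1) (fun i => g (Z.of_nat i - Z.of_nat M)%Z).

Lemma boxsum_rprod n M (g : Z -> R) : boxsum n M (fun x => rprod n (fun i => g (x i))) = box M g ^ n.
Proof.
  induction n as [|n IH]; [easy|].
  rewrite boxsum_S_R. simpl rprod.
  rewrite (rsum_ext _ _ (fun k => box M g ^ n * g (Z.of_nat k - Z.of_nat M)%Z)).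
  - rewrite rsum_scal; apply Rmult_comm.
  - intros k hk. rewrite boxsum_scal, IH; ring.
Qed.

Fixpoint lsum (g : Z -> R) (l : list Z) : R :=
  match l with nil => 0 | cons a l' => g a + lsum g l' end.

Lemma lsum_app g l1 l2 : lsum g (l1 ++ l2) = lsum g l1 + lsum g l2.
Proof. induction l1 as [|a l1 IH]; simpl; [|rewrite IH]; ring. Qed.

Lemma lsum_incl g l : (forall m, 0 <= g m) -> NoDup l ->
  forall l', incl l l' -> lsum g l <= lsum g l'.
Proof.
  intros g0 nd; induction nd as [|a l na nd IH]; intros l' inc.
  - simpl; clear inc; induction l' as [|a l' IH]; simpl; [lra|specialize (g0 a); lra].
  - destruct (in_split a l') as [l1 [l2 ->]]; [apply inc; now left|].
    rewrite lsum_app; simpl. specialize (IH (l1 ++ l2)).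
    rewrite lsum_app in IH. enough (lsum g l <= lsum g l1 + lsum g l2) by lra.
    apply IH; intros b hb. specialize (inc b (or_intror hb)).
    apply in_app_or in inc; apply in_or_app; destruct inc as [|[->|]]; auto; contradiction.
Qed.

Lemma lsum_map_seq g (x : nat -> Z) n : lsum g (map x (seq 0 n)) = rsum n (fun i => g (x i)).
Proof.
  induction n as [|n IH]; [easy|].
  rewrite seq_S, map_app, lsum_app, IH; simpl; ring.
Qed.

(** Distinctness of the points is what keeps the row sums of a Fredholm minor bounded independently
    of its size. *)
Lemma rsum_distinct g n (x : nat -> Z) M : (forall m, 0 <= g m) ->
  (forall i j, (i < j)%nat -> (j < n)%nat -> x i <> x j) ->
  (forall i, (i < n)%nat -> (- Z.of_nat M <= x i <= Z.of_nat M)%Z) ->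
  rsum n (fun i => g (x i)) <= box M g.
Proof.
  intros g0 inj bd. unfold box.
  rewrite <- lsum_map_seq, <- (lsum_map_seq g (fun i => (Z.of_nat i - Z.of_nat M)%Z)).
  apply lsum_incl; [assumption| |].
  - clear bd; induction n as [|n IH]; [constructor|].
    rewrite seq_S, map_app; simpl.
    apply NoDup_app; [apply IH; intros; apply inj; lia|repeat constructor; easy|].
    intros z hz [hz'|[]]. apply in_map_iff in hz as [i [hi h]]. apply in_seq in h.
    apply (inj i n); [lia|lia|congruence].
  - intros z hz. apply in_map_iff in hz as [i [hi h]]. apply in_seq in h.
    specialize (bd i ltac:(lia)). apply in_map_iff.
    exists (Z.to_nat (z + Z.of_nat M)); split; [lia|]. apply in_seq; lia.
Qed.

(** With two equal points the minor has two equal rows and vanishes. With distinct points, row i of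
    the balanced minor has absolute sum at most [s] times its own weight. *)
Lemma fred_minor_le A (p w : Z -> R) s n M x :
  (forall m, 0 < p m) -> (forall m, 0 < w m) ->
  (forall m m', Cmod (A m m') <= p m ^ 2 * w m' ^ 2) ->
  box M (fun m => p m * w m) <= s ->
  (forall i, (i < n)%nat -> (- Z.of_nat M <= x i <= Z.of_nat M)%Z) ->
  Cmod (fred_minor A n x) <= rprod n (fun i => s * (p (x i) * w (x i))).
Proof.
  intros p0 w0 HA Hs bd.
  assert (pw : forall m, 0 <= p m * w m) by (intros; apply Rlt_le, Rmult_lt_0_compat; auto).
  assert (s0 : 0 <= s).
  { eapply Rle_trans; [|exact Hs]. apply rsum_ge0; auto. }
  destruct (classic (exists i j, (i < j)%nat /\ (j < n)%nat /\ x i = x j)) as [[i [j [ij [jn e]]]]|nd].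
  - unfold fred_minor. rewrite (@DetAlg.detC_repeat n _ i j ij jn).
    + rewrite Cmod_0; apply rprod_ge0; intros; apply Rmult_le_pos; auto.
    + intros k hk; now rewrite e.
  - unfold fred_minor.
    rewrite <- (detC_balance n _ (fun i => p (x i)) (fun i => w (x i))) by auto.
    apply detC_le; intros i hi.
    eapply Rle_trans; [apply (rsum_le _ _ (fun j => (p (x i) * w (x i)) * (p (x j) * w (x j))))|].
    + intros j hj. rewrite Cmod_balance by auto.
      replace (p (x i) * w (x i) * (p (x j) * w (x j)))
        with (1 * (p (x i) * w (x i)) * (p (x j) * w (x j))) by ring.
      apply balance_le; auto. rewrite Rmult_1_l; auto.
    + rewrite rsum_scal, Rmult_comm. apply Rmult_le_compat_r; [auto|].
      eapply Rle_trans; [|exact Hs].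
      apply (rsum_distinct (fun m => p m * w m)); auto.
      intros i' j' h1 h2 e; apply nd; exists i', j'; auto.
Qed.

(** The bound on a minor is a product over the coordinates of [x], so its sum over the box is the
    n-th power of a one-dimensional sum, which is at most [s * s]. *)
Lemma boxsum_fred_minor A (p w : Z -> R) s n M :
  (forall m, 0 < p m) -> (forall m, 0 < w m) ->
  (forall m m', Cmod (A m m') <= p m ^ 2 * w m' ^ 2) ->
  box M (fun m => p m * w m) <= s ->
  boxsum n M (fun x => Cmod (fred_minor A n x)) <= (s * s) ^ n.
Proof.
  intros p0 w0 HA Hs.
  assert (pw : forall m, 0 <= p m * w m) by (intros; apply Rlt_le, Rmult_lt_0_compat; auto).
  assert (s0 : 0 <= s).
  { eapply Rle_trans; [|exact Hs]. apply rsum_ge0; auto. }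
  eapply Rle_trans; [apply (boxsum_le _ _ _ (fun x => rprod n (fun i => s * (p (x i) * w (x i)))))|].
  - intros x hx. now apply (fred_minor_le A p w s n M).
  - rewrite (boxsum_rprod n M (fun m => s * (p m * w m))).
    unfold box; rewrite rsum_scal. apply pow_incr; split.
    + apply Rmult_le_pos; [assumption|apply rsum_ge0; auto].
    + now apply Rmult_le_compat_l.
Qed.

Definition boxdet (A : Z -> Z -> C) (M : nat) : C :=
  detC (2 * M + 1) (fun i j => dltC i j +
    A (Z.of_nat i - Z.of_nat M)%Z (Z.of_nat j - Z.of_nat M)%Z)%C.

Lemma ex_lim_incr_bounded (u : nat -> R) B : (forall n, u n <= u (S n)) -> (forall n, u n <= B) ->
  ex_finite_lim_seq u.
Proof. intros; now apply ex_finite_lim_seq_incr with B. Qed.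

Lemma exp_series x : is_series (fun n => x ^ n / INR (fact n)) (exp x).
Proof.
  assert (h := is_exp_Reals x). unfold is_pseries in h.
  eapply is_series_ext; [|exact h]. intros n; simpl.
  rewrite pow_n_pow. unfold scal; simpl. unfold mult; simpl. reflexivity.
Qed.

Lemma rsum_exp_le x N : 0 <= x -> rsum N (fun n => x ^ n / INR (fact n)) <= exp x.
Proof.
  intros x0. assert (h := exp_series x).
  assert (pos : forall n, 0 <= x ^ n / INR (fact n)).
  { intros n; apply Rmult_le_pos; [now apply pow_le|apply Rlt_le, Rinv_0_lt_compat, INR_fact_lt_0]. }
  eapply Rle_trans; [apply (rsum_incr _ (S N) _ pos); lia|].
  rewrite <- sum_n_rsum.
  apply (is_lim_seq_incr_compare _ _ h). intros n; rewrite sum_Sn.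
  specialize (pos (S n)). unfold plus; simpl in *. lra.
Qed.

Lemma rsum_exp_lim x e : 0 <= x -> 0 < e -> exists N, exp x - rsum N (fun n => x ^ n / INR (fact n)) < e.
Proof.
  intros x0 he. assert (h := exp_series x).
  apply (is_lim_seq_spec _ (exp x)) in h. destruct (h (mkposreal e he)) as [N HN].
  exists (S N). specialize (HN N (Nat.le_refl _)). simpl pos in HN.
  rewrite sum_n_rsum in HN. apply Rabs_def2 in HN. lra.
Qed.

Lemma csum_tail_le c r N N' : (N <= N')%nat -> (forall n, Cmod (c n) <= r n) ->
  Cmod (csum N' c - csum N c) <= rsum N' r - rsum N r.
Proof.
  intros h H; induction h as [|N' h IH].
  - replace (csum N c - csum N c)%C with (RtoC 0) by ring. rewrite Cmod_0; lra.
  - simpl. replace (csum N' c + c N' - csum N c)%C with ((csum N' c - csum N c) + c N')%C by ring.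
    eapply Rle_trans; [apply Cmod_triangle|]. specialize (H N'). lra.
Qed.

Lemma rsum_fst n c : rsum n (fun i => fst (c i)) = fst (csum n c).
Proof. induction n as [|n IH]; simpl; [easy|now rewrite IH]. Qed.

Lemma rsum_snd n c : rsum n (fun i => snd (c i)) = snd (csum n c).
Proof. induction n as [|n IH]; simpl; [easy|now rewrite IH]. Qed.

(** Dominated convergence in von Koch's formula: on every box the term of order n is at most D^n /
    n!, whatever the size of the box. *)
Theorem fredholm_det_boxdet A (p w : Z -> R) s :
  (forall m, 0 < p m) -> (forall m, 0 < w m) ->
  (forall m m', Cmod (A m m') <= p m ^ 2 * w m' ^ 2) ->
  (forall M, box M (fun m => p m * w m) <= s) ->
  exists d, is_fredholm_det A d /\ Clim (boxdet A) d.
Proof.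
  intros p0 w0 HA Hs.
  set (D := s * s).
  set (b := fun n M => boxsum n M (fun x => Cmod (fred_minor A n x))).
  set (a := fun n M => boxsum (G := C_AbelianMonoid) n M (fred_minor A n)).
  assert (D0 : 0 <= D) by apply Rle_0_sqr.
  assert (bD : forall n M, b n M <= D ^ n).
  { intros; apply (boxsum_fred_minor A p w s); auto. }
  assert (aD : forall n M, Cmod (a n M) <= D ^ n).
  { intros; eapply Rle_trans; [apply boxsum_Cmod|apply bD]. }
  assert (bl : forall n, ex_finite_lim_seq (b n)).
  { intros n; apply ex_lim_incr_bounded with (D ^ n); [|apply bD].
    intros M; apply boxsum_incr; intros; apply Cmod_ge_0. }
  (* Signed box sums need not be monotone in M, but those of [Cmod + g] and of [Cmod] have
     nonnegative terms; the limit of [g] is their difference. *)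
  assert (part : forall n (g : C -> R), (forall z, Rabs (g z) <= Cmod z) ->
      ex_finite_lim_seq (fun M => boxsum n M (fun x => g (fred_minor A n x)))).
  { intros n g hg.
    assert (h : ex_finite_lim_seq (fun M => boxsum n M (fun x =>
       Cmod (fred_minor A n x) + g (fred_minor A n x)))).
    { apply ex_lim_incr_bounded with (2 * D ^ n).
      - intros M; apply boxsum_incr; intros x.
        specialize (hg (fred_minor A n x)); apply Rabs_le_between in hg; lra.
      - intros M; eapply Rle_trans;
          [apply (boxsum_le n M _ (fun x => 2 * Cmod (fred_minor A n x)))|].
        + intros x _; specialize (hg (fred_minor A n x)); apply Rabs_le_between in hg; lra.
        + rewrite boxsum_scal. specialize (bD n M). unfold b in bD. lra. }
    destruct h as [l1 h1]. destruct (bl n) as [l2 h2].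
    exists (l1 - l2). eapply is_lim_seq_ext; [|apply (is_lim_seq_minus' _ _ _ _ h1 h2)].
    intros M; simpl. unfold b; rewrite boxsum_plus; ring. }
  assert (TT : forall n, exists T, Clim (a n) T).
  { intros n. destruct (part n fst) as [l1 h1].
    { intros z; eapply Rle_trans; [apply Rmax_l|apply Rmax_Cmod]. }
    destruct (part n snd) as [l2 h2].
    { intros z; eapply Rle_trans; [apply Rmax_r|apply Rmax_Cmod]. }
    exists (l1, l2). apply Clim_parts; simpl.
    - eapply is_lim_seq_ext; [|exact h1]. intros M; simpl; symmetry; apply boxsum_fst.
    - eapply is_lim_seq_ext; [|exact h2]. intros M; simpl; symmetry; apply boxsum_snd. }
  destruct (functional_choice _ TT) as [T HT].
  clear TT part.
  assert (TD : forall n, Cmod (T n) <= D ^ n).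
  { intros n; apply (Clim_le _ _ _ (HT n)); exists O; auto. }
  set (r := fun n => D ^ n / INR (fact n)).
  assert (fpos : forall n, 0 < / INR (fact n)) by (intros; apply Rinv_0_lt_compat, INR_fact_lt_0).
  set (c := fun n => (RtoC (/ INR (fact n)) * T n)%C).
  assert (scl : forall n z, Cmod z <= D ^ n -> Cmod (RtoC (/ INR (fact n)) * z) <= r n).
  { intros n z hz. rewrite Cmod_mult, Cmod_R, Rabs_pos_eq by (apply Rlt_le, fpos).
    unfold r, Rdiv; rewrite Rmult_comm. apply Rmult_le_compat_r; [apply Rlt_le, fpos|assumption]. }
  assert (cr : forall n, Cmod (c n) <= r n) by (intros; apply scl, TD).
  assert (exr : ex_series r) by (exists (exp D); apply exp_series).
  assert (ex1 : ex_series (fun n => fst (c n))).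
  { apply (ex_series_le (V := R_CompleteNormedModule) (fun n => fst (c n)) r); [|exact exr]. intros n.
    eapply Rle_trans; [|apply cr]. eapply Rle_trans; [apply Rmax_l|apply Rmax_Cmod]. }
  assert (ex2 : ex_series (fun n => snd (c n))).
  { apply (ex_series_le (V := R_CompleteNormedModule) (fun n => snd (c n)) r); [|exact exr]. intros n.
    eapply Rle_trans; [|apply cr]. eapply Rle_trans; [apply Rmax_r|apply Rmax_Cmod]. }
  destruct ex1 as [d1 hd1]. destruct ex2 as [d2 hd2].
  assert (cl : Clim (fun n => csum (S n) c) (d1, d2)).
  { apply Clim_parts; simpl fst; simpl snd.
    - eapply is_lim_seq_ext; [|exact hd1]. intros n; rewrite sum_n_rsum; apply rsum_fst.
    - eapply is_lim_seq_ext; [|exact hd2]. intros n; rewrite sum_n_rsum; apply rsum_snd. }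
  exists (d1, d2); split; [split; [|split]|].
  - exact bl.
  - apply (ex_series_le (V := R_CompleteNormedModule) _ r); [|exact exr]. intros n.
    destruct (bl n) as [l hl]. fold (b n).
    rewrite (is_lim_seq_unique _ _ hl). simpl.
    assert (0 <= l).
    { apply (is_lim_seq_le (fun _ => 0) (b n) 0 l); [|apply is_lim_seq_const|exact hl].
      intros M; apply boxsum_ge0; intros; apply Cmod_ge_0. }
    assert (l <= D ^ n) by
      (apply (is_lim_seq_le (b n) (fun _ => D ^ n) l (D ^ n)); [apply bD|exact hl|apply is_lim_seq_const]).
    unfold norm; simpl; unfold abs; simpl.
    rewrite Rabs_pos_eq; [|apply Rmult_le_pos; [assumption|apply Rlt_le, fpos]].
    unfold r, Rdiv. apply Rmult_le_compat_r; [apply Rlt_le, fpos|assumption].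
  - exists T; split; [intros n; apply Clim_filterlim, HT|].
    apply Clim_filterlim. eapply Clim_ext; [|exact cl]. intros n.
    symmetry; exact (@DetAlg.sum_n_csum n c).
  - intros eps he.
    (* [N] depends on [D] only, so it cuts off the tails of the expansions on all boxes and of the
       limit series at once. The terms below [N] converge by [fin]. *)
    destruct (rsum_exp_lim D (eps / 4) D0 ltac:(lra)) as [N HN]. fold r in HN.
    assert (fin : Clim (fun M => csum N (fun n => RtoC (/ INR (fact n)) * a n M)%C) (csum N c)).
    { apply (Clim_csum N (fun M n => (RtoC (/ INR (fact n)) * a n M)%C)).
      intros n _; apply Clim_scal, HT. }
    destruct (fin (eps / 4) ltac:(lra)) as [M0 HM0].
    exists M0; intros M hM. specialize (HM0 M hM).
    destruct (@DetAlg.von_koch M A) as [c' [c1 [c2 c3]]].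
    fold (boxdet A M) in c3. rewrite c3.
    assert (c'E : forall n, c' n = (RtoC (/ INR (fact n)) * a n M)%C).
    { intros n. unfold a; rewrite c1, Cmult_assoc, <- RtoC_mult, Rinv_l, Cmult_1_l; [easy|].
      apply INR_fact_neq_0. }
    assert (c'r : forall n, Cmod (c' n) <= r n) by (intros; rewrite c'E; apply scl, aD).
    (* The finite expansion stops at 2M+1; padding it with zeros allows a comparison at [N] even
       when the box is small. *)
    assert (c4 : csum (2 * M + 2) c' = csum (max N (2 * M + 2)) c').
    { assert (h : (2 * M + 2 <= max N (2 * M + 2))%nat) by lia.
      induction h as [|m h IH]; [easy|]. simpl csum at 2. rewrite <- IH, c2 by lia. ring. }
    rewrite c4.
    assert (t1 : Cmod (csum (max N (2 * M + 2)) c' - csum N c') < eps / 4).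
    { eapply Rle_lt_trans; [apply (csum_tail_le c' r); [lia|assumption]|].
      eapply Rle_lt_trans; [|apply HN]. apply Rplus_le_compat_r, rsum_exp_le, D0. }
    assert (t2 : Cmod (csum N c - (d1, d2)) <= eps / 4).
    { apply (Clim_le (fun n => csum N c - csum (S n) c)%C).
      - apply (Clim_plus (fun _ => csum N c)); [apply Clim_const|].
        apply Clim_ext with (fun n => (- (1)) * csum (S n) c)%C; [intros; ring|].
        replace (- (d1, d2))%C with (- (1) * (d1, d2))%C by ring. now apply Clim_scal.
      - exists N; intros n hn.
        replace (csum N c - csum (S n) c)%C with (- (csum (S n) c - csum N c))%C by ring.
        rewrite Cmod_opp. eapply Rle_trans; [apply (csum_tail_le c r); [lia|assumption]|].
        left; eapply Rle_lt_trans; [|apply HN]. apply Rplus_le_compat_r, rsum_exp_le, D0. }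
    rewrite (csum_ext N _ c') in HM0 by (intros; symmetry; apply c'E).
    replace (csum (max N (2 * M + 2)) c' - (d1, d2))%C with
      ((csum (max N (2 * M + 2)) c' - csum N c') + ((csum N c' - csum N c) + (csum N c - (d1, d2))))%C by ring.
    eapply Rle_lt_trans; [apply Cmod_triangle|].
    assert (h := Cmod_triangle (csum N c' - csum N c) (csum N c - (d1, d2))). lra.
Qed.

(** * Reduction to a half line *)

Lemma box_S M g : box (S M) g = g (- Z.of_nat (S M))%Z + box M g + g (Z.of_nat (S M)).
Proof.
  unfold box. replace (2 * S M + 1)%nat with (S (S (2 * M + 1))) by lia.
  rewrite rsum_head.
  change (rsum (S (2 * M + 1)) ?G) with (rsum (2 * M + 1) G + G (2 * M + 1)%nat).
  rewrite <- Rplus_assoc. apply (f_equal2 Rplus); [apply (f_equal2 Rplus)|].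
  - cbv beta; f_equal; lia.
  - apply rsum_ext; intros i _; f_equal; lia.
  - cbv beta; f_equal; lia.
Qed.

Definition cbox (M : nat) (g : Z -> C) : C :=
  csum (2 * M + 1) (fun i => g (Z.of_nat i - Z.of_nat M)%Z).

Lemma cbox_S M g : cbox (S M) g = (g (- Z.of_nat (S M))%Z + cbox M g + g (Z.of_nat (S M)))%C.
Proof.
  unfold cbox. replace (2 * S M + 1)%nat with (S (S (2 * M + 1))) by lia.
  rewrite csum_head.
  change (csum (S (2 * M + 1)) ?G) with (csum (2 * M + 1) G + G (2 * M + 1)%nat)%C.
  rewrite Cplus_assoc. apply (f_equal2 Cplus); [apply (f_equal2 Cplus)|].
  - cbv beta; f_equal; lia.
  - apply csum_ext; intros i _; f_equal; lia.
  - cbv beta; f_equal; lia.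
Qed.

Lemma box_le M g h : (forall m, g m <= h m) -> box M g <= box M h.
Proof. intros H; apply rsum_le; intros; apply H. Qed.

Lemma box_scal M c g : box M (fun m => c * g m) = c * box M g.
Proof. apply rsum_scal. Qed.

Lemma Cmod_cbox_le M g h : (forall m, Cmod (g m) <= h m) -> Cmod (cbox M g) <= box M h.
Proof. intros H; apply Cmod_csum_le; intros; apply H. Qed.

Lemma box_geom M x : 0 <= x < 1 -> box M (fun m => x ^ Z.abs_nat m) <= 2 / (1 - x).
Proof.
  intros hx. apply Rle_trans with (2 * (1 - x ^ S M) / (1 - x)).
  - induction M as [|M IH].
    + change (0 + 1 <= 2 * (1 - x * 1) / (1 - x)). apply Rle_trans with 2; [lra|right; field; lra].
    + rewrite box_S. replace (Z.abs_nat (- Z.of_nat (S M))) with (S M) by lia.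
      replace (Z.abs_nat (Z.of_nat (S M))) with (S M) by lia.
      apply Rle_trans with (x ^ S M + 2 * (1 - x ^ S M) / (1 - x) + x ^ S M); [lra|].
      right. simpl; field; lra.
  - apply Rmult_le_compat_r; [apply Rlt_le, Rinv_0_lt_compat; lra|].
    assert (0 <= x ^ S M) by (apply pow_le; lra). lra.
Qed.

Lemma rsum_geom n x : 0 <= x < 1 -> rsum n (fun i => x ^ i) <= / (1 - x).
Proof.
  intros hx. apply Rle_trans with ((1 - x ^ n) / (1 - x)).
  - right; induction n as [|n IH]; simpl; [field; lra|]. rewrite IH; field; lra.
  - rewrite <- (Rmult_1_l (/ (1 - x))). apply Rmult_le_compat_r; [apply Rlt_le, Rinv_0_lt_compat; lra|].
    assert (0 <= x ^ n) by (apply pow_le; lra). lra.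
Qed.

Lemma csum_geom_le n F K x : 0 <= x < 1 -> 0 <= K -> (forall i, (i < n)%nat -> Cmod (F i) <= K * x ^ i) ->
  Cmod (csum n F) <= K / (1 - x).
Proof.
  intros hx hK H. eapply Rle_trans; [apply (Cmod_csum_le _ _ _ H)|].
  rewrite rsum_scal. apply Rmult_le_compat_l; [assumption|now apply rsum_geom].
Qed.

Lemma csum_geom_tail F K x A M : 0 <= x < 1 -> (forall i, Cmod (F i) <= K * x ^ i) ->
  Clim (fun n => csum n F) A -> Cmod (A - csum M F) <= K * x ^ M / (1 - x).
Proof.
  intros hx HF HA.
  apply (Clim_le (fun n => csum n F - csum M F)%C).
  - apply (Clim_plus (fun n => csum n F) (fun _ => - csum M F)%C); [assumption|apply Clim_const].
  - exists M; intros n hn.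
    assert (K0 : 0 <= K).
    { specialize (HF O); simpl in HF. assert (h := Cmod_ge_0 (F O)). lra. }
    eapply Rle_trans; [apply (csum_tail_le F (fun i => K * x ^ i)); assumption|].
    apply Rle_trans with (K * (x ^ M - x ^ n) / (1 - x)).
    + right; induction hn as [|n hn IH]; [field; lra|].
      simpl rsum. replace (rsum n (fun i => K * x ^ i) + K * x ^ n - rsum M (fun i => K * x ^ i))
        with ((rsum n (fun i => K * x ^ i) - rsum M (fun i => K * x ^ i)) + K * x ^ n) by ring.
      rewrite IH; simpl; field; lra.
    + apply Rmult_le_compat_r; [apply Rlt_le, Rinv_0_lt_compat; lra|].
      apply Rmult_le_compat_l; [assumption|]. assert (0 <= x ^ n) by (apply pow_le; lra). lra.
Qed.

Lemma is_lim_geom0 K x : 0 <= x < 1 -> is_lim_seq (fun n => K * x ^ n) 0.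
Proof.
  intros hx. replace (Finite 0) with (Finite (K * 0)) by (f_equal; ring).
  apply (is_lim_seq_scal_l _ K 0). apply is_lim_seq_geom. rewrite Rabs_pos_eq; lra.
Qed.

Lemma Clim_squeeze0 u (B : nat -> R) : (forall n, Cmod (u n) <= B n) ->
  is_lim_seq B 0 -> Clim u (RtoC 0).
Proof.
  intros H; apply Clim_squeeze; intros n.
  replace (u n - RtoC 0)%C with (u n) by ring; auto.
Qed.

Lemma powerRZ_of_nat x n : powerRZ x (Z.of_nat n) = x ^ n.
Proof. symmetry; apply pow_powerRZ. Qed.

Lemma powerRZ_nat_minus x (l : nat) m : 0 < x -> powerRZ x (Z.of_nat l - m) = x ^ l * powerRZ x (- m).
Proof. intros hx; unfold Zminus; rewrite powerRZ_add by lra. now rewrite powerRZ_of_nat. Qed.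

(* Factorisation of the kernel through the half line l >= 0, followed by Sylvester's identity. *)
Lemma fredholm_half_line (f be : Z -> R) (phi chi : Z -> C) (A : Z -> Z -> C) (K nu s : R) :
  0 <= nu < 1 -> 0 < K -> (forall m, 0 < f m) -> (forall m, 0 < be m) ->
  (forall n, Cmod (phi n) <= K) ->
  (forall (l : nat) m, Cmod (chi (Z.of_nat l - m)%Z) <= K * be m * nu ^ l) ->
  (forall M, box M (fun m => sqrt (f m) * sqrt (be m)) <= s) ->
  (forall m m', Clim (fun L => csum L (fun l =>
      - RtoC (f m) * phi (m - Z.of_nat l)%Z * chi (Z.of_nat l - m')%Z)%C) (A m m')) ->
  exists d, is_fredholm_det A d /\ Clim (fun M => detC M (fun l l' => dltC l l' +
    cbox M (fun m => chi (Z.of_nat l - m)%Z * (- RtoC (f m) * phi (m - Z.of_nat l')%Z)))%C) d.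
Proof.
  intros hnu K0 f0 be0 Hphi Hchi Hs HA.
  set (K' := K * K / (1 - nu)).
  assert (K'0 : 0 < K') by (apply Rdiv_lt_0_compat; [apply Rmult_lt_0_compat|]; lra).
  (* Summing the geometric series in l bounds [A m m'] by f(m) K' be(m'), and the square roots split
     this as p(m)^2 w(m')^2. *)
  set (p := fun m => sqrt (f m)). set (w := fun m => sqrt K' * sqrt (be m)).
  assert (p0 : forall m, 0 < p m) by (intros; apply sqrt_lt_R0; auto).
  assert (w0 : forall m, 0 < w m) by (intros; apply Rmult_lt_0_compat; apply sqrt_lt_R0; auto).
  assert (pw : forall m m', p m ^ 2 * w m' ^ 2 = f m * (K' * be m')).
  { intros m m'. unfold p, w. rewrite Rpow_mult_distr, !pow2_sqrt by (apply Rlt_le; auto). ring. }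
  assert (term : forall m m' l, Cmod (- RtoC (f m) * phi (m - Z.of_nat l)%Z * chi (Z.of_nat l - m')%Z)%C
     <= (f m * (K * K * be m')) * nu ^ l).
  { intros m m' l. rewrite !Cmod_mult, Cmod_opp, Cmod_R, (Rabs_pos_eq (f m)) by (apply Rlt_le; auto).
    replace (f m * (K * K * be m') * nu ^ l) with (f m * K * (K * be m' * nu ^ l)) by ring.
    apply Rmult_le_compat; try apply Cmod_ge_0; auto.
    - apply Rmult_le_pos; [apply Rlt_le; auto|apply Cmod_ge_0].
    - apply Rmult_le_compat_l; [apply Rlt_le; auto|auto]. }
  assert (HA1 : forall m m', Cmod (A m m') <= p m ^ 2 * w m' ^ 2).
  { intros m m'. rewrite pw. apply (Clim_le _ _ _ (HA m m')). exists O; intros n _.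
    eapply Rle_trans; [apply (csum_geom_le _ _ (f m * (K * K * be m')) nu hnu)|].
    - apply Rlt_le; repeat apply Rmult_lt_0_compat; auto.
    - intros; apply term.
    - unfold K'; right; field; lra. }
  assert (Hs' : forall M, box M (fun m => p m * w m) <= sqrt K' * s).
  { intros M. eapply Rle_trans; [|apply Rmult_le_compat_l; [apply sqrt_pos|apply (Hs M)]].
    rewrite <- box_scal. right; apply rsum_ext; intros; unfold p, w; ring. }
  destruct (fredholm_det_boxdet A p w (sqrt K' * s) p0 w0 HA1 Hs') as [d [Hd Ld]].
  exists d; split; [exact Hd|].
  set (X := fun M i l => (- RtoC (f (Z.of_nat i - Z.of_nat M)%Z) *
      phi (Z.of_nat i - Z.of_nat M - Z.of_nat l)%Z)%C).
  set (Y := fun M l j => chi (Z.of_nat l - (Z.of_nat j - Z.of_nat M))%Z).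
  (* One M truncates both the line to [-M, M] and the half line to l < M. The second truncation
     moves each entry by at most nu^M times its bound, and [detC_compare] turns this into an error
     of order nu^M on the determinant. *)
  apply Clim_ext with (fun M => detC (2 * M + 1) (fun i j => dltC i j +
      csum M (fun l => X M i l * Y M l j))%C).
  { intros M. exact (@DetAlg.detC_sylvester _ _ (X M) (Y M)). }
  set (S' := sqrt K' * s).
  assert (L0 : Clim (fun M => detC (2 * M + 1) (fun i j => dltC i j +
      csum M (fun l => X M i l * Y M l j))%C - boxdet A M)%C (RtoC 0)).
  { apply Clim_squeeze0 with (fun M => (S' * S' * exp (S' * S')) * nu ^ M); [|now apply is_lim_geom0].
    intros M.
    rewrite (Rmult_comm _ (nu ^ M)).
    apply (detC_compare _ _ _ (fun i => p (Z.of_nat i - Z.of_nat M)%Z) (fun i => w (Z.of_nat i - Z.of_nat M)%Z));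
      auto.
    - apply pow_le; lra.
    - intros i j hi hj. rewrite pw.
      eapply Rle_trans; [apply (csum_geom_le _ _ (f (Z.of_nat i - Z.of_nat M)%Z *
        (K * K * be (Z.of_nat j - Z.of_nat M)%Z)) nu hnu)|].
      + apply Rlt_le; repeat apply Rmult_lt_0_compat; [apply f0|exact K0|exact K0|apply be0].
      + intros; apply term.
      + unfold K'; right; field; lra.
    - intros i j hi hj. rewrite pw.
      set (m := (Z.of_nat i - Z.of_nat M)%Z). set (m' := (Z.of_nat j - Z.of_nat M)%Z).
      assert (h := csum_geom_tail _ (f m * (K * K * be m')) nu (A m m') M hnu (term m m') (HA m m')).
      rewrite <- Cmod_opp. eapply Rle_trans; [|eapply Rle_trans; [exact h|]].
      + right; f_equal. unfold X, Y. fold m m'. ring.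
      + right; unfold K'; field; lra.
    - apply Hs'. }
  apply Clim_ext with (fun M => (detC (2 * M + 1) (fun i j => dltC i j +
      csum M (fun l => X M i l * Y M l j))%C - boxdet A M) + boxdet A M)%C; [intros; ring|].
  replace d with (RtoC 0 + d)%C by ring. now apply Clim_plus.
Qed.

(** The weight [fcoef] with t q^(1/2 + k) gathered in [tau]; with [powerRZ] in place of [Rpower],
    shifts of [m] become algebraic. *)
Definition ffun (q tau : R) (m : Z) : R :=
  let e := tau * powerRZ q m in e / (1 + e).

Lemma csum_dlt_l n l X : (l < n)%nat -> csum n (fun k => dltC l k * X k)%C = X l.
Proof.
  assert (z : forall m, (m <= l)%nat -> csum m (fun k => dltC l k * X k)%C = RtoC 0).
  { intros m hm; rewrite <- (csum_0 m); apply csum_ext; intros k hk.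
    unfold dltC; destruct (Nat.eqb_spec l k); [lia|ring]. }
  induction n as [|n IH]; intros hl; [lia|]. simpl.
  destruct (Nat.eq_dec l n) as [->|].
  - rewrite z by lia. unfold dltC; rewrite Nat.eqb_refl; ring.
  - rewrite IH by lia. unfold dltC; destruct (Nat.eqb_spec l n); [lia|ring].
Qed.

Lemma csum_dlt_r n l X : (l < n)%nat -> csum n (fun k => X k * dltC k l)%C = X l.
Proof.
  intros hl; rewrite <- (csum_dlt_l n l X hl). apply csum_ext; intros k _.
  unfold dltC; rewrite Nat.eqb_sym; ring.
Qed.

Lemma csum_drop n l G : (l <= n)%nat -> (forall k, (k < l)%nat -> G k = RtoC 0) ->
  csum n G = csum (n - l) (fun s => G (l + s)%nat).
Proof.
  intros hl H; induction hl as [|n hl IH].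
  - rewrite Nat.sub_diag; simpl. rewrite <- (csum_0 l). now apply csum_ext.
  - replace (S n - l)%nat with (S (n - l)) by lia. simpl. rewrite IH.
    now replace (l + (n - l))%nat with n by lia.
Qed.

Lemma Rmult4_pos a b c d : 0 < a -> 0 < b -> 0 < c -> 0 < d -> 0 <= a * b * c * d.
Proof. intros; apply Rlt_le; repeat apply Rmult_lt_0_compat; assumption. Qed.

Lemma cbox_csum_swap n M (F : nat -> Z -> C) :
  csum n (fun k => cbox M (F k)) = cbox M (fun m => csum n (fun k => F k m)).
Proof. unfold cbox; apply (csum_swap n (2 * M + 1) (fun k i => F k _)). Qed.

Lemma cbox_scal M c g : cbox M (fun m => c * g m)%C = (c * cbox M g)%C.
Proof. apply csum_scal. Qed.

Lemma cbox_plus M g h : cbox M (fun m => g m + h m)%C = (cbox M g + cbox M h)%C.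
Proof. apply csum_plus. Qed.

Lemma cbox_ext M g h : (forall m, g m = h m) -> cbox M g = cbox M h.
Proof. intros H; apply csum_ext; intros; apply H. Qed.

Lemma ffun_pos q tau m : 0 < q -> 0 < tau -> 0 < ffun q tau m.
Proof.
  intros hq ht; unfold ffun. assert (0 < tau * powerRZ q m).
  { apply Rmult_lt_0_compat; [assumption|now apply powerRZ_lt]. }
  apply Rdiv_lt_0_compat; lra.
Qed.

Lemma ffun_eq q tau m : 0 < q -> 0 < tau ->
  ffun q tau m = (1 - ffun q tau m) * (tau * powerRZ q m).
Proof.
  intros hq ht; unfold ffun. assert (0 < tau * powerRZ q m).
  { apply Rmult_lt_0_compat; [assumption|now apply powerRZ_lt]. }
  field; lra.
Qed.

(** For m >= 0 the weight is at most tau q^m, for m < 0 at most 1; the condition q < th < 1 makes (q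
    / th)^m and th^|m| decay. *)
Lemma ffun_bound q tau th m : 0 < q -> q < th < 1 -> 0 < tau ->
  ffun q tau m * powerRZ th (- m) <= (1 + tau) * Rmax (q / th) th ^ Z.abs_nat m.
Proof.
  intros hq hth ht.
  set (ka := Rmax (q / th) th).
  assert (ka1 : q / th <= ka) by apply Rmax_l.
  assert (ka2 : th <= ka) by apply Rmax_r.
  assert (e0 : 0 < tau * powerRZ q m).
  { apply Rmult_lt_0_compat; [assumption|now apply powerRZ_lt]. }
  assert (hpos := powerRZ_lt th (- m) ltac:(lra)).
  destruct (Z_le_gt_dec 0 m) as [hm|hm].
  - assert (hf : ffun q tau m <= tau * powerRZ q m).
    { unfold ffun. apply (Rmult_le_reg_r (1 + tau * powerRZ q m)); [lra|].
      field_simplify; [|lra]. nra. }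
    apply Rle_trans with (tau * powerRZ q m * powerRZ th (- m)).
    { apply Rmult_le_compat_r; lra. }
    clear hf hpos e0; destruct (Z_of_nat_complete m hm) as [n ->]. rewrite Zabs2Nat.id.
    rewrite powerRZ_neg', !powerRZ_of_nat.
    apply Rle_trans with (tau * (q / th) ^ n).
    + right. unfold Rdiv; rewrite Rpow_mult_distr, pow_inv; ring.
    + assert ((q / th) ^ n <= ka ^ n).
      { apply pow_incr; split; [apply Rlt_le, Rdiv_lt_0_compat; lra|assumption]. }
      assert (0 <= (q / th) ^ n) by (apply pow_le, Rlt_le, Rdiv_lt_0_compat; lra).
      nra.
  - assert (hf : ffun q tau m <= 1).
    { unfold ffun. apply (Rmult_le_reg_r (1 + tau * powerRZ q m)); [lra|].
      field_simplify; [|lra]. nra. }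
    apply Rle_trans with (powerRZ th (- m)).
    { rewrite <- (Rmult_1_l (powerRZ th (- m))) at 2. apply Rmult_le_compat_r; lra. }
    replace (- m)%Z with (Z.of_nat (Z.abs_nat m)) by lia.
    rewrite powerRZ_of_nat.
    assert (th ^ Z.abs_nat m <= ka ^ Z.abs_nat m) by (apply pow_incr; lra).
    assert (0 <= th ^ Z.abs_nat m) by (apply pow_le; lra). nra.
Qed.

Lemma Rmax_div_lt1 q th : 0 < q -> q < th < 1 -> 0 <= Rmax (q / th) th < 1.
Proof.
  intros hq hth; split; [eapply Rle_trans; [|apply Rmax_r]; lra|].
  apply Rmax_lub_lt; [|lra]. apply (Rmult_lt_reg_r th); [lra|]. field_simplify; lra.
Qed.

Lemma box_ffun_bound q tau th : 0 < q -> q < th < 1 -> 0 < tau -> exists s, 0 < s /\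
  forall M, box M (fun m => ffun q tau m * powerRZ th (- m)) <= s.
Proof.
  intros hq hth ht. set (ka := Rmax (q / th) th).
  assert (hk : 0 <= ka < 1) by now apply Rmax_div_lt1.
  exists ((1 + tau) * (2 / (1 - ka))); split.
  { apply Rmult_lt_0_compat; [lra|apply Rdiv_lt_0_compat; lra]. }
  intros M. eapply Rle_trans; [apply (box_le _ _ (fun m => (1 + tau) * ka ^ Z.abs_nat m))|].
  - intros m; now apply ffun_bound.
  - rewrite box_scal. apply Rmult_le_compat_l; [lra|now apply box_geom].
Qed.

(** The products p w of the Fredholm bound are square roots of f(m) be(m), so the geometric rate
    [ka] becomes its square root. The factor 2 counts the two powers in [be]. *)
Lemma box_sqrt_bound q tau th et : 0 < q -> q < th < 1 -> q < et < 1 -> 0 < tau -> exists s,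
  forall M, box M (fun m => sqrt (ffun q tau m) * sqrt (powerRZ th (- m) + powerRZ et (- m))) <= s.
Proof.
  intros hq hth het ht.
  set (k1 := Rmax (q / th) th). set (k2 := Rmax (q / et) et).
  assert (hk1 : 0 <= k1 < 1) by now apply Rmax_div_lt1.
  assert (hk2 : 0 <= k2 < 1) by now apply Rmax_div_lt1.
  set (ka := Rmax k1 k2).
  assert (h1 : k1 <= ka) by apply Rmax_l. assert (h2 : k2 <= ka) by apply Rmax_r.
  assert (hk : 0 <= ka < 1) by (split; [lra|apply Rmax_lub_lt; lra]).
  assert (hg : 0 <= sqrt ka < 1).
  { split; [apply sqrt_pos|]. rewrite <- sqrt_1. apply sqrt_lt_1; lra. }
  exists (sqrt (2 * (1 + tau)) * (2 / (1 - sqrt ka))). intros M.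
  eapply Rle_trans; [apply (box_le _ _ (fun m => sqrt (2 * (1 + tau)) * sqrt ka ^ Z.abs_nat m))|].
  - intros m. assert (hf := ffun_pos q tau m hq ht).
    assert (p1 := powerRZ_lt th (- m) ltac:(lra)). assert (p2 := powerRZ_lt et (- m) ltac:(lra)).
    assert (b1 := ffun_bound q tau th m hq hth ht). assert (b2 := ffun_bound q tau et m hq het ht).
    fold k1 in b1. fold k2 in b2.
    assert (e1 : k1 ^ Z.abs_nat m <= ka ^ Z.abs_nat m) by (apply pow_incr; lra).
    assert (e2 : k2 ^ Z.abs_nat m <= ka ^ Z.abs_nat m) by (apply pow_incr; lra).
    rewrite <- sqrt_mult by lra.
    apply Rle_trans with (sqrt (2 * (1 + tau) * ka ^ Z.abs_nat m)).
    + apply sqrt_le_1_alt. nra.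
    + right. rewrite sqrt_mult by (try apply pow_le; lra). f_equal.
      generalize (Z.abs_nat m); intros n; induction n as [|n IH]; simpl; [apply sqrt_1|].
      rewrite sqrt_mult by (try apply pow_le; lra). now rewrite IH.
  - rewrite box_scal. apply Rmult_le_compat_l; [apply sqrt_pos|now apply box_geom].
Qed.

(* [phi], [psi], [psi'] stand for the Laurent coefficients multiplied by [s0 ^ n], where [s0] is a radius of the inner
   annulus: this makes [phi] bounded. *)
Section HalfLine.
Context (q tau th et th2 om K : R) (phi psi psi' : Z -> C) (rho : nat -> C).
Hypothesis hq : 0 < q.
Hypothesis hth : q < th < 1.
Hypothesis het : q < et < 1.
Hypothesis hth2 : 1 < th2.
Hypothesis hth2q : th2 * q < et.
Hypothesis hom : 0 < om < 1.
Hypothesis htau : 0 < tau.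
Hypothesis hK : 0 < K.
Hypothesis Hphi : forall n, Cmod (phi n) <= K.
Hypothesis Hpsi : forall n, Cmod (psi n) <= K * powerRZ th n.
Hypothesis Hpsi2 : forall n, Cmod (psi n) <= K * powerRZ th2 n.
Hypothesis Hpsi' : forall n, Cmod (psi' n) <= K * powerRZ et n.
Hypothesis Hrho0 : rho O = RtoC 0.
Hypothesis Hrho : forall s, Cmod (rho s) <= K * (/ et) ^ s.
Hypothesis Hrec : forall k S, Cmod (psi' k - csum S (fun s =>
  rho s * RtoC (powerRZ q (k + Z.of_nat s)) * psi (k + Z.of_nat s)%Z)%C) <= K * powerRZ et k * om ^ S.
Hypothesis Hinv : forall a b : nat, Clim (fun M => cbox M (fun m =>
  psi (Z.of_nat a - m)%Z * phi (m - Z.of_nat b)%Z)%C) (dltC a b).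

Let f := ffun q tau.
(** Truncated to the box, [B] is -Psi f Phi and [Bd] is -(Psi - Psi') f Phi, while [1 + Bc] is the
    product of the truncated [1 + U] and [1 + B]. [Bc] and [Bd] agree in the limit only. *)
Let B M l l' := cbox M (fun m => psi (Z.of_nat l - m)%Z * (- RtoC (f m) * phi (m - Z.of_nat l')%Z))%C.
Let Bd M l l' := cbox M (fun m => (psi (Z.of_nat l - m)%Z - psi' (Z.of_nat l - m)%Z) *
   (- RtoC (f m) * phi (m - Z.of_nat l')%Z))%C.
Let U l k := if Nat.ltb l k then (RtoC tau * rho (k - l)%nat * RtoC (q ^ k))%C else RtoC 0.
Let Bc M l l' := (U l l' + B M l l' + csum M (fun k => U l k * B M k l'))%C.

(** The residual is the part of the sum outside the box. The side m > M is controlled by the bound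
    on psi with [th2], at the price of th2^k, and the side m < -M by the bound with [th]. *)
Lemma half_line_resid M k l' : (k < M)%nat ->
  Cmod (dltC k l' - cbox M (fun m => psi (Z.of_nat k - m)%Z * phi (m - Z.of_nat l')%Z)%C)
   <= K * K * / (1 - / th2) * (th2 ^ k * (/ th2) ^ M) + K * K * / (1 - th) * th ^ M.
Proof.
  intros hk.
  assert (x0 : 0 < / th2) by (apply Rinv_0_lt_compat; lra).
  assert (x1 : / th2 < 1) by (rewrite <- Rinv_1; apply Rinv_lt_contravar; lra).
  set (g := fun m => (psi (Z.of_nat k - m)%Z * phi (m - Z.of_nat l')%Z)%C).
  assert (c1 : 0 <= K * K * / (1 - / th2) * th2 ^ k).
  { repeat apply Rmult_le_pos; try lra; [apply Rlt_le, Rinv_0_lt_compat; lra|apply pow_le; lra]. }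
  assert (c2 : 0 <= K * K * / (1 - th)).
  { repeat apply Rmult_le_pos; try lra; apply Rlt_le, Rinv_0_lt_compat; lra. }
  apply (Clim_le (fun n => cbox n g - cbox M g)%C).
  { apply (Clim_plus (fun n => cbox n g) (fun _ => - cbox M g)%C); [apply Hinv|apply Clim_const]. }
  exists M; intros n hn.
  (* The exact partial geometric sums are carried along, so that the induction on [n] closes with an
     equality; the subtracted terms are dropped afterwards. *)
  apply Rle_trans with (K * K * / (1 - / th2) * th2 ^ k * ((/ th2) ^ M - (/ th2) ^ n)
     + K * K * / (1 - th) * (th ^ M - th ^ n)).
  - induction hn as [|n hn IH].
    + replace (cbox M g - cbox M g)%C with (RtoC 0) by ring. rewrite Cmod_0. lra.
    + rewrite cbox_S.
      replace (g (- Z.of_nat (S n))%Z + cbox n g + g (Z.of_nat (S n)) - cbox M g)%C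
        with ((cbox n g - cbox M g) + (g (- Z.of_nat (S n))%Z + g (Z.of_nat (S n))))%C by ring.
      eapply Rle_trans; [apply Cmod_triangle|].
      assert (t1 : Cmod (g (Z.of_nat (S n))) <= K * K * (th2 ^ k * (/ th2) ^ n)).
      { unfold g. rewrite Cmod_mult. rewrite (Rmult_comm (K * K)).
        apply Rle_trans with ((K * powerRZ th2 (Z.of_nat k - Z.of_nat (S n))) * K).
        - apply Rmult_le_compat; auto using Cmod_ge_0.
        - rewrite powerRZ_nat_minus by lra. rewrite powerRZ_neg', powerRZ_of_nat.
          replace (K * (th2 ^ k * / th2 ^ S n) * K) with (K * K * th2 ^ k * / th2 ^ S n) by ring.
          replace (th2 ^ k * (/ th2) ^ n * (K * K)) with (K * K * th2 ^ k * (/ th2) ^ n) by ring.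
          apply Rmult_le_compat_l; [repeat apply Rmult_le_pos; try lra; apply pow_le; lra|].
          rewrite <- pow_inv. simpl. rewrite <- (Rmult_1_l ((/ th2) ^ n)) at 2.
          apply Rmult_le_compat_r; [apply pow_le|]; lra. }
      assert (t2 : Cmod (g (- Z.of_nat (S n))%Z) <= K * K * th ^ n).
      { unfold g. rewrite Cmod_mult.
        apply Rle_trans with ((K * powerRZ th (Z.of_nat k - - Z.of_nat (S n))) * K).
        - apply Rmult_le_compat; auto using Cmod_ge_0.
        - replace (Z.of_nat k - - Z.of_nat (S n))%Z with (Z.of_nat (S k + n)) by lia.
          rewrite powerRZ_of_nat, pow_add.
          replace (K * (th ^ S k * th ^ n) * K) with (K * K * (th ^ S k * th ^ n)) by ring.
          apply Rmult_le_compat_l; [nra|].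
          rewrite <- (Rmult_1_l (th ^ n)) at 2. apply Rmult_le_compat_r; [apply pow_le; lra|].
          assert (h := pow_incr th 1 (S k) ltac:(lra)). rewrite pow1 in h. exact h. }
      eapply Rle_trans; [apply Rplus_le_compat; [exact IH|eapply Rle_trans;
        [apply Cmod_triangle|apply Rplus_le_compat; [exact t2|exact t1]]]|].
      right. simpl. field. lra.
  - assert (0 <= (/ th2) ^ n) by (apply pow_le; lra). assert (0 <= th ^ n) by (apply pow_le; lra).
    apply Rplus_le_compat.
    + rewrite <- Rmult_assoc. apply Rmult_le_compat_l; [assumption|lra].
    + apply Rmult_le_compat_l; [assumption|lra].
Qed.

(** The coefficient rho_(k-l) may grow like et^(l-k). Regrouped as et^l (q / et)^k, the bound is
    summable in k because q < et. *)
Lemma half_line_U l k : Cmod (U l k) <= tau * K * et ^ l * (q / et) ^ k.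
Proof.
  assert (0 <= q / et) by (apply Rlt_le, Rdiv_lt_0_compat; lra).
  unfold U. destruct (Nat.ltb_spec l k) as [h|h].
  - rewrite !Cmod_mult, !Cmod_R, !Rabs_pos_eq by (try apply pow_le; lra).
    apply Rle_trans with (tau * (K * (/ et) ^ (k - l)) * q ^ k).
    + apply Rmult_le_compat_r; [apply pow_le; lra|]. apply Rmult_le_compat_l; [lra|auto].
    + right. assert (h1 : et ^ l * (/ et) ^ l = 1).
      { rewrite <- Rpow_mult_distr, Rinv_r, pow1 by lra. reflexivity. }
      assert (h2 : (q / et) ^ k = q ^ k * ((/ et) ^ l * (/ et) ^ (k - l))).
      { unfold Rdiv. rewrite Rpow_mult_distr, <- pow_add. do 2 f_equal. lia. }
      rewrite h2. generalize dependent ((/ et) ^ l). intros z h1 _.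
      generalize ((/ et) ^ (k - l)); intros y.
      transitivity (tau * K * y * q ^ k * (et ^ l * z)); [rewrite h1|]; ring.
  - rewrite Cmod_0. repeat apply Rmult_le_pos; try lra; apply pow_le; lra.
Qed.

(** Exact at every M: the sum in [Bc] already runs over k < M only, so [1 + Bc] is a genuine product
    of M x M matrices. *)
Lemma half_line_det M : detC M (fun l l' => dltC l l' + Bc M l l')%C
  = detC M (fun l l' => dltC l l' + B M l l')%C.
Proof.
  rewrite <- (@DetAlg.detC_unitri_mul M (fun l k => dltC l k + U l k)%C
    (fun l l' => dltC l l' + B M l l')%C).
  - apply DetAlg.detC_ext; intros l l' hl hl'. unfold Bc.
    rewrite (csum_ext M (fun k => (dltC l k + U l k) * (dltC k l' + B M k l'))%C
      (fun k => (dltC l k * (dltC k l' + B M k l')) +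
      (U l k * dltC k l' + U l k * B M k l'))%C) by (intros; ring).
    rewrite csum_plus, csum_plus, csum_dlt_l, csum_dlt_r by assumption. ring.
  - intros i j hj hi. unfold dltC, U.
    destruct (Nat.eqb_spec i j); [lia|]. destruct (Nat.ltb_spec i j); [lia|]. ring.
  - intros i hi. unfold dltC, U. rewrite Nat.eqb_refl, Nat.ltb_irrefl. ring.
Qed.

(** Isolates the two sources of error: the relation Psi Phi = 1 cut to the box, and the recurrence
    for psi' cut after M - l terms. *)
Lemma half_line_diff M l l' : (l < M)%nat -> (l' < M)%nat ->
  (Bc M l l' - Bd M l l')%C =
  (csum M (fun k => U l k * (dltC k l' - cbox M (fun m => psi (Z.of_nat k - m)%Z * phi (m - Z.of_nat l')%Z)))
   + cbox M (fun m => RtoC (f m) * phi (m - Z.of_nat l')%Z * - (psi' (Z.of_nat l - m)%Z -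
       csum (M - l) (fun s => rho s * RtoC (powerRZ q (Z.of_nat l - m + Z.of_nat s)) *
          psi (Z.of_nat l - m + Z.of_nat s)%Z))))%C.
Proof.
  intros hl hl'.
  assert (e1 : Bd M l l' = (B M l l' + cbox M (fun m => psi' (Z.of_nat l - m)%Z *
      (RtoC (f m) * phi (m - Z.of_nat l')%Z)))%C).
  { unfold Bd, B. rewrite <- cbox_plus. apply cbox_ext; intros; ring. }
  (* On the box, delta + B = (delta - Psi Phi) + Psi (1 - f) Phi. *)
  assert (e2 : (U l l' + csum M (fun k => U l k * B M k l'))%C =
     (csum M (fun k => U l k * (dltC k l' - cbox M (fun m => psi (Z.of_nat k - m)%Z * phi (m - Z.of_nat l')%Z)))
     + csum M (fun k => U l k * cbox M (fun m => psi (Z.of_nat k - m)%Z *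
          (RtoC (1 - f m) * phi (m - Z.of_nat l')%Z))))%C).
  { rewrite <- (csum_dlt_r M l' (fun k => U l k) hl'), <- !csum_plus.
    apply csum_ext; intros k hk.
    replace (cbox M (fun m => psi (Z.of_nat k - m)%Z * (RtoC (1 - f m) * phi (m - Z.of_nat l')%Z)))%C
      with (cbox M (fun m => psi (Z.of_nat k - m)%Z * phi (m - Z.of_nat l')%Z) + B M k l')%C.
    - ring.
    - unfold B. rewrite <- cbox_plus. apply cbox_ext; intros m. rewrite RtoC_minus; ring. }
  (* With k = l + s one has tau q^k (1 - f(m)) = f(m) q^(l - m + s), so the sum over k becomes the
     truncated recurrence at index l - m. *)
  assert (e3 : csum M (fun k => U l k * cbox M (fun m => psi (Z.of_nat k - m)%Z *
          (RtoC (1 - f m) * phi (m - Z.of_nat l')%Z)))%C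
     = cbox M (fun m => RtoC (f m) * phi (m - Z.of_nat l')%Z *
       csum (M - l) (fun s => rho s * RtoC (powerRZ q (Z.of_nat l - m + Z.of_nat s)) *
          psi (Z.of_nat l - m + Z.of_nat s)%Z))%C).
  { rewrite (csum_ext _ _ (fun k => cbox M (fun m => U l k * (psi (Z.of_nat k - m)%Z *
          (RtoC (1 - f m) * phi (m - Z.of_nat l')%Z))))%C) by (intros; symmetry; apply cbox_scal).
    rewrite cbox_csum_swap. apply cbox_ext; intros m.
    rewrite (csum_drop M l) by first [lia | intros k hk; unfold U; destruct (Nat.ltb_spec l k); [lia|ring]].
    rewrite <- csum_scal. apply csum_ext; intros s hs.
    replace (Z.of_nat (l + s) - m)%Z with (Z.of_nat l - m + Z.of_nat s)%Z by lia.
    unfold U. destruct (Nat.ltb_spec l (l + s)) as [h|h].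
    - replace (l + s - l)%nat with s by lia.
      unfold f at 2. rewrite (ffun_eq q tau m hq htau). fold f. rewrite !RtoC_mult.
      replace (RtoC (q ^ (l + s))) with (RtoC (powerRZ q m) * RtoC (powerRZ q (Z.of_nat l - m + Z.of_nat s)))%C.
      + ring.
      + rewrite <- RtoC_mult, <- powerRZ_add by lra. f_equal.
        replace (m + (Z.of_nat l - m + Z.of_nat s))%Z with (Z.of_nat (l + s)) by lia.
        apply powerRZ_of_nat.
    (* The diagonal k = l is absent from [U], and the recurrence has no term s = 0 because rho_0 =
       0. *)
    - assert (s = O) by lia; subst s. rewrite Hrho0. ring. }
  rewrite e1. unfold Bc.
  replace (U l l' + B M l l' + csum M (fun k => U l k * B M k l') -
    (B M l l' + cbox M (fun m => psi' (Z.of_nat l - m)%Z * (RtoC (f m) * phi (m - Z.of_nat l')%Z))))%C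
   with ((U l l' + csum M (fun k => U l k * B M k l')) +
     - (1) * cbox M (fun m => psi' (Z.of_nat l - m)%Z * (RtoC (f m) * phi (m - Z.of_nat l')%Z)))%C by ring.
  rewrite e2, e3, <- cbox_scal, <- Cplus_assoc, <- cbox_plus. f_equal.
  apply cbox_ext; intros; ring.
Qed.

Lemma half_line_B M l l' s (chi : Z -> C) x : 0 < x ->
  (forall n, Cmod (chi n) <= K * powerRZ x n) ->
  box M (fun m => f m * powerRZ x (- m)) <= s ->
  Cmod (cbox M (fun m => chi (Z.of_nat l - m)%Z * (- RtoC (f m) * phi (m - Z.of_nat l')%Z))%C)
   <= K * K * s * x ^ l.
Proof.
  intros hx Hc Hs.
  assert (f0 : forall m, 0 < f m) by (intros; apply ffun_pos; assumption).
  eapply Rle_trans; [apply (Cmod_cbox_le _ _ (fun m => K * K * x ^ l * (f m * powerRZ x (- m))))|].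
  - intros m. rewrite !Cmod_mult, Cmod_opp, Cmod_R, Rabs_pos_eq by (apply Rlt_le, f0).
    replace (K * K * x ^ l * (f m * powerRZ x (- m))) with ((K * (x ^ l * powerRZ x (- m))) * (f m * K)) by ring.
    rewrite <- powerRZ_nat_minus by assumption.
    apply Rmult_le_compat; auto using Cmod_ge_0.
    + apply Rmult_le_pos; [apply Rlt_le, f0|apply Cmod_ge_0].
    + apply Rmult_le_compat_l; [apply Rlt_le, f0|auto].
  - rewrite box_scal. replace (K * K * s * x ^ l) with (K * K * x ^ l * s) by ring.
    apply Rmult_le_compat_l; [|assumption].
    repeat apply Rmult_le_pos; try lra. apply pow_le; lra.
Qed.

(** [1 + Bc] has the determinant of [1 + B], and [Bc] differs from [Bd] by a vanishing factor times
    K4 sg^l. As the bounds decay in the row index alone, [detC_compare] is applied with column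
    weight 1. *)
Lemma half_line_lim :
  Clim (fun M => detC M (fun l l' => dltC l l' + B M l l') - detC M (fun l l' => dltC l l' + Bd M l l'))%C (RtoC 0).
Proof.
  destruct (box_ffun_bound q tau th hq hth htau) as [s1 [s10 Hs1]].
  destruct (box_ffun_bound q tau et hq het htau) as [s2 [s20 Hs2]].
  assert (f0 : forall m, 0 < f m) by (intros; apply ffun_pos; assumption).
  assert (x0 : 0 < / th2) by (apply Rinv_0_lt_compat; lra).
  assert (x1 : / th2 < 1) by (rewrite <- Rinv_1; apply Rinv_lt_contravar; lra).
  assert (qe : 0 < q / et < 1).
  { split; [apply Rdiv_lt_0_compat; lra|]. apply (Rmult_lt_reg_r et); [lra|]. field_simplify; lra. }
  (* The residual of Psi Phi = 1 grows like th2^k in row k and [U] decays like (q / et)^k; the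
     hypothesis [th2 * q < et] makes their product summable. *)
  assert (qe2 : 0 < q / et * th2 < 1).
  { split; [apply Rmult_lt_0_compat; lra|]. apply (Rmult_lt_reg_r et); [lra|]. field_simplify; lra. }
  set (nu := Rmax th et). assert (n1 : th <= nu) by apply Rmax_l. assert (n2 : et <= nu) by apply Rmax_r.
  assert (n3 : nu < 1) by (apply Rmax_lub_lt; lra).
  (* The remainder om^(M - l) of the recurrence is small for small l only. Giving up part of the
     decay in l, from et to sg > et, yields et^l om^(M - l) <= sg^l ka^M for all l < M. *)
  set (sg := (1 + nu) / 2). assert (sg1 : nu < sg < 1) by (unfold sg; lra).
  set (ka := Rmax (et / sg) om).
  assert (k1 : et / sg <= ka) by apply Rmax_l. assert (k2 : om <= ka) by apply Rmax_r.
  assert (es : 0 < et / sg < 1).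
  { split; [apply Rdiv_lt_0_compat; lra|]. apply (Rmult_lt_reg_r sg); [lra|]. field_simplify; lra. }
  assert (k3 : 0 < ka < 1) by (split; [lra|apply Rmax_lub_lt; lra]).
  set (b1 := K * K * s1). set (b2 := K * K * s2).
  set (ku := tau * K). set (kq := ku * / (1 - q / et)).
  set (r1 := K * K * / (1 - / th2)). set (r2 := K * K * / (1 - th)).
  set (K3 := ku * r1 * / (1 - q / et * th2) + kq * r2 + b2).
  (* Sum of all constants met below, so that each separate bound uses some of its summands. *)
  set (K4 := ku + b1 + b2 + kq * b1 + K3).
  assert (K0 : 0 < K * K) by (apply Rmult_lt_0_compat; assumption).
  assert (b10 : 0 < b1) by (apply Rmult_lt_0_compat; assumption).
  assert (b20 : 0 < b2) by (apply Rmult_lt_0_compat; assumption).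
  assert (ku0 : 0 < ku) by (apply Rmult_lt_0_compat; assumption).
  assert (kq0 : 0 < kq) by (apply Rmult_lt_0_compat; [assumption|apply Rinv_0_lt_compat; lra]).
  assert (r10 : 0 < r1) by (apply Rmult_lt_0_compat; [assumption|apply Rinv_0_lt_compat; lra]).
  assert (r20 : 0 < r2) by (apply Rmult_lt_0_compat; [assumption|apply Rinv_0_lt_compat; lra]).
  assert (u10 : 0 < ku * r1 * / (1 - q / et * th2)).
  { apply Rmult_lt_0_compat; [now apply Rmult_lt_0_compat|apply Rinv_0_lt_compat; lra]. }
  assert (u20 : 0 < kq * r2) by (apply Rmult_lt_0_compat; assumption).
  assert (u30 : 0 < kq * b1) by (apply Rmult_lt_0_compat; assumption).
  assert (K30 : 0 < K3) by (unfold K3; lra). assert (K40 : 0 < K4) by (unfold K4; lra).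
  assert (BB : forall M l l', Cmod (B M l l') <= b1 * th ^ l).
  { intros M l l'. apply half_line_B; auto; lra. }
  assert (th_sg : forall l, th ^ l <= sg ^ l) by (intros; apply pow_incr; lra).
  assert (et_sg : forall l, et ^ l <= sg ^ l) by (intros; apply pow_incr; lra).
  assert (sgp : forall l, 0 < sg ^ l) by (intros; apply pow_lt; lra).
  assert (BC : forall M l l', (l < M)%nat -> (l' < M)%nat -> Cmod (Bc M l l') <= K4 * sg ^ l).
  { intros M l l' hl hl'. unfold Bc.
    assert (t1 : Cmod (U l l') <= ku * sg ^ l).
    { eapply Rle_trans; [apply half_line_U|]. fold ku.
      assert ((q / et) ^ l' <= 1).
      { rewrite <- (pow1 l'). apply pow_incr; lra. }
      assert (0 <= (q / et) ^ l') by (apply pow_le; lra). assert (h := et_sg l).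
      assert (0 < et ^ l) by (apply pow_lt; lra).
      apply Rle_trans with (ku * et ^ l * 1); [|rewrite Rmult_1_r; apply Rmult_le_compat_l; lra].
      apply Rmult_le_compat_l; [apply Rmult_le_pos; lra|assumption]. }
    assert (t2 : Cmod (csum M (fun k => U l k * B M k l')%C) <= kq * b1 * sg ^ l).
    { eapply Rle_trans; [apply (csum_geom_le _ _ (ku * et ^ l * b1) (q / et)); [lra| |]|].
      - repeat apply Rmult_le_pos; try lra. apply pow_le; lra.
      - intros k hk. rewrite Cmod_mult.
        replace (ku * et ^ l * b1 * (q / et) ^ k) with ((tau * K * et ^ l * (q / et) ^ k) * b1) by (unfold ku; ring).
        apply Rmult_le_compat; try apply Cmod_ge_0; [apply half_line_U|].
        eapply Rle_trans; [apply BB|]. rewrite <- (Rmult_1_r b1) at 2. apply Rmult_le_compat_l; [lra|].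
        rewrite <- (pow1 k). apply pow_incr; lra.
      - replace (ku * et ^ l * b1 / (1 - q / et)) with (kq * b1 * et ^ l) by (unfold kq, Rdiv; ring).
        apply Rmult_le_compat_l; [lra|apply et_sg]. }
    assert (t3 : Cmod (B M l l') <= b1 * sg ^ l).
    { eapply Rle_trans; [apply BB|]. apply Rmult_le_compat_l; [lra|apply th_sg]. }
    eapply Rle_trans; [apply Cmod_triangle|].
    eapply Rle_trans; [apply Rplus_le_compat; [apply Cmod_triangle|exact t2]|].
    assert (0 < (b2 + K3) * sg ^ l) by (apply Rmult_lt_0_compat; [lra|apply sgp]).
    unfold K4. lra. }
  assert (BD : forall M l l', Cmod (Bd M l l') <= K4 * sg ^ l).
  { intros M l l'. unfold Bd.
    rewrite (cbox_ext _ _ (fun m => psi (Z.of_nat l - m)%Z * (- RtoC (f m) * phi (m - Z.of_nat l')%Z)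
      + - (1) * (psi' (Z.of_nat l - m)%Z * (- RtoC (f m) * phi (m - Z.of_nat l')%Z)))%C) by (intros; ring).
    rewrite cbox_plus, cbox_scal. eapply Rle_trans; [apply Cmod_triangle|].
    rewrite Cmod_mult, Cmod_m1, Rmult_1_l.
    assert (t1 := BB M l l'). unfold B in t1.
    assert (t2 := half_line_B M l l' s2 psi' et ltac:(lra) Hpsi' (Hs2 M)).
    assert (h1 := th_sg l). assert (h2 := et_sg l).
    assert (b1 * th ^ l <= b1 * sg ^ l) by (apply Rmult_le_compat_l; lra).
    assert (b2 * et ^ l <= b2 * sg ^ l) by (apply Rmult_le_compat_l; lra).
    assert (0 < (ku + kq * b1 + K3) * sg ^ l) by (apply Rmult_lt_0_compat; [lra|apply sgp]).
    fold b2 in t2. unfold K4. lra. }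
  assert (BE : forall M l l', (l < M)%nat -> (l' < M)%nat ->
     Cmod (Bc M l l' - Bd M l l') <= ((/ th2) ^ M + th ^ M + ka ^ M) * (K4 * sg ^ l)).
  { intros M l l' hl hl'. rewrite half_line_diff by assumption.
    assert (xM : 0 < (/ th2) ^ M) by (apply pow_lt; lra). assert (tM : 0 < th ^ M) by (apply pow_lt; lra).
    assert (el : 0 < et ^ l) by (apply pow_lt; lra).
    eapply Rle_trans; [apply Cmod_triangle|].
    assert (t1 : Cmod (csum M (fun k => U l k * (dltC k l' - cbox M (fun m =>
        psi (Z.of_nat k - m)%Z * phi (m - Z.of_nat l')%Z)))%C)
        <= et ^ l * (ku * r1 * / (1 - q / et * th2) * (/ th2) ^ M + kq * r2 * th ^ M)).
    { eapply Rle_trans; [apply (Cmod_csum_le _ _ (fun k => (ku * et ^ l * r1 * (/ th2) ^ M) * (q / et * th2) ^ k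
         + (ku * et ^ l * r2 * th ^ M) * (q / et) ^ k))|].
      - intros k hk. rewrite Cmod_mult.
        apply Rle_trans with ((tau * K * et ^ l * (q / et) ^ k) * (r1 * (th2 ^ k * (/ th2) ^ M) + r2 * th ^ M)).
        + apply Rmult_le_compat; try apply Cmod_ge_0; [apply half_line_U|now apply half_line_resid].
        + right. rewrite (Rpow_mult_distr (q / et)). unfold ku; ring.
      - rewrite rsum_plus, !rsum_scal.
        assert (g1 := rsum_geom M (q / et * th2) ltac:(lra)). assert (g2 := rsum_geom M (q / et) ltac:(lra)).
        replace (et ^ l * (ku * r1 * / (1 - q / et * th2) * (/ th2) ^ M + kq * r2 * th ^ M))
          with ((ku * et ^ l * r1 * (/ th2) ^ M) * / (1 - q / et * th2) + (ku * et ^ l * r2 * th ^ M) * / (1 - q / et))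
          by (unfold kq; ring).
        apply Rplus_le_compat; (apply Rmult_le_compat_l; [apply Rmult4_pos; assumption|assumption]). }
    assert (t2 : Cmod (cbox M (fun m => RtoC (f m) * phi (m - Z.of_nat l')%Z * - (psi' (Z.of_nat l - m)%Z -
       csum (M - l) (fun s => rho s * RtoC (powerRZ q (Z.of_nat l - m + Z.of_nat s)) *
          psi (Z.of_nat l - m + Z.of_nat s)%Z)))%C) <= b2 * (et ^ l * om ^ (M - l))).
    { eapply Rle_trans; [apply (Cmod_cbox_le _ _ (fun m => (K * K * (et ^ l * om ^ (M - l))) *
         (f m * powerRZ et (- m))))|].
      - intros m. rewrite !Cmod_mult, Cmod_opp, Cmod_R, Rabs_pos_eq by (apply Rlt_le, f0).
        apply Rle_trans with (f m * K * (K * powerRZ et (Z.of_nat l - m) * om ^ (M - l))).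
        + apply Rmult_le_compat; try apply Cmod_ge_0.
          * apply Rmult_le_pos; [apply Rlt_le, f0|apply Cmod_ge_0].
          * apply Rmult_le_compat_l; [apply Rlt_le, f0|auto].
          * apply Hrec.
        + right. rewrite powerRZ_nat_minus by lra. ring.
      - rewrite box_scal. unfold b2.
        replace (K * K * s2 * (et ^ l * om ^ (M - l))) with ((K * K * (et ^ l * om ^ (M - l))) * s2) by ring.
        apply Rmult_le_compat_l; [|apply Hs2].
        repeat apply Rmult_le_pos; try lra. apply pow_le; lra. }
    assert (t3 : et ^ l * om ^ (M - l) <= sg ^ l * ka ^ M).
    { replace (et ^ l) with (sg ^ l * (et / sg) ^ l).
      - rewrite Rmult_assoc. apply Rmult_le_compat_l; [apply Rlt_le, sgp|].
        replace M with (l + (M - l))%nat at 2 by lia. rewrite pow_add.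
        apply Rmult_le_compat; try (apply pow_le; lra); apply pow_incr; lra.
      - rewrite <- Rpow_mult_distr. f_equal. field. lra. }
    assert (t4 : b2 * (et ^ l * om ^ (M - l)) <= b2 * (sg ^ l * ka ^ M)) by (apply Rmult_le_compat_l; lra).
    assert (kM : 0 < ka ^ M) by (apply pow_lt; lra).
    assert (t5 : et ^ l * (ku * r1 * / (1 - q / et * th2) * (/ th2) ^ M + kq * r2 * th ^ M)
       <= sg ^ l * (K3 * ((/ th2) ^ M + th ^ M))).
    { apply Rmult_le_compat; [lra| |apply et_sg|].
      - apply Rplus_le_le_0_compat; apply Rmult_le_pos; lra.
      - set (A1 := ku * r1 * / (1 - q / et * th2)) in *. set (A2 := kq * r2) in *.
        assert (A1 * (/ th2) ^ M <= K3 * (/ th2) ^ M) by (apply Rmult_le_compat_r; unfold K3; lra).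
        assert (A2 * th ^ M <= K3 * th ^ M) by (apply Rmult_le_compat_r; unfold K3; lra).
        lra. }
    eapply Rle_trans; [apply Rplus_le_compat; [exact t1|exact t2]|].
    apply Rle_trans with (sg ^ l * (K3 * ((/ th2) ^ M + th ^ M)) + b2 * (sg ^ l * ka ^ M)); [lra|].
    replace (((/ th2) ^ M + th ^ M + ka ^ M) * (K4 * sg ^ l)) with
      (sg ^ l * (K4 * ((/ th2) ^ M + th ^ M)) + K4 * (sg ^ l * ka ^ M)) by ring.
    apply Rplus_le_compat.
    - apply Rmult_le_compat_l; [apply Rlt_le, sgp|]. apply Rmult_le_compat_r; [lra|unfold K4; lra].
    - apply Rmult_le_compat_r; [apply Rmult_le_pos; [apply Rlt_le, sgp|lra]|unfold K4; lra]. }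
  set (S := sqrt K4 * / (1 - sqrt sg)).
  assert (ss : 0 <= sqrt sg < 1).
  { split; [apply sqrt_pos|]. rewrite <- sqrt_1. apply sqrt_lt_1; lra. }
  apply Clim_squeeze0 with (fun M => (S * S * exp (S * S)) * (/ th2) ^ M + (S * S * exp (S * S)) * th ^ M
     + (S * S * exp (S * S)) * ka ^ M).
  - intros M. rewrite <- half_line_det.
    replace ((S * S * exp (S * S)) * (/ th2) ^ M + (S * S * exp (S * S)) * th ^ M
     + (S * S * exp (S * S)) * ka ^ M) with (((/ th2) ^ M + th ^ M + ka ^ M) * (S * S * exp (S * S))) by ring.
    assert (psq : forall l, (sqrt K4 * sqrt sg ^ l) ^ 2 = K4 * sg ^ l).
    { intros l. rewrite Rpow_mult_distr, pow2_sqrt by lra. f_equal.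
      rewrite <- pow_mult, Nat.mul_comm, pow_mult, pow2_sqrt by lra. reflexivity. }
    apply (detC_compare M (Bc M) (Bd M) (fun l => sqrt K4 * sqrt sg ^ l) (fun _ => 1)).
    + assert (0 < (/ th2) ^ M) by (apply pow_lt; lra). assert (0 < th ^ M) by (apply pow_lt; lra).
      assert (0 < ka ^ M) by (apply pow_lt; lra). lra.
    + intros; apply Rmult_lt_0_compat; [now apply sqrt_lt_R0|apply pow_lt, sqrt_lt_R0; lra].
    + intros; lra.
    + intros; rewrite psq, pow1, Rmult_1_r; auto.
    + intros; rewrite psq, pow1, Rmult_1_r; auto.
    + intros; rewrite psq, pow1, Rmult_1_r; auto.
    + rewrite (rsum_ext _ _ (fun l => sqrt K4 * sqrt sg ^ l)) by (intros; ring).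
      rewrite rsum_scal. apply Rmult_le_compat_l; [apply sqrt_pos|now apply rsum_geom].
  - replace (Finite 0) with (Finite (0 + 0 + 0)) by (f_equal; ring).
    apply is_lim_seq_plus'; [apply is_lim_seq_plus'|]; apply is_lim_geom0; lra.
Qed.

Theorem fredholm_det_eq (A1 A2 : Z -> Z -> C) :
  (forall m m', Clim (fun L => csum L (fun l =>
      - RtoC (f m) * phi (m - Z.of_nat l)%Z * psi (Z.of_nat l - m')%Z)%C) (A1 m m')) ->
  (forall m m', Clim (fun L => csum L (fun l =>
      - RtoC (f m) * phi (m - Z.of_nat l)%Z * (psi (Z.of_nat l - m')%Z - psi' (Z.of_nat l - m')%Z))%C) (A2 m m')) ->
  exists d, is_fredholm_det A2 d /\ is_fredholm_det A1 d.
Proof.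
  intros H1 H2.
  assert (f0 : forall m, 0 < f m) by (intros; apply ffun_pos; assumption).
  (* One weight for both kernels: th^(-m) controls psi and et^(-m) controls psi'. *)
  set (be := fun m => powerRZ th (- m) + powerRZ et (- m)).
  assert (tp : forall m, 0 < powerRZ th m) by (intros; apply powerRZ_lt; lra).
  assert (ep : forall m, 0 < powerRZ et m) by (intros; apply powerRZ_lt; lra).
  assert (be0 : forall m, 0 < be m) by (intros m; specialize (tp (- m)%Z); specialize (ep (- m)%Z); unfold be; lra).
  destruct (box_sqrt_bound q tau th et hq hth het htau) as [s Hs].
  set (nu := Rmax th et). assert (n1 : th <= nu) by apply Rmax_l. assert (n2 : et <= nu) by apply Rmax_r.
  assert (n3 : nu < 1) by (apply Rmax_lub_lt; lra).
  assert (c1 : forall (l : nat) m, Cmod (psi (Z.of_nat l - m)%Z) <= K * powerRZ th (- m) * nu ^ l).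
  { intros l m. eapply Rle_trans; [apply Hpsi|]. rewrite powerRZ_nat_minus by lra.
    replace (K * (th ^ l * powerRZ th (- m))) with (K * powerRZ th (- m) * th ^ l) by ring.
    apply Rmult_le_compat_l; [apply Rmult_le_pos; [lra|apply Rlt_le, tp]|apply pow_incr; lra]. }
  assert (c2 : forall (l : nat) m, Cmod (psi' (Z.of_nat l - m)%Z) <= K * powerRZ et (- m) * nu ^ l).
  { intros l m. eapply Rle_trans; [apply Hpsi'|]. rewrite powerRZ_nat_minus by lra.
    replace (K * (et ^ l * powerRZ et (- m))) with (K * powerRZ et (- m) * et ^ l) by ring.
    apply Rmult_le_compat_l; [apply Rmult_le_pos; [lra|apply Rlt_le, ep]|apply pow_incr; lra]. }
  assert (nl : forall l, 0 <= nu ^ l) by (intros; apply pow_le; lra).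
  destruct (fredholm_half_line f be phi psi A1 K nu s) as [d1 [F1 L1]]; auto; [lra| |].
  { intros l m. eapply Rle_trans; [apply c1|]. apply Rmult_le_compat_r; [apply nl|].
    apply Rmult_le_compat_l; [lra|]. specialize (ep (- m)%Z). unfold be. lra. }
  destruct (fredholm_half_line f be phi (fun n => psi n - psi' n)%C A2 K nu s) as [d2 [F2 L2]]; auto; [lra| |].
  { intros l m. eapply Rle_trans; [apply Cmod_triangle|]. rewrite Cmod_opp.
    specialize (c1 l m). specialize (c2 l m). unfold be.
    replace (K * (powerRZ th (- m) + powerRZ et (- m)) * nu ^ l) with
      (K * powerRZ th (- m) * nu ^ l + K * powerRZ et (- m) * nu ^ l) by ring. lra. }
  exists d1; split; [|exact F1].
  replace d1 with d2; [exact F2|].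
  apply (Clim_unique _ _ _ L2).
  apply Clim_ext with (fun M => detC M (fun l l' => dltC l l' + B M l l') + - (1) * (detC M (fun l l' => dltC l l' + B M l l')
     - detC M (fun l l' => dltC l l' + Bd M l l')))%C; [intros; unfold Bd; ring|].
  replace d1 with (d1 + - (1) * RtoC 0)%C by ring.
  apply Clim_plus; [exact L1|]. apply Clim_scal, half_line_lim.
Qed.
End HalfLine.

(** * q-Pochhammer symbols *)

Lemma Cmod_minus_sym x y : Cmod (x - y) = Cmod (y - x).
Proof. rewrite <- Cmod_opp; f_equal; ring. Qed.

Lemma Cmod_sub_ge x y : Cmod x - Cmod y <= Cmod (x - y).
Proof.
  assert (h := Cmod_triangle (x - y) y).
  replace (x - y + y)%C with x in h by ring. lra.
Qed.

Lemma Cmult_neq0 x y : x <> RtoC 0 -> y <> RtoC 0 -> (x * y)%C <> RtoC 0.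
Proof. intros; apply Cmult_neq_0; assumption. Qed.

(** * Continuity of complex functions, and finite products *)

Definition cont_at (F : C -> C) (w : C) : Prop :=
  forall eps, 0 < eps -> exists del, 0 < del /\
    forall w', Cmod (w' - w) < del -> Cmod (F w' - F w) < eps.

Lemma cont_const c w : cont_at (fun _ => c) w.
Proof.
  intros eps he; exists 1; split; [lra|]. intros.
  replace (c - c)%C with (RtoC 0) by ring. now rewrite Cmod_0.
Qed.

Lemma cont_id w : cont_at (fun x => x) w.
Proof. intros eps he; exists eps; auto. Qed.

Lemma cont_ext_near F G w d : 0 < d -> (forall w', Cmod (w' - w) < d -> F w' = G w') ->
  cont_at F w -> cont_at G w.
Proof.
  intros hd E H eps he. destruct (H eps he) as [del [h1 h2]].
  exists (Rmin d del); split; [now apply Rmin_pos|]. intros w' hw.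
  rewrite <- !E.
  - apply h2. eapply Rlt_le_trans; [exact hw|apply Rmin_r].
  - replace (w - w)%C with (RtoC 0) by ring. now rewrite Cmod_0.
  - eapply Rlt_le_trans; [exact hw|apply Rmin_l].
Qed.

Lemma cont_ext F G w : (forall w', F w' = G w') -> cont_at F w -> cont_at G w.
Proof. intros E; apply (cont_ext_near F G w 1); [lra|auto]. Qed.

Lemma cont_plus F G w : cont_at F w -> cont_at G w -> cont_at (fun x => F x + G x)%C w.
Proof.
  intros HF HG eps he.
  destruct (HF (eps / 2) ltac:(lra)) as [d1 [h1 H1]]. destruct (HG (eps / 2) ltac:(lra)) as [d2 [h2 H2]].
  exists (Rmin d1 d2); split; [now apply Rmin_pos|]. intros w' hw.
  replace (F w' + G w' - (F w + G w))%C with ((F w' - F w) + (G w' - G w))%C by ring.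
  eapply Rle_lt_trans; [apply Cmod_triangle|].
  specialize (H1 w' (Rlt_le_trans _ _ _ hw (Rmin_l _ _))).
  specialize (H2 w' (Rlt_le_trans _ _ _ hw (Rmin_r _ _))). lra.
Qed.

Lemma cont_mult F G w : cont_at F w -> cont_at G w -> cont_at (fun x => F x * G x)%C w.
Proof.
  intros HF HG eps he.
  set (A := Cmod (F w) + 1). set (B := Cmod (G w) + 1).
  assert (A0 : 1 <= A) by (unfold A; assert (h := Cmod_ge_0 (F w)); lra).
  assert (B0 : 1 <= B) by (unfold B; assert (h := Cmod_ge_0 (G w)); lra).
  destruct (HF (eps / (2 * B))) as [d1 [h1 H1]]; [apply Rdiv_lt_0_compat; lra|].
  destruct (HG (Rmin 1 (eps / (2 * A)))) as [d2 [h2 H2]];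
    [apply Rmin_pos; [lra|apply Rdiv_lt_0_compat; lra]|].
  exists (Rmin d1 d2); split; [now apply Rmin_pos|]. intros w' hw.
  specialize (H1 w' (Rlt_le_trans _ _ _ hw (Rmin_l _ _))).
  specialize (H2 w' (Rlt_le_trans _ _ _ hw (Rmin_r _ _))).
  assert (H3 := Rlt_le_trans _ _ _ H2 (Rmin_l _ _)).
  assert (H4 := Rlt_le_trans _ _ _ H2 (Rmin_r _ _)).
  replace (F w' * G w' - F w * G w)%C with ((F w' - F w) * G w' + F w * (G w' - G w))%C by ring.
  eapply Rle_lt_trans; [apply Cmod_triangle|]. rewrite !Cmod_mult.
  assert (g : Cmod (G w') <= B).
  { assert (h := Cmod_sub_ge (G w') (G w)). unfold B; lra. }
  assert (t1 : Cmod (F w' - F w) * Cmod (G w') <= eps / (2 * B) * B).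
  { apply Rmult_le_compat; auto using Cmod_ge_0; lra. }
  assert (t2 : Cmod (F w) * Cmod (G w' - G w) < A * (eps / (2 * A))).
  { apply Rle_lt_trans with (Cmod (F w) * (eps / (2 * A))).
    - apply Rmult_le_compat_l; [apply Cmod_ge_0|lra].
    - apply Rmult_lt_compat_r; [apply Rdiv_lt_0_compat; lra|unfold A; lra]. }
  replace (eps / (2 * B) * B) with (eps / 2) in t1 by (field; lra).
  replace (A * (eps / (2 * A))) with (eps / 2) in t2 by (field; lra). lra.
Qed.

Lemma cont_inv F w : F w <> RtoC 0 -> cont_at F w -> cont_at (fun x => / F x)%C w.
Proof.
  intros hF HF eps he. assert (a0 : 0 < Cmod (F w)) by now apply Cmod_gt_0.
  set (a := Cmod (F w)) in *.
  destruct (HF (Rmin (a / 2) (eps * (a * a) / 2))) as [d [h1 H1]].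
  { apply Rmin_pos; [lra|]. apply Rdiv_lt_0_compat; [|lra]. repeat apply Rmult_lt_0_compat; lra. }
  exists d; split; [assumption|]. intros w' hw. specialize (H1 w' hw).
  assert (H2 := Rlt_le_trans _ _ _ H1 (Rmin_l _ _)).
  assert (H3 := Rlt_le_trans _ _ _ H1 (Rmin_r _ _)).
  assert (b : a / 2 < Cmod (F w')).
  { assert (h := Cmod_sub_ge (F w) (F w')). rewrite Cmod_minus_sym in h. fold a in h. lra. }
  assert (hF' : F w' <> RtoC 0) by (apply Cmod_gt_0; lra).
  replace (/ F w' - / F w)%C with (- (F w' - F w) / (F w' * F w))%C by (field; auto).
  rewrite Cmod_div, Cmod_opp, Cmod_mult by now apply Cmult_neq0.
  fold a. apply (Rmult_lt_reg_r (Cmod (F w') * a)); [apply Rmult_lt_0_compat; lra|].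
  unfold Rdiv; rewrite Rmult_assoc, Rinv_l, Rmult_1_r by (apply Rgt_not_eq, Rmult_lt_0_compat; lra).
  eapply Rlt_le_trans; [exact H3|].
  replace (eps * (a * a) / 2) with (eps * (a / 2 * a)) by field.
  apply Rmult_le_compat_l; [lra|]. apply Rmult_le_compat_r; lra.
Qed.

Lemma cont_lipschitz F w d L : 0 < d -> 0 <= L ->
  (forall w', Cmod (w' - w) < d -> Cmod (F w' - F w) <= L * Cmod (w' - w)) -> cont_at F w.
Proof.
  intros hd hL H eps he.
  exists (Rmin d (eps / (L + 1))); split.
  { apply Rmin_pos; [assumption|apply Rdiv_lt_0_compat; lra]. }
  intros w' hw. assert (h1 := Rlt_le_trans _ _ _ hw (Rmin_l _ _)).
  assert (h2 := Rlt_le_trans _ _ _ hw (Rmin_r _ _)).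
  eapply Rle_lt_trans; [apply H, h1|].
  assert (c0 := Cmod_ge_0 (w' - w)).
  apply Rle_lt_trans with ((L) * (eps / (L + 1))); [apply Rmult_le_compat_l; lra|].
  apply (Rmult_lt_reg_r (L + 1)); [lra|]. field_simplify; [|lra]. nra.
Qed.

Lemma cont_comp F G w : cont_at G w -> cont_at F (G w) -> cont_at (fun x => F (G x)) w.
Proof.
  intros HG HF eps he. destruct (HF eps he) as [d1 [h1 H1]].
  destruct (HG d1 h1) as [d2 [h2 H2]]. exists d2; auto.
Qed.

Lemma cont_prodC n (F : C -> nat -> C) w : (forall i, (i < n)%nat -> cont_at (fun x => F x i) w) ->
  cont_at (fun x => prodC n (F x)) w.
Proof.
  induction n as [|n IH]; intros H; simpl; [apply cont_const|].
  apply cont_mult; [apply IH; intros; apply H|apply H]; lia.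
Qed.

Lemma prodC_ext n F G : (forall i, (i < n)%nat -> F i = G i) -> prodC n F = prodC n G.
Proof.
  induction n as [|n IH]; intros H; simpl; [easy|].
  rewrite IH, (H n); auto; intros; apply H; lia.
Qed.

Lemma prodC_mult n F G : prodC n (fun i => F i * G i)%C = (prodC n F * prodC n G)%C.
Proof. induction n as [|n IH]; simpl; [|rewrite IH]; ring. Qed.

Lemma prodC_neq0 n F : (forall i, (i < n)%nat -> F i <> RtoC 0) -> prodC n F <> RtoC 0.
Proof.
  induction n as [|n IH]; intros H; simpl.
  - intros E; apply R1_neq_R0; now injection E.
  - apply Cmult_neq0; [apply IH; intros; apply H|apply H]; lia.
Qed.

(** Each factor has modulus at most 2, so the error obeys x -> 2 x + e, which produces 2^n - 1. *)
Lemma prodC_near1 n F e : 0 <= e <= 1 -> (forall i, (i < n)%nat -> Cmod (F i - 1) <= e) ->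
  Cmod (prodC n F - 1) <= (2 ^ n - 1) * e.
Proof.
  intros he; induction n as [|n IH]; intros H; simpl.
  - replace (RtoC 1 - 1)%C with (RtoC 0) by ring. rewrite Cmod_0; lra.
  - replace (prodC n F * F n - 1)%C with ((prodC n F - 1) * F n + (F n - 1))%C by ring.
    eapply Rle_trans; [apply Cmod_triangle|]. rewrite Cmod_mult.
    assert (h1 := H n (Nat.lt_succ_diag_r n)).
    assert (h2 : Cmod (F n) <= 2).
    { assert (h := Cmod_sub_ge (F n) 1). rewrite Cmod_1 in h. lra. }
    assert (h3 := IH (fun i hi => H i (Nat.lt_lt_succ_r _ _ hi))).
    assert (h4 := Cmod_ge_0 (prodC n F - 1)).
    assert (Cmod (prodC n F - 1) * Cmod (F n) <= (2 ^ n - 1) * e * 2).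
    { apply Rmult_le_compat; auto using Cmod_ge_0. }
    lra.
Qed.

Lemma Cinv_near1 y e : 0 <= e <= / 2 -> Cmod (y - 1) <= e -> y <> RtoC 0 /\ Cmod (/ y - 1) <= 2 * e.
Proof.
  intros he hy.
  assert (h : / 2 <= Cmod y).
  { assert (h := Cmod_sub_ge 1 y). rewrite Cmod_1, Cmod_minus_sym in h. lra. }
  assert (y0 : y <> RtoC 0) by (apply Cmod_gt_0; lra).
  split; [assumption|].
  replace (/ y - 1)%C with (- (y - 1) / y)%C by (field; assumption).
  rewrite Cmod_div, Cmod_opp by assumption.
  apply (Rmult_le_reg_r (Cmod y)); [lra|]. unfold Rdiv; rewrite Rmult_assoc, Rinv_l by lra.
  nra.
Qed.

Lemma limC_unique u l : Clim u l -> limC u = l.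
Proof.
  intros H.
  assert (part : forall g : C -> R, (forall x y, Rabs (g x - g y) <= Cmod (x - y)) ->
     is_lim_seq (fun n => g (u n)) (g l)).
  { intros g hg. apply is_lim_seq_spec. intros eps.
    destruct (H eps (cond_pos eps)) as [N HN]. exists N; intros n hn.
    eapply Rle_lt_trans; [apply hg|auto]. }
  assert (h1 : is_lim_seq (fun n => fst (u n)) (fst l)).
  { apply part; intros x y. eapply Rle_trans; [|apply (Rmax_Cmod (x - y)%C)]. apply Rmax_l. }
  assert (h2 : is_lim_seq (fun n => snd (u n)) (snd l)).
  { apply part; intros x y. eapply Rle_trans; [|apply (Rmax_Cmod (x - y)%C)]. apply Rmax_r. }
  unfold limC. rewrite (is_lim_seq_unique _ _ h1), (is_lim_seq_unique _ _ h2).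
  now destruct l.
Qed.

Lemma Clim_geom_ex c K x : 0 <= x < 1 -> (forall n, Cmod (c n) <= K * x ^ n) ->
  exists l, Clim (fun n => csum n c) l.
Proof.
  intros hx Hc.
  assert (exr : ex_series (fun n => K * x ^ n)).
  { apply (ex_series_scal_l K (fun n => x ^ n)). exists (/ (1 - x)).
    apply is_series_geom. rewrite Rabs_pos_eq; lra. }
  assert (ex1 : ex_series (fun n => fst (c n))).
  { apply (ex_series_le (V := R_CompleteNormedModule) (fun n => fst (c n)) (fun n => K * x ^ n)); [|exact exr]. intros n.
    eapply Rle_trans; [|apply Hc]. eapply Rle_trans; [apply Rmax_l|apply Rmax_Cmod]. }
  assert (ex2 : ex_series (fun n => snd (c n))).
  { apply (ex_series_le (V := R_CompleteNormedModule) (fun n => snd (c n)) (fun n => K * x ^ n)); [|exact exr]. intros n.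
    eapply Rle_trans; [|apply Hc]. eapply Rle_trans; [apply Rmax_r|apply Rmax_Cmod]. }
  destruct ex1 as [d1 hd1]. destruct ex2 as [d2 hd2]. exists (d1, d2).
  apply Clim_parts; simpl fst; simpl snd; apply is_lim_seq_incr_1.
  - eapply is_lim_seq_ext; [|exact hd1]. intros n; rewrite sum_n_rsum. apply rsum_fst.
  - eapply is_lim_seq_ext; [|exact hd2]. intros n; rewrite sum_n_rsum. apply rsum_snd.
Qed.

(** * The infinite product (x; q)_oo as a limit of finite ones *)

Definition qprod (q : R) (J : nat) (x : C) : C :=
  prodC J (fun j => Cminus (RtoC 1) (Cmult x (RtoC (q ^ j)))).

Section QPoch.
Context (q : R) (hq : 0 < q < 1).

Lemma qsum_bound J : 0 <= rsum J (fun j => q ^ j) <= / (1 - q).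
Proof.
  split; [apply rsum_ge0; intros; apply pow_le; lra|apply rsum_geom; lra].
Qed.

Lemma Cmod_qfac X x j : Cmod x <= X -> Cmod (1 - x * RtoC (q ^ j)) <= 1 + X * q ^ j.
Proof.
  intros hx. eapply Rle_trans; [apply Cmod_triangle|].
  assert (0 < q ^ j) by (apply pow_lt; lra).
  rewrite Cmod_1, Cmod_opp, Cmod_mult, Cmod_R, Rabs_pos_eq by lra.
  apply Rplus_le_compat_l, Rmult_le_compat_r; lra.
Qed.

Lemma Cmod_qprod X x J : Cmod x <= X ->
  Cmod (qprod q J x) <= exp (X * rsum J (fun j => q ^ j)).
Proof.
  intros hx; induction J as [|J IH].
  - change (qprod q 0 x) with (RtoC 1). simpl rsum. rewrite Cmod_1, Rmult_0_r, exp_0; lra.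
  - unfold qprod in *; simpl prodC; simpl rsum. rewrite Cmod_mult, Rmult_plus_distr_l, exp_plus.
    apply Rmult_le_compat; auto using Cmod_ge_0.
    eapply Rle_trans; [apply (Cmod_qfac X x J hx)|apply exp_ineq1_le].
Qed.

Lemma qprod_lipschitz_sum X x y J : Cmod x <= X -> Cmod y <= X ->
  Cmod (qprod q J x - qprod q J y) <=
  Cmod (x - y) * (rsum J (fun j => q ^ j) * exp (X * rsum J (fun j => q ^ j))).
Proof.
  intros hx hy. induction J as [|J IH].
  - unfold qprod; simpl prodC. replace (RtoC 1 - RtoC 1)%C with (RtoC 0) by ring.
    rewrite Cmod_0; simpl; lra.
  - assert (hE := Cmod_qprod X y J hy). unfold qprod in *; simpl prodC in *; simpl rsum in *.
    set (P := prodC J (fun j => (1 - x * RtoC (q ^ j))%C)) in *.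
    set (Q := prodC J (fun j => (1 - y * RtoC (q ^ j))%C)) in *.
    set (s := rsum J (fun j => q ^ j)) in *.
    assert (qJ : 0 < q ^ J) by (apply pow_lt; lra).
    assert (s0 : 0 <= s) by apply qsum_bound.
    replace (P * (1 - x * RtoC (q ^ J)) - Q * (1 - y * RtoC (q ^ J)))%C with
      ((P - Q) * (1 - x * RtoC (q ^ J)) + Q * (- (x - y) * RtoC (q ^ J)))%C by ring.
    eapply Rle_trans; [apply Cmod_triangle|]. rewrite !Cmod_mult, Cmod_opp, Cmod_R, (Rabs_pos_eq (q ^ J)) by lra.
    assert (X0 : 0 <= X) by (eapply Rle_trans; [apply Cmod_ge_0|exact hx]).
    assert (hF := Cmod_qfac X x J hx).
    assert (e1 : 1 + X * q ^ J <= exp (X * q ^ J)) by apply exp_ineq1_le.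
    assert (e2 := exp_pos (X * s)). assert (c0 := Cmod_ge_0 (x - y)).
    rewrite (Rmult_plus_distr_l X), exp_plus.
    assert (t1 : Cmod (P - Q) * Cmod (1 - x * RtoC (q ^ J)) <=
       Cmod (x - y) * (s * exp (X * s)) * exp (X * q ^ J)).
    { apply Rmult_le_compat; auto using Cmod_ge_0. eapply Rle_trans; [exact hF|exact e1]. }
    assert (t2 : Cmod Q * (Cmod (x - y) * q ^ J) <= exp (X * s) * (Cmod (x - y) * q ^ J)).
    { apply Rmult_le_compat_r; [apply Rmult_le_pos; lra|exact hE]. }
    assert (t3 : exp (X * s) * (Cmod (x - y) * q ^ J) * 1 <=
       exp (X * s) * (Cmod (x - y) * q ^ J) * exp (X * q ^ J)).
    { apply Rmult_le_compat_l; [repeat apply Rmult_le_pos; lra|].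
      assert (0 <= X * q ^ J) by (apply Rmult_le_pos; lra). lra. }
    lra.
Qed.

(** A Lipschitz constant on |x| <= X valid for all partial products at once. It therefore survives
    the limit and yields both the continuity of (x; q)_oo and its behaviour near 0. *)
Definition qlip (X : R) : R := / (1 - q) * exp (X * / (1 - q)).

Lemma qlip_pos X : 0 < qlip X.
Proof. apply Rmult_lt_0_compat; [apply Rinv_0_lt_compat; lra|apply exp_pos]. Qed.

Lemma exp_le x y : x <= y -> exp x <= exp y.
Proof. intros [h| ->]; [left; now apply exp_increasing|lra]. Qed.

Lemma qprod_lipschitz X x y J : Cmod x <= X -> Cmod y <= X ->
  Cmod (qprod q J x - qprod q J y) <= qlip X * Cmod (x - y).
Proof.
  intros hx hy. eapply Rle_trans; [apply (qprod_lipschitz_sum X); assumption|].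
  rewrite Rmult_comm. apply Rmult_le_compat_r; [apply Cmod_ge_0|].
  assert (X0 : 0 <= X) by (eapply Rle_trans; [apply Cmod_ge_0|exact hx]).
  destruct (qsum_bound J) as [h1 h2].
  apply Rmult_le_compat; [assumption|apply Rlt_le, exp_pos|assumption|].
  apply exp_le, Rmult_le_compat_l; assumption.
Qed.

Lemma qprod_S J x : qprod q (S J) x = (qprod q J x * (1 - x * RtoC (q ^ J)))%C.
Proof. reflexivity. Qed.

(** [limC] returns some value even for a divergent sequence, so [qpoch] receives its meaning here:
    the partial products telescope into a series with terms of order q^j. *)
Lemma qprod_Clim x : Clim (fun J => qprod q J x) (qpoch x q).
Proof.
  assert (E : forall J, qprod q J x = (1 + csum J (fun j => qprod q (S j) x - qprod q j x))%C).
  { induction J as [|J IH]; simpl csum.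
    - unfold qprod; simpl; ring.
    - transitivity (qprod q J x + (qprod q (S J) x - qprod q J x))%C; [ring|].
      rewrite IH at 1. ring. }
  set (X := Cmod x).
  destruct (Clim_geom_ex (fun j => qprod q (S j) x - qprod q j x)%C (exp (X * / (1 - q)) * X) q) as [l Hl].
  - lra.
  - intros j. rewrite qprod_S.
    replace (qprod q j x * (1 - x * RtoC (q ^ j)) - qprod q j x)%C with
       (- (qprod q j x * (x * RtoC (q ^ j))))%C by ring.
    assert (0 < q ^ j) by (apply pow_lt; lra).
    rewrite Cmod_opp, !Cmod_mult, Cmod_R, Rabs_pos_eq, <- Rmult_assoc by lra.
    apply Rmult_le_compat_r; [lra|]. apply Rmult_le_compat_r; [apply Cmod_ge_0|].
    eapply Rle_trans; [apply (Cmod_qprod X); unfold X; lra|].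
    apply exp_le, Rmult_le_compat_l; [apply Cmod_ge_0|apply qsum_bound].
  - assert (H : Clim (fun J => qprod q J x) (1 + l)%C).
    { apply (Clim_ext (fun J => 1 + csum J (fun j => qprod q (S j) x - qprod q j x))%C).
      - intros; symmetry; apply E.
      - apply (Clim_plus (fun _ => RtoC 1)); [apply Clim_const|exact Hl]. }
    unfold qpoch. change (fun n => prodC n (fun j => (1 - x * RtoC (q ^ j))%C)) with (fun J => qprod q J x).
    now rewrite (limC_unique _ _ H).
Qed.

Lemma qpoch_lipschitz X x y : Cmod x <= X -> Cmod y <= X ->
  Cmod (qpoch x q - qpoch y q) <= qlip X * Cmod (x - y).
Proof.
  intros hx hy.
  apply (Clim_le (fun J => qprod q J x + - (1) * qprod q J y)%C).
  - replace (qpoch x q - qpoch y q)%C with (qpoch x q + - (1) * qpoch y q)%C by ring.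
    apply Clim_plus; [|apply Clim_scal]; apply qprod_Clim.
  - exists O; intros J _.
    replace (qprod q J x + - (1) * qprod q J y)%C with (qprod q J x - qprod q J y)%C by ring.
    now apply qprod_lipschitz.
Qed.

Lemma qprod_add J n x : qprod q (J + n) x = (qprod q J x * qprod q n (x * RtoC (q ^ J)))%C.
Proof.
  induction n as [|n IH].
  - rewrite Nat.add_0_r. unfold qprod at 3; simpl. ring.
  - rewrite Nat.add_succ_r, !qprod_S, IH, pow_add, RtoC_mult. ring.
Qed.

Lemma qpoch_split J x : qpoch x q = (qprod q J x * qpoch (x * RtoC (q ^ J)) q)%C.
Proof.
  apply (Clim_unique (fun n => qprod q (J + n) x)).
  - intros eps he. destruct (qprod_Clim x eps he) as [N HN]. exists N; intros n hn; apply HN; lia.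
  - apply (Clim_ext (fun n => qprod q J x * qprod q n (x * RtoC (q ^ J)))%C).
    + intros; symmetry; apply qprod_add.
    + apply Clim_scal, qprod_Clim.
Qed.

Lemma qpoch_0 : qpoch 0 q = RtoC 1.
Proof.
  apply (Clim_unique (fun J => qprod q J 0)); [apply qprod_Clim|].
  apply (Clim_ext (fun _ => RtoC 1)); [|apply Clim_const].
  induction n as [|n IH]; [easy|]. rewrite qprod_S, <- IH. ring.
Qed.

Lemma qpoch_near1 x : Cmod x <= 1 -> Cmod (qpoch x q - 1) <= qlip 1 * Cmod x.
Proof.
  intros hx. rewrite <- qpoch_0.
  replace (Cmod x) with (Cmod (x - 0)) by (f_equal; ring).
  apply qpoch_lipschitz; [assumption|rewrite Cmod_0; lra].
Qed.

Lemma qprod_neq0 J x : (forall j, (x * RtoC (q ^ j))%C <> RtoC 1) -> qprod q J x <> RtoC 0.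
Proof.
  intros H; apply prodC_neq0; intros j _ E. apply (H j).
  replace (x * RtoC (q ^ j))%C with (1 - (1 - x * RtoC (q ^ j)))%C by ring. rewrite E; ring.
Qed.

Lemma qpow_small e : 0 < e -> exists J0, forall J, (J0 <= J)%nat -> q ^ J < e.
Proof.
  intros he.
  assert (h : is_lim_seq (fun n => q ^ n) 0) by (apply is_lim_seq_geom; rewrite Rabs_pos_eq; lra).
  apply is_lim_seq_spec in h. destruct (h (mkposreal e he)) as [N HN].
  exists N; intros J hJ. specialize (HN J hJ). simpl in HN.
  rewrite Rminus_0_r, Rabs_pos_eq in HN; [assumption|apply pow_le; lra].
Qed.

(** After finitely many nonzero factors, the remaining product has argument x q^J so small that its
    distance to 1 is less than 1. *)
Lemma qpoch_neq0 x : (forall j, (x * RtoC (q ^ j))%C <> RtoC 1) -> qpoch x q <> RtoC 0.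
Proof.
  intros H. assert (L0 := qlip_pos 1). assert (c0 := Cmod_ge_0 x).
  destruct (qpow_small (/ ((Cmod x + 1) * (1 + qlip 1)))) as [J HJ].
  { apply Rinv_0_lt_compat, Rmult_lt_0_compat; lra. }
  rewrite (qpoch_split J). apply Cmult_neq0; [now apply qprod_neq0|].
  specialize (HJ J (Nat.le_refl _)).
  assert (qJ : 0 < q ^ J) by (apply pow_lt; lra).
  set (y := (x * RtoC (q ^ J))%C).
  assert (hy : Cmod y * (1 + qlip 1) < 1).
  { unfold y. rewrite Cmod_mult, Cmod_R, Rabs_pos_eq by lra.
    apply Rle_lt_trans with ((Cmod x + 1) * (1 + qlip 1) * q ^ J); [nra|].
    apply (Rmult_lt_compat_l ((Cmod x + 1) * (1 + qlip 1))) in HJ; [|apply Rmult_lt_0_compat; lra].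
    rewrite Rinv_r in HJ; [exact HJ|]. apply Rgt_not_eq, Rmult_lt_0_compat; lra. }
  assert (y0 := Cmod_ge_0 y).
  assert (h : Cmod (qpoch y q - 1) <= qlip 1 * Cmod y) by (apply qpoch_near1; nra).
  intros E. rewrite E in h. replace (0 - 1)%C with (- (1))%C in h by ring.
  rewrite Cmod_m1 in h. nra.
Qed.

Lemma cont_qpoch w : cont_at (fun x => qpoch x q) w.
Proof.
  apply (cont_lipschitz _ w 1 (qlip (Cmod w + 1))); [lra|apply Rlt_le, qlip_pos|].
  intros w' hw. apply qpoch_lipschitz; [|lra].
  assert (h := Cmod_sub_ge w' w). lra.
Qed.

Lemma qpoch_1step x : qpoch x q = ((1 - x) * qpoch (x * RtoC q) q)%C.
Proof.
  rewrite (qpoch_split 1 x). rewrite pow_1. f_equal.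
  unfold qprod; simpl. ring.
Qed.
End QPoch.

(** * Contour integrals *)

(** Encoded through [cont_at], whose closure properties then apply to functions of a real
    variable. *)
Definition rcont (F : R -> C) (s : R) : Prop := cont_at (fun z => F (fst z)) (RtoC s).

Lemma rcont_eps F s : rcont F s <-> forall eps, 0 < eps -> exists del, 0 < del /\
  forall s', Rabs (s' - s) < del -> Cmod (F s' - F s) < eps.
Proof.
  split; intros H eps he; destruct (H eps he) as [d [h1 h2]]; exists d; split; try assumption.
  - intros s' hs. apply (h2 (RtoC s')). rewrite <- RtoC_minus, Cmod_R. exact hs.
  - intros z hz. simpl. apply h2. eapply Rle_lt_trans; [|exact hz].
    eapply Rle_trans; [|apply (Rmax_Cmod (z - RtoC s)%C)]. simpl. apply Rmax_l.
Qed.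

Lemma rcont_continuous F s : rcont F s -> continuous (T := R_UniformSpace) (U := C_UniformSpace) F s.
Proof.
  intros H P [eps HP]. destruct (proj1 (rcont_eps F s) H eps (cond_pos eps)) as [d [h1 h2]].
  exists (mkposreal d h1). intros s' hs. apply HP. apply C_NormedModule_mixin_compat1.
  apply h2. exact hs.
Qed.

Lemma continuous_rcont F s : continuous (T := R_UniformSpace) (U := C_UniformSpace) F s -> rcont F s.
Proof.
  intros H. apply rcont_eps. intros eps he.
  assert (he2 : 0 < eps / 2) by lra.
  destruct (H (ball (F s) (mkposreal _ he2))) as [d hd]; [now exists (mkposreal _ he2)|].
  exists d; split; [apply cond_pos|]. intros s' hs. destruct (hd s' hs) as [h1 h2].
  eapply Rle_lt_trans; [apply (Cmod_le_parts (F s' - F s)%C)|].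
  change (Rabs (fst (F s') - fst (F s)) < eps / 2) in h1.
  change (Rabs (snd (F s') - snd (F s)) < eps / 2) in h2.
  change (Rabs (fst (F s') - fst (F s)) + Rabs (snd (F s') - snd (F s)) < eps). lra.
Qed.

Lemma rcont_mult F G s : rcont F s -> rcont G s -> rcont (fun t => F t * G t)%C s.
Proof. apply cont_mult. Qed.

Lemma rcont_comp h F s : rcont F s -> cont_at h (F s) -> rcont (fun t => h (F t)) s.
Proof. intros H1 H2. exact (cont_comp h (fun z => F (fst z)) (RtoC s) H1 H2). Qed.

(** Derivatives by components: the complex product and inverse are rational in the components, so
    the real differentiation rules suffice. *)
Definition cder (F F' : R -> C) : Prop := forall s,
  is_derive (fun t => fst (F t)) s (fst (F' s)) /\ is_derive (fun t => snd (F t)) s (snd (F' s)).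

Lemma cder_mult F F' G G' : cder F F' -> cder G G' ->
  cder (fun t => F t * G t)%C (fun t => F' t * G t + F t * G' t)%C.
Proof.
  intros HF HG s. destruct (HF s) as [f1 f2]. destruct (HG s) as [g1 g2].
  assert (com : forall n m : R, mult n m = mult m n) by (intros; apply Rmult_comm).
  split; simpl.
  - evar_last; [apply (is_derive_minus _ _ _ _ _ (is_derive_mult _ _ _ _ _ f1 g1 com) (is_derive_mult _ _ _ _ _ f2 g2 com))|].
    unfold minus, plus, opp, mult; simpl; unfold mult; simpl. ring.
  - evar_last; [apply (is_derive_plus _ _ _ _ _ (is_derive_mult _ _ _ _ _ f1 g2 com) (is_derive_mult _ _ _ _ _ f2 g1 com))|].
    unfold minus, plus, opp, mult; simpl; unfold mult; simpl. ring.
Qed.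

Lemma cder_pow F F' n : cder F F' ->
  cder (fun t => F t ^ S n)%C (fun t => RtoC (INR (S n)) * F t ^ n * F' t)%C.
Proof.
  intros HF; induction n as [|n IH].
  - intros s; destruct (HF s) as [h1 h2]; split.
    + apply (is_derive_ext (fun t => fst (F t))); [intros; now rewrite Cpow_1_r|].
      replace (RtoC (INR 1) * F s ^ 0 * F' s)%C with (F' s) by (change (INR 1) with 1; change (F s ^ 0)%C with (RtoC 1); ring). exact h1.
    + apply (is_derive_ext (fun t => snd (F t))); [intros; now rewrite Cpow_1_r|].
      replace (RtoC (INR 1) * F s ^ 0 * F' s)%C with (F' s) by (change (INR 1) with 1; change (F s ^ 0)%C with (RtoC 1); ring). exact h2.
  - assert (h := cder_mult _ _ _ _ HF IH). intros s; destruct (h s) as [h1 h2].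
    replace (RtoC (INR (S (S n))) * F s ^ S n * F' s)%C with
      (F' s * F s ^ S n + F s * (RtoC (INR (S n)) * F s ^ n * F' s))%C.
    + split; [exact h1|exact h2].
    + rewrite (S_INR (S n)), RtoC_plus, !(Cpow_S (F s)). ring.
Qed.

Lemma cder_inv F F' : (forall s, F s <> RtoC 0) -> cder F F' ->
  cder (fun t => / F t)%C (fun t => - (F' t) * / F t * / F t)%C.
Proof.
  intros H0 HF s. destruct (HF s) as [h1 h2].
  set (x := fun t => fst (F t)) in *. set (y := fun t => snd (F t)) in *.
  assert (nz : x s ^ 2 + y s ^ 2 <> 0).
  { intros E. apply (H0 s). unfold x, y in E.
    assert (fst (F s) = 0) by nra. assert (snd (F s) = 0) by nra.
    destruct (F s); simpl in *; subst; reflexivity. }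
  assert (com : forall n m : R, mult n m = mult m n) by (intros; apply Rmult_comm).
  assert (hd : is_derive (fun t => x t ^ 2 + y t ^ 2) s (2 * x s * fst (F' s) + 2 * y s * snd (F' s))).
  { apply (is_derive_ext (fun t => x t * x t + y t * y t)); [intros; simpl; ring|].
    evar_last; [apply (is_derive_plus _ _ _ _ _ (is_derive_mult _ _ _ _ _ h1 h1 com) (is_derive_mult _ _ _ _ _ h2 h2 com))|].
    unfold plus, mult; simpl; unfold mult, x, y; simpl. ring. }
  split.
  - apply (is_derive_ext (fun t => x t / (x t ^ 2 + y t ^ 2))); [reflexivity|].
    evar_last; [apply (is_derive_div _ _ _ _ _ h1 hd nz)|].
    unfold x, y in *. simpl in *. field. rewrite !Rmult_1_r in nz. exact nz.
  - apply (is_derive_ext (fun t => - y t / (x t ^ 2 + y t ^ 2))); [reflexivity|].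
    evar_last; [apply (is_derive_div _ _ _ _ _ (is_derive_opp _ _ _ h2) hd nz)|].
    unfold opp, x, y in *. simpl in *. field. rewrite !Rmult_1_r in nz. exact nz.
Qed.

Definition CInt (F : R -> C) : C := RInt (V := C_R_CompleteNormedModule) F 0 1.

Lemma CInt_ex F : (forall s, 0 <= s <= 1 -> rcont F s) ->
  ex_RInt (V := C_R_CompleteNormedModule) F 0 1.
Proof.
  intros H. apply ex_RInt_continuous. rewrite Rmin_left, Rmax_right by lra.
  intros z hz. apply (rcont_continuous F z), H, hz.
Qed.

Lemma CInt_ext F G : (forall s, 0 <= s <= 1 -> F s = G s) -> CInt F = CInt G.
Proof.
  intros H. unfold CInt. apply (RInt_ext (V := C_R_CompleteNormedModule)). rewrite Rmin_left, Rmax_right by lra. intros; apply H; lra.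
Qed.

Lemma CInt_plus F G : (forall s, 0 <= s <= 1 -> rcont F s) -> (forall s, 0 <= s <= 1 -> rcont G s) ->
  CInt (fun s => F s + G s)%C = (CInt F + CInt G)%C.
Proof. intros HF HG. exact (RInt_plus _ _ _ _ (CInt_ex F HF) (CInt_ex G HG)). Qed.

(** [RInt] is linear over the reals; a complex factor mixes the two components, which are therefore
    integrated separately. *)
Lemma CInt_scal c F : (forall s, 0 <= s <= 1 -> rcont F s) -> CInt (fun s => c * F s)%C = (c * CInt F)%C.
Proof.
  intros HF. assert (h := RInt_correct _ _ _ (CInt_ex F HF)).
  change (is_RInt (V := prod_NormedModule R_AbsRing R_NormedModule R_NormedModule) F 0 1 (CInt F)) in h.
  assert (h1 := is_RInt_fct_extend_fst _ _ _ _ h). assert (h2 := is_RInt_fct_extend_snd _ _ _ _ h).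
  apply (is_RInt_unique (V := C_R_CompleteNormedModule)).
  apply (is_RInt_fct_extend_pair (U := R_NormedModule) (V := R_NormedModule)).
  - exact (is_RInt_minus _ _ _ _ _ _ (is_RInt_scal _ _ _ (fst c) _ h1) (is_RInt_scal _ _ _ (snd c) _ h2)).
  - exact (is_RInt_plus _ _ _ _ _ _ (is_RInt_scal _ _ _ (fst c) _ h2) (is_RInt_scal _ _ _ (snd c) _ h1)).
Qed.

Lemma CInt_bound F B : (forall s, 0 <= s <= 1 -> rcont F s) ->
  (forall s, 0 <= s <= 1 -> Cmod (F s) <= B) -> Cmod (CInt F) <= B.
Proof.
  intros HF HB. assert (h := RInt_correct _ _ _ (CInt_ex F HF)).
  assert (nC : forall z : C, norm (K := R_AbsRing) (V := C_R_NormedModule) z = Cmod z).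
  { intros z. change (sqrt (Rabs (fst z) ^ 2 + Rabs (snd z) ^ 2) = Cmod z).
    unfold Cmod. rewrite !pow2_abs. reflexivity. }
  assert (h2 := norm_RInt_le_const (V := C_R_NormedModule) F 0 1 (CInt F) B ltac:(lra)).
  rewrite nC in h2. replace B with ((1 - 0) * B) by ring. apply h2; [|exact h].
  intros s hs; rewrite nC; auto.
Qed.

Lemma CInt_derive F F' : cder F F' -> (forall s, 0 <= s <= 1 -> rcont F' s) ->
  CInt F' = (F 1 - F 0)%C.
Proof.
  intros HF HC. apply (is_RInt_unique (V := C_R_CompleteNormedModule)).
  apply (is_RInt_fct_extend_pair (U := R_NormedModule) (V := R_NormedModule)).
  - apply (is_RInt_derive (V := R_CompleteNormedModule) (fun t => fst (F t))); intros s hs; [apply HF|].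
    rewrite Rmin_left, Rmax_right in hs by lra.
    apply (continuous_comp (V := C_UniformSpace) F' fst); [now apply rcont_continuous, HC|].
    apply (continuous_fst (U := R_UniformSpace) (V := R_UniformSpace)).
  - apply (is_RInt_derive (V := R_CompleteNormedModule) (fun t => snd (F t))); intros s hs; [apply HF|].
    rewrite Rmin_left, Rmax_right in hs by lra.
    apply (continuous_comp (V := C_UniformSpace) F' snd); [now apply rcont_continuous, HC|].
    apply (continuous_snd (U := R_UniformSpace) (V := R_UniformSpace)).
Qed.

Lemma rcont_bounded F : (forall s, 0 <= s <= 1 -> rcont F s) ->
  exists B, forall s, 0 <= s <= 1 -> Cmod (F s) <= B.
Proof.
  intros H.
  destruct (bounded_continuity (V := C_R_NormedModule) F 0 1) as [M HM].
  - intros s hs. exact (rcont_continuous F s (H s hs)).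
  - exists M; intros s hs. specialize (HM s hs).
    change (sqrt (Rabs (fst (F s)) ^ 2 + Rabs (snd (F s)) ^ 2) < M) in HM.
    rewrite !pow2_abs in HM. now left.
Qed.

Definition C1loop (gam dgam : R -> C) : Prop :=
  cder gam dgam /\ (forall s, rcont gam s) /\ (forall s, rcont dgam s) /\ gam 0 = gam 1.

Lemma closed_C1_loop gam dgam : closed_C1_curve gam dgam -> C1loop gam dgam.
Proof.
  intros [H1 [H2 H3]]. split; [|split; [|split; [|exact H3]]].
  - intros s. specialize (H1 s). unfold is_derive in *. split.
    + exact (filterdiff_comp' (K := R_AbsRing) (U := AbsRing_NormedModule R_AbsRing)
        (V := prod_NormedModule R_AbsRing R_NormedModule R_NormedModule) (W := R_NormedModule)
        gam (fun z => fst z) s _ (fun z => fst z) H1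
        (filterdiff_linear _ (is_linear_fst (U := R_NormedModule) (V := R_NormedModule)))).
    + exact (filterdiff_comp' (K := R_AbsRing) (U := AbsRing_NormedModule R_AbsRing)
        (V := prod_NormedModule R_AbsRing R_NormedModule R_NormedModule) (W := R_NormedModule)
        gam (fun z => snd z) s _ (fun z => snd z) H1
        (filterdiff_linear _ (is_linear_snd (U := R_NormedModule) (V := R_NormedModule)))).
  - intros s. apply continuous_rcont.
    apply (ex_derive_continuous (V := prod_NormedModule R_AbsRing R_NormedModule R_NormedModule)).
    exists (dgam s); apply H1.
  - intros s; apply continuous_rcont, H2.
Qed.

(** * Abstract integration functionals *)

Definition contD (D : C -> Prop) (F : C -> C) : Prop := forall w, D w -> cont_at F w.

(** What is kept of an integral along finitely many loops with support [D]: [li_bound] is the length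
    estimate and [li_cpt] stands for compactness of the support. The form covers combinations of
    contours, in which winding numbers can cancel. *)
Record lin_int (D : C -> Prop) (I : (C -> C) -> C) : Prop := {
  li_ext : forall F G, (forall w, D w -> F w = G w) -> I F = I G;
  li_plus : forall F G, contD D F -> contD D G -> I (fun w => F w + G w)%C = (I F + I G)%C;
  li_scal : forall c F, contD D F -> I (fun w => c * F w)%C = (c * I F)%C;
  li_bound : exists L, 0 <= L /\ forall F B, contD D F -> (forall w, D w -> Cmod (F w) <= B) ->
     Cmod (I F) <= L * B;
  li_cpt : forall F, contD D F -> exists B, 0 <= B /\ forall w, D w -> Cmod (F w) <= B }.

Definition trace (gam : R -> C) (w : C) : Prop := exists s, 0 <= s <= 1 /\ gam s = w.

Lemma lin_int_loop gam dgam : C1loop gam dgam -> lin_int (trace gam) (cint gam dgam).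
Proof.
  intros [_ [Hg [Hd _]]].
  assert (rc : forall F, contD (trace gam) F -> forall s, 0 <= s <= 1 -> rcont (fun t => F (gam t) * dgam t)%C s).
  { intros F HF s hs. apply rcont_mult; [|apply Hd]. apply rcont_comp; [apply Hg|].
    apply HF; now exists s. }
  split.
  - intros F G E. apply (CInt_ext (fun t => F (gam t) * dgam t)%C (fun t => G (gam t) * dgam t)%C).
    intros s hs. rewrite E; [easy|]. now exists s.
  - intros F G HF HG.
    change (CInt (fun t => (F (gam t) + G (gam t)) * dgam t)%C =
      (CInt (fun t => F (gam t) * dgam t) + CInt (fun t => G (gam t) * dgam t))%C). rewrite <- (CInt_plus _ _ (rc F HF) (rc G HG)).
    apply CInt_ext; intros; ring.
  - intros c F HF.
    change (CInt (fun t => c * F (gam t) * dgam t)%C = (c * CInt (fun t => F (gam t) * dgam t))%C). rewrite <- (CInt_scal c _ (rc F HF)).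
    apply CInt_ext; intros; ring.
  - destruct (rcont_bounded dgam ltac:(auto)) as [L HL].
    assert (L0 : 0 <= L) by (eapply Rle_trans; [apply Cmod_ge_0|apply (HL 0); lra]).
    exists L; split; [assumption|]. intros F B HF HB.
    apply (CInt_bound (fun t => F (gam t) * dgam t)%C); [now apply rc|].
    intros s hs. rewrite Cmod_mult, Rmult_comm.
    apply Rmult_le_compat; auto using Cmod_ge_0. apply HB; now exists s.
  - intros F HF.
    destruct (rcont_bounded (fun t => F (gam t))) as [B HB].
    { intros s hs. apply rcont_comp; [apply Hg|]. apply HF; now exists s. }
    exists B; split; [eapply Rle_trans; [apply Cmod_ge_0|apply (HB 0); lra]|].
    intros w [s [hs <-]]; auto.
Qed.

(** With c = -1 the second contour is reversed, so a difference of contours becomes a single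
    functional. *)
Lemma lin_int_comb D1 D2 I1 I2 c : lin_int D1 I1 -> lin_int D2 I2 ->
  lin_int (fun w => D1 w \/ D2 w) (fun F => I1 F + c * I2 F)%C.
Proof.
  intros H1 H2.
  assert (r1 : forall F, contD (fun w => D1 w \/ D2 w) F -> contD D1 F) by (intros F H w hw; apply H; now left).
  assert (r2 : forall F, contD (fun w => D1 w \/ D2 w) F -> contD D2 F) by (intros F H w hw; apply H; now right).
  split.
  - intros F G E. rewrite (li_ext _ _ H1 F G), (li_ext _ _ H2 F G); auto.
  - intros F G HF HG. rewrite (li_plus _ _ H1), (li_plus _ _ H2); auto. ring.
  - intros d F HF. rewrite (li_scal _ _ H1), (li_scal _ _ H2); auto. ring.
  - destruct (li_bound _ _ H1) as [L1 [p1 b1]]. destruct (li_bound _ _ H2) as [L2 [p2 b2]].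
    assert (c0 := Cmod_ge_0 c).
    exists (L1 + Cmod c * L2); split.
    { apply Rplus_le_le_0_compat; [assumption|now apply Rmult_le_pos]. }
    intros F B HF HB. eapply Rle_trans; [apply Cmod_triangle|]. rewrite Cmod_mult, Rmult_plus_distr_r.
    apply Rplus_le_compat; [apply b1; auto|]. rewrite Rmult_assoc. apply Rmult_le_compat_l; [assumption|].
    apply b2; auto.
  - intros F HF. destruct (li_cpt _ _ H1 F (r1 F HF)) as [B1 [p1 b1]].
    destruct (li_cpt _ _ H2 F (r2 F HF)) as [B2 [p2 b2]].
    exists (Rmax B1 B2); split; [eapply Rle_trans; [exact p1|apply Rmax_l]|].
    intros w [hw|hw].
    + eapply Rle_trans; [apply b1, hw|apply Rmax_l].
    + eapply Rle_trans; [apply b2, hw|apply Rmax_r].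
Qed.

(** * Integer powers and their integrals along loops *)

Lemma zpowC_nat z n : zpowC z (Z.of_nat n) = (z ^ n)%C.
Proof. destruct n as [|n]; [easy|]. simpl. now rewrite SuccNat2Pos.id_succ. Qed.

Lemma zpowC_opp_nat z n : zpowC z (- Z.of_nat n) = (/ (z ^ n))%C.
Proof.
  destruct n as [|n]; simpl; [|now rewrite SuccNat2Pos.id_succ].
  unfold Cinv; simpl; apply injective_projections; simpl; field.
Qed.

Lemma zpowC_S z k : z <> RtoC 0 -> zpowC z (k + 1) = (zpowC z k * z)%C.
Proof.
  intros hz. destruct (Z_le_gt_dec 0 k) as [h|h].
  - destruct (Z_of_nat_complete k h) as [n ->].
    replace (Z.of_nat n + 1)%Z with (Z.of_nat (S n)) by lia.
    rewrite !zpowC_nat, Cpow_S. ring.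
  - assert (h' : (0 <= - k - 1)%Z) by lia. destruct (Z_of_nat_complete _ h') as [n hn].
    replace k with (- Z.of_nat (S n))%Z by lia.
    replace (- Z.of_nat (S n) + 1)%Z with (- Z.of_nat n)%Z by lia.
    rewrite !zpowC_opp_nat, Cpow_S. field. split; [|assumption]. now apply Cpow_nz.
Qed.

Lemma zpowC_add z k l : z <> RtoC 0 -> zpowC z (k + l) = (zpowC z k * zpowC z l)%C.
Proof.
  intros hz. assert (pos : forall n k, zpowC z (k + Z.of_nat n) = (zpowC z k * z ^ n)%C).
  { induction n as [|n IH]; intros k'.
    - simpl. rewrite Z.add_0_r. ring.
    - replace (k' + Z.of_nat (S n))%Z with (k' + Z.of_nat n + 1)%Z by lia.
      rewrite zpowC_S, IH, Cpow_S by assumption. ring. }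
  destruct (Z_le_gt_dec 0 l) as [h|h].
  - destruct (Z_of_nat_complete l h) as [n ->]. now rewrite pos, zpowC_nat.
  - assert (h' : (0 <= - l)%Z) by lia. destruct (Z_of_nat_complete _ h') as [n hn].
    replace l with (- Z.of_nat n)%Z by lia. rewrite zpowC_opp_nat.
    assert (e := pos n (k + - Z.of_nat n)%Z).
    replace (k + - Z.of_nat n + Z.of_nat n)%Z with k in e by lia. rewrite e.
    field. now apply Cpow_nz.
Qed.

Lemma zpowC_neq0 z k : z <> RtoC 0 -> zpowC z k <> RtoC 0.
Proof.
  intros hz E. assert (h := zpowC_add z k (- k) hz).
  rewrite Z.add_opp_diag_r, E, Cmult_0_l in h. simpl in h. injection h; lra.
Qed.

Lemma zpowC_opp z k : z <> RtoC 0 -> zpowC z (- k) = (/ zpowC z k)%C.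
Proof.
  intros hz. assert (h := zpowC_add z k (- k) hz). rewrite Z.add_opp_diag_r in h.
  assert (n := zpowC_neq0 z k hz).
  transitivity (zpowC z k * zpowC z (- k) * / zpowC z k)%C; [field; assumption|].
  rewrite <- h. simpl. ring.
Qed.

Lemma Cmod_zpowC z k : z <> RtoC 0 -> Cmod (zpowC z k) = powerRZ (Cmod z) k.
Proof.
  intros hz. destruct (Z_le_gt_dec 0 k) as [h|h].
  - destruct (Z_of_nat_complete k h) as [n ->]. now rewrite zpowC_nat, Cmod_pow, powerRZ_of_nat.
  - assert (h' : (0 <= - k)%Z) by lia. destruct (Z_of_nat_complete _ h') as [n hn].
    replace k with (- Z.of_nat n)%Z by lia.
    rewrite zpowC_opp_nat, Cmod_inv, Cmod_pow by now apply Cpow_nz.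
    now rewrite powerRZ_neg', powerRZ_of_nat.
Qed.

Lemma cont_pow n w : cont_at (fun z => z ^ n)%C w.
Proof.
  induction n as [|n IH]; [exact (cont_const (RtoC 1) w)|].
  apply (cont_ext (fun z => z * z ^ n)%C); [intros; now rewrite Cpow_S|].
  apply cont_mult; [apply cont_id|exact IH].
Qed.

Lemma cont_zpowC k w : w <> RtoC 0 -> cont_at (fun z => zpowC z k) w.
Proof.
  intros hw. destruct (Z_le_gt_dec 0 k) as [h|h].
  - destruct (Z_of_nat_complete k h) as [n ->].
    apply (cont_ext (fun z => z ^ n)%C); [intros; now rewrite zpowC_nat|apply cont_pow].
  - assert (h' : (0 <= - k)%Z) by lia. destruct (Z_of_nat_complete _ h') as [n hn].
    replace k with (- Z.of_nat n)%Z by lia.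
    apply (cont_ext (fun z => / (z ^ n))%C); [intros; now rewrite zpowC_opp_nat|].
    apply cont_inv; [now apply Cpow_nz|apply cont_pow].
Qed.

(** For k <> -1 the integrand is a constant multiple of the derivative of a power of [gam], and the
    loop closes. *)
Lemma cint_zpowC gam dgam k : C1loop gam dgam -> (forall s, gam s <> RtoC 0) -> k <> (-1)%Z ->
  cint gam dgam (fun w => zpowC w k) = RtoC 0.
Proof.
  intros [Hder [Hg [Hd He]]] H0 hk.
  assert (red : forall c P, c <> RtoC 0 -> cder P (fun t => c * (zpowC (gam t) k * dgam t))%C -> P 0 = P 1 ->
     cint gam dgam (fun w => zpowC w k) = RtoC 0).
  { intros c P hc HP E.
    assert (rc : forall s, 0 <= s <= 1 -> rcont (fun t => zpowC (gam t) k * dgam t)%C s).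
    { intros s _. apply rcont_mult; [|apply Hd]. apply (rcont_comp (fun z => zpowC z k)); [apply Hg|].
      now apply cont_zpowC. }
    assert (h := CInt_derive P _ HP (fun s hs => cont_mult _ _ _ (cont_const c _) (rc s hs))).
    rewrite (CInt_scal c (fun t => zpowC (gam t) k * dgam t)%C rc), E in h.
    change (CInt (fun t => zpowC (gam t) k * dgam t)%C) with (cint gam dgam (fun w => zpowC w k)) in h.
    replace (P 1 - P 1)%C with (RtoC 0) in h by ring.
    transitivity (/ c * (c * cint gam dgam (fun w => zpowC w k)))%C; [field; assumption|].
    rewrite h; ring. }
  assert (nz : forall n, RtoC (INR (S n)) <> RtoC 0).
  { intros n E. injection E as E1. exact (not_0_INR (S n) (Nat.neq_succ_0 n) E1). }
  destruct (Z_le_gt_dec 0 k) as [h|h].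
  - destruct (Z_of_nat_complete k h) as [n ->].
    apply (red (RtoC (INR (S n))) (fun t => gam t ^ S n)%C); [apply nz| |now rewrite He].
    intros s. destruct (cder_pow _ _ n Hder s) as [h1 h2].
    rewrite zpowC_nat, Cmult_assoc. split; assumption.
  - assert (h' : (0 <= - k - 2)%Z) by lia. destruct (Z_of_nat_complete _ h') as [n hn].
    replace k with (- Z.of_nat (S (S n)))%Z in * by lia.
    (* Here k = -(n + 2), and the derivative of w^(-(n + 1)) is -(n + 1) w^k. *)
    apply (red (- RtoC (INR (S n)))%C (fun t => (/ gam t) ^ S n)%C); [| |now rewrite He].
    + intros E. apply (nz n). replace (RtoC (INR (S n))) with (- - RtoC (INR (S n)))%C by ring.
      rewrite E; ring.
    + intros s. destruct (cder_pow _ _ n (cder_inv _ _ H0 Hder) s) as [h1 h2].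
      replace (- RtoC (INR (S n)) * (zpowC (gam s) (- Z.of_nat (S (S n))) * dgam s))%C
        with (RtoC (INR (S n)) * (/ gam s) ^ n * (- dgam s * / gam s * / gam s))%C; [split; assumption|].
      rewrite zpowC_opp_nat, !Cpow_S, Cpow_inv by apply H0. field. split; [now apply Cpow_nz|apply H0].
Qed.

(** * Vanishing of Laurent moments *)

Lemma zpowC_pred z k : z <> RtoC 0 -> zpowC z (k - 1) = (zpowC z k * / z)%C.
Proof.
  intros hz. assert (h := zpowC_S z (k - 1) hz).
  replace (k - 1 + 1)%Z with k in h by lia. rewrite h. field. assumption.
Qed.

Lemma contD_mult D F G : contD D F -> contD D G -> contD D (fun w => F w * G w)%C.
Proof. intros H1 H2 w hw; apply cont_mult; auto. Qed.

Lemma contD_inv D F : (forall w, D w -> F w <> RtoC 0) -> contD D F -> contD D (fun w => / F w)%C.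
Proof. intros H1 H2 w hw; apply cont_inv; auto. Qed.

Lemma contD_lin (D : C -> Prop) p : contD D (fun w => 1 - p * w)%C.
Proof.
  intros w _. apply (cont_ext (fun w => 1 + - p * w)%C); [intros; ring|].
  apply cont_plus; [apply cont_const|apply cont_mult; [apply cont_const|apply cont_id]].
Qed.

Lemma contD_linv (D : C -> Prop) p : (forall w, D w -> w <> RtoC 0) -> contD D (fun w => 1 - p * / w)%C.
Proof.
  intros D0 w hw. apply (cont_ext (fun w => 1 + - p * / w)%C); [intros; ring|].
  apply cont_plus; [apply cont_const|apply cont_mult; [apply cont_const|]].
  apply (cont_inv (fun z => z)); [auto|apply cont_id].
Qed.

Fixpoint lprodinv (ps : list C) (w : C) : C :=
  match ps with nil => RtoC 1 | p :: l => (/ (1 - p * w) * lprodinv l w)%C end.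

Section Zint.
Context (D : C -> Prop) (I : (C -> C) -> C) (HI : lin_int D I) (D0 : forall w, D w -> w <> RtoC 0).

(* All two-sided Laurent moments vanish: unlike [I F = 0], this is stable under products with [1 - p w] and [1 - p / w]. *)
Definition Zint (F : C -> C) : Prop := forall k, I (fun w => F w * zpowC w k)%C = RtoC 0.

Lemma contD_zpow F k : contD D F -> contD D (fun w => F w * zpowC w k)%C.
Proof. intros H; apply contD_mult; [assumption|]. intros w hw; apply cont_zpowC; auto. Qed.

Lemma li_lin2 F G c : contD D F -> contD D G -> I (fun w => F w + c * G w)%C = (I F + c * I G)%C.
Proof.
  intros HF HG. rewrite (li_plus _ _ HI F (fun w => c * G w)%C), (li_scal _ _ HI); auto.
  apply contD_mult; [intros w _; apply cont_const|assumption].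
Qed.

Lemma Zint_ext F G : (forall w, D w -> F w = G w) -> Zint F -> Zint G.
Proof.
  intros E H k. rewrite <- (H k). apply (li_ext _ _ HI). intros w hw; now rewrite E.
Qed.

Lemma Zint_mul_lin F p : contD D F -> Zint F -> Zint (fun w => F w * (1 - p * w))%C.
Proof.
  intros HF H k.
  rewrite (li_ext _ _ HI _ (fun w => F w * zpowC w k + - p * (F w * zpowC w (k + 1)))%C).
  - rewrite li_lin2, (H k), (H (k + 1)%Z) by now apply contD_zpow. ring.
  - intros w hw. rewrite zpowC_S by auto. ring.
Qed.

Lemma Zint_mul_linv F p : contD D F -> Zint F -> Zint (fun w => F w * (1 - p * / w))%C.
Proof.
  intros HF H k.
  rewrite (li_ext _ _ HI _ (fun w => F w * zpowC w k + - p * (F w * zpowC w (k - 1)))%C).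
  - rewrite li_lin2, (H k), (H (k - 1)%Z) by now apply contD_zpow. ring.
  - intros w hw. rewrite zpowC_pred by auto. ring.
Qed.

(** The moments d_k of 1/(1 - p w) satisfy d_k - p d_(k+1) = 0, the right-hand side being a moment
    of 1. Hence d_0 = 0 propagates upwards, where p <> 0 is used, and downwards. *)
Lemma Zint_pole p : (forall w, D w -> (1 - p * w)%C <> RtoC 0) -> p <> RtoC 0 ->
  Zint (fun _ => RtoC 1) -> I (fun w => / (1 - p * w))%C = RtoC 0 -> Zint (fun w => / (1 - p * w))%C.
Proof.
  intros Hp p0 H1 H0.
  set (d := fun k => I (fun w => / (1 - p * w) * zpowC w k)%C).
  assert (cF : contD D (fun w => / (1 - p * w))%C) by (apply contD_inv; [exact Hp|apply contD_lin]).
  assert (rec : forall k, d k = (p * d (k + 1)%Z)%C).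
  { intros k. assert (h := H1 k).
    rewrite (li_ext _ _ HI _ (fun w => / (1 - p * w) * zpowC w k + - p * (/ (1 - p * w) * zpowC w (k + 1)))%C) in h.
    - rewrite li_lin2 in h by now apply contD_zpow. fold (d k) (d (k + 1)%Z) in h.
      transitivity ((d k + - p * d (k + 1)%Z) + p * d (k + 1)%Z)%C; [ring|]. rewrite h; ring.
    - intros w hw. rewrite zpowC_S by auto. field. now apply Hp. }
  assert (d0 : d 0%Z = RtoC 0).
  { rewrite <- H0. apply (li_ext _ _ HI). intros w _; simpl. ring. }
  assert (pos : forall n, d (Z.of_nat n) = RtoC 0).
  { induction n as [|n IH]; [exact d0|].
    assert (h := rec (Z.of_nat n)). rewrite IH in h.
    replace (Z.of_nat n + 1)%Z with (Z.of_nat (S n)) in h by lia.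
    transitivity (/ p * (p * d (Z.of_nat (S n))))%C; [field; assumption|]. rewrite <- h; ring. }
  assert (neg : forall n, d (- Z.of_nat n)%Z = RtoC 0).
  { induction n as [|n IH]; [exact d0|].
    rewrite rec. replace (- Z.of_nat (S n) + 1)%Z with (- Z.of_nat n)%Z by lia. rewrite IH; ring. }
  intros k. fold (d k). destruct (Z_le_gt_dec 0 k) as [h|h].
  - destruct (Z_of_nat_complete k h) as [n ->]. apply pos.
  - replace k with (- Z.of_nat (Z.to_nat (- k)))%Z by lia. apply neg.
Qed.

Lemma contD_lprodinv ps : (forall p w, In p ps -> D w -> (1 - p * w)%C <> RtoC 0) -> contD D (lprodinv ps).
Proof.
  induction ps as [|p ps IH]; intros H; simpl.
  - intros w _; apply cont_const.
  - apply contD_mult; [|apply IH; intros; apply H; [now right|assumption]].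
    apply contD_inv; [intros; apply H; [now left|assumption]|apply contD_lin].
Qed.

(** Partial fractions: 1/((1 - p1 w)(1 - p2 w)) is a combination of the two simple factors with
    coefficients p1/(p1 - p2) and -p2/(p1 - p2). Each step thus reduces to two lists that are
    shorter by one pole. *)
Lemma Zint_lprodinv ps : NoDup ps -> Zint (fun _ => RtoC 1) ->
  (forall p, In p ps -> p <> RtoC 0 /\ (forall w, D w -> (1 - p * w)%C <> RtoC 0) /\
     I (fun w => / (1 - p * w))%C = RtoC 0) -> Zint (lprodinv ps).
Proof.
  destruct ps as [|p ps]; [intros _ H _; exact H|]. revert p.
  induction ps as [|p2 ps IH]; intros p1 nd H1 H.
  - destruct (H p1 (or_introl eq_refl)) as [h1 [h2 h3]].
    apply (Zint_ext (fun w => / (1 - p1 * w))%C); [intros w _; simpl; ring|].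
    now apply Zint_pole.
  - inversion nd as [|? ? n1 nd1]; subst. inversion nd1 as [|? ? n2 nd2]; subst.
    destruct (H p1 (or_introl eq_refl)) as [_ [g1 _]].
    destruct (H p2 (or_intror (or_introl eq_refl))) as [_ [g2 _]].
    assert (ne : (p1 - p2)%C <> RtoC 0).
    { intros E. apply n1. left. replace p1 with ((p1 - p2) + p2)%C by ring. rewrite E; ring. }
    assert (Z1 : Zint (lprodinv (p1 :: ps))).
    { apply IH; [constructor; [intros h; apply n1; now right|assumption]|assumption|].
      intros p [<-|hp]; apply H; [now left|right; now right]. }
    assert (Z2 : Zint (lprodinv (p2 :: ps))).
    { apply IH; [assumption|assumption|]. intros p hp; apply H; now right. }
    intros k.
    rewrite (li_ext _ _ HI _ (fun w => (p1 / (p1 - p2)) * (lprodinv (p1 :: ps) w * zpowC w k) +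
       - (p2 / (p1 - p2)) * (lprodinv (p2 :: ps) w * zpowC w k))%C).
    + assert (c1 : contD D (lprodinv (p1 :: ps))).
      { apply contD_lprodinv; intros p w [<-|hp] hw; [now apply g1|]. apply H; [right; now right|assumption]. }
      assert (c2 : contD D (lprodinv (p2 :: ps))).
      { apply contD_lprodinv; intros p w hp hw. apply H; [now right|assumption]. }
      rewrite li_lin2, (li_scal _ _ HI), (Z1 k), (Z2 k) by
        (try (apply contD_mult; [intros w _; apply cont_const|]); now apply contD_zpow). ring.
    + intros w hw. simpl. field. repeat split; auto.
Qed.

(** Powers of w are bounded on [D], so each moment is continuous under uniform convergence. *)
Lemma Zint_limit F (Fj : nat -> C -> C) K x J0 : 0 <= x < 1 -> contD D F ->
  (forall J, contD D (Fj J)) -> (forall J, Zint (Fj J)) ->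
  (forall J w, (J0 <= J)%nat -> D w -> Cmod (F w - Fj J w) <= K * x ^ J) -> Zint F.
Proof.
  intros hx HF HFj Hz Hd k.
  destruct (li_cpt _ _ HI (fun w => zpowC w k)) as [B [B0 HB]].
  { intros w hw; apply cont_zpowC; auto. }
  destruct (li_bound _ _ HI) as [L [L0 HL]].
  apply (Clim_unique (fun J => I (fun w => F w * zpowC w k) + - (1) * I (fun w => Fj J w * zpowC w k))%C).
  - apply (Clim_ext (fun _ => I (fun w => F w * zpowC w k))%C); [|apply Clim_const].
    intros J. rewrite (Hz J k). ring.
  - intros eps he.
    assert (hl := is_lim_geom0 (L * (K * B)) x hx). apply is_lim_seq_spec in hl.
    destruct (hl (mkposreal eps he)) as [N HN]. exists (max J0 N); intros J hJ.
    specialize (HN J ltac:(lia)). simpl in HN. rewrite Rminus_0_r in HN.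
    eapply Rle_lt_trans; [|exact HN]. eapply Rle_trans; [|apply Rle_abs].
    rewrite <- li_lin2 by now apply contD_zpow.
    replace (I (fun w => F w * zpowC w k + - (1) * (Fj J w * zpowC w k))%C - 0)%C with
      (I (fun w => F w * zpowC w k + - (1) * (Fj J w * zpowC w k))%C) by ring.
    replace (L * (K * B) * x ^ J) with (L * (K * x ^ J * B)) by ring. apply HL.
    + intros w hw. apply cont_plus; [now apply contD_zpow|].
      apply cont_mult; [apply cont_const|now apply contD_zpow].
    + intros w hw. replace (F w * zpowC w k + - (1) * (Fj J w * zpowC w k))%C
        with ((F w - Fj J w) * zpowC w k)%C by ring.
      rewrite Cmod_mult. apply Rmult_le_compat; auto using Cmod_ge_0. apply Hd; [lia|assumption].
Qed.

Lemma Rpow_lim0 c x A : 0 <= x < 1 -> (forall n, A <= c * x ^ n) -> A <= 0.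
Proof.
  intros hx H. assert (h := is_lim_geom0 c x hx).
  exact (is_lim_seq_le (fun _ => A) _ A 0 H (is_lim_seq_const A) h).
Qed.

(** Growth takes the place of a winding number about p: the moments satisfy d_k = p d_(k-1), so
    d_(-j) = p^n d_(-j-n), and the moment of order -n is O(r0^(-n)) with |p| < r0. *)
Lemma Zint_growth F p r0 : Cmod p < r0 -> (forall w, D w -> r0 <= Cmod w) -> contD D F -> Zint F ->
  Zint (fun w => F w * / (1 - p * / w))%C.
Proof.
  intros hp hr HF H.
  assert (p0 := Cmod_ge_0 p).
  assert (nz : forall w, D w -> (1 - p * / w)%C <> RtoC 0).
  { intros w hw E. assert (h := hr w hw). assert (w0 := D0 w hw).
    assert (e : p = w).
    { transitivity (w * (1 - (1 - p * / w)))%C; [field; assumption|]. rewrite E; ring. }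
    subst; lra. }
  set (G := fun w => (F w * / (1 - p * / w))%C).
  assert (cG : contD D G).
  { apply contD_mult; [assumption|]. apply contD_inv; [assumption|now apply contD_linv]. }
  set (d := fun k => I (fun w => G w * zpowC w k)%C).
  assert (rec : forall k, d k = (p * d (k - 1)%Z)%C).
  { intros k. assert (h := H k).
    rewrite (li_ext _ _ HI _ (fun w => G w * zpowC w k + - p * (G w * zpowC w (k - 1)))%C) in h.
    - rewrite li_lin2 in h by now apply contD_zpow. fold (d k) (d (k - 1)%Z) in h.
      transitivity ((d k + - p * d (k - 1)%Z) + p * d (k - 1)%Z)%C; [ring|]. rewrite h; ring.
    - intros w hw. rewrite zpowC_pred by auto. unfold G. field.
      assert (w0 := D0 w hw). split; [assumption|].
      intros E. apply (nz w hw). replace (1 - p * / w)%C with ((w - p) / w)%C by (field; assumption).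
      rewrite E; field; assumption. }
  destruct (li_cpt _ _ HI G cG) as [B [B0 HB]].
  destruct (li_bound _ _ HI) as [L [L0 HL]].
  assert (neg : forall j, d (- Z.of_nat j)%Z = RtoC 0).
  { intros j.
    assert (it : forall n, Cmod (d (- Z.of_nat j)%Z) <= (L * B * (/ r0) ^ j) * (Cmod p / r0) ^ n).
    { intros n.
      assert (e : d (- Z.of_nat j)%Z = (p ^ n * d (- Z.of_nat (j + n))%Z)%C).
      { induction n as [|n IH]; [rewrite Nat.add_0_r; simpl; ring|].
        rewrite IH, rec, Cpow_S. replace (- Z.of_nat (j + n) - 1)%Z with (- Z.of_nat (j + S n))%Z by lia. ring. }
      rewrite e, Cmod_mult, Cmod_pow. unfold Rdiv. rewrite Rpow_mult_distr.
      replace (L * B * (/ r0) ^ j * (Cmod p ^ n * (/ r0) ^ n)) with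
        (Cmod p ^ n * (L * (B * ((/ r0) ^ j * (/ r0) ^ n)))) by ring.
      rewrite <- pow_add.
      apply Rmult_le_compat_l; [apply pow_le; assumption|].
      apply HL; [now apply contD_zpow|]. intros w hw. rewrite Cmod_mult, Cmod_zpowC by auto.
      assert (hw' := hr w hw).
      apply Rmult_le_compat; auto using Cmod_ge_0.
      + apply Rlt_le, powerRZ_lt; lra.
      + rewrite powerRZ_neg', powerRZ_of_nat, pow_inv. apply Rinv_le_contravar; [apply pow_lt; lra|].
        apply pow_incr; lra. }
    assert (h := Rpow_lim0 _ _ _ (conj (Rle_mult_inv_pos _ _ p0 (Rle_lt_trans _ _ _ p0 hp))
      (proj1 (Rdiv_lt_1 (Cmod p) r0 (Rle_lt_trans _ _ _ p0 hp)) hp)) it).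
    apply Cmod_eq_0. assert (h2 := Cmod_ge_0 (d (- Z.of_nat j)%Z)). lra. }
  assert (pos : forall n, d (Z.of_nat n) = RtoC 0).
  { induction n as [|n IH]; [exact (neg O)|].
    rewrite rec. replace (Z.of_nat (S n) - 1)%Z with (Z.of_nat n) by lia. rewrite IH; ring. }
  intros k. fold G. fold (d k). destruct (Z_le_gt_dec 0 k) as [h|h].
  - destruct (Z_of_nat_complete k h) as [n ->]. apply pos.
  - replace k with (- Z.of_nat (Z.to_nat (- k)))%Z by lia. apply neg.
Qed.
End Zint.

(** * Circles and their winding numbers *)

Lemma circ_eq r s : dcirc r s = (RtoC (2 * PI) * Ci * circ r s)%C.
Proof. unfold dcirc, circ, RtoC, Ci, Cmult; simpl. f_equal; ring. Qed.

Lemma Cmod_circ r s : 0 < r -> Cmod (circ r s) = r.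
Proof.
  intros hr. unfold circ, Cmod; simpl fst; simpl snd.
  replace ((r * cos (2 * PI * s)) ^ 2 + (r * sin (2 * PI * s)) ^ 2) with
    (r ^ 2 * (Rsqr (sin (2 * PI * s)) + Rsqr (cos (2 * PI * s)))) by (unfold Rsqr; ring).
  rewrite sin2_cos2, Rmult_1_r. apply sqrt_pow2; lra.
Qed.

Lemma circ_neq0 r s : 0 < r -> circ r s <> RtoC 0.
Proof. intros hr; apply Cmod_gt_0; rewrite Cmod_circ; assumption. Qed.

Lemma cder_rcont F F' s : cder F F' -> rcont F s.
Proof.
  intros H. destruct (H s) as [h1 h2].
  assert (c1 : continuous (fun t => fst (F t)) s) by (apply (ex_derive_continuous (K := R_AbsRing) (V := R_NormedModule) (fun t => fst (F t))); eexists; exact h1).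
  assert (c2 : continuous (fun t => snd (F t)) s) by (apply (ex_derive_continuous (K := R_AbsRing) (V := R_NormedModule) (fun t => snd (F t))); eexists; exact h2).
  apply rcont_eps; intros eps he. assert (he2 : 0 < eps / 2) by lra.
  destruct (c1 (ball (fst (F s)) (mkposreal _ he2))) as [d1 hd1]; [now exists (mkposreal _ he2)|].
  destruct (c2 (ball (snd (F s)) (mkposreal _ he2))) as [d2 hd2]; [now exists (mkposreal _ he2)|].
  exists (Rmin d1 d2); split; [apply Rmin_pos; apply cond_pos|]. intros s' hs.
  assert (b1 := hd1 s' (Rlt_le_trans _ _ _ hs (Rmin_l _ _))).
  assert (b2 := hd2 s' (Rlt_le_trans _ _ _ hs (Rmin_r _ _))).
  change (Rabs (fst (F s') - fst (F s)) < eps / 2) in b1.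
  change (Rabs (snd (F s') - snd (F s)) < eps / 2) in b2.
  eapply Rle_lt_trans; [apply (Cmod_le_parts (F s' - F s)%C)|].
  change (Rabs (fst (F s') - fst (F s)) + Rabs (snd (F s') - snd (F s)) < eps). lra.
Qed.

Lemma circ_loop r : C1loop (circ r) (dcirc r).
Proof.
  assert (h : cder (circ r) (dcirc r)).
  { intros s; split; simpl; auto_derive; auto; ring. }
  assert (h2 : cder (dcirc r) (fun s => (- (2 * PI) ^ 2 * r * cos (2 * PI * s), - (2 * PI) ^ 2 * r * sin (2 * PI * s)))).
  { intros s; split; simpl; auto_derive; auto; ring. }
  split; [exact h|split; [|split]].
  - intros s; exact (cder_rcont _ _ s h).
  - intros s; exact (cder_rcont _ _ s h2).
  - unfold circ. rewrite Rmult_0_r, Rmult_1_r, cos_0, sin_0, cos_2PI, sin_2PI. reflexivity.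
Qed.

Definition tpi : C := (RtoC (2 * PI) * Ci)%C.

Lemma tpi_neq0 : tpi <> RtoC 0.
Proof.
  apply Cmod_gt_0. unfold tpi. rewrite Cmod_mult, Cmod_Ci, Cmod_R.
  assert (h := PI_RGT_0). rewrite Rabs_pos_eq; lra.
Qed.

Lemma circ_inv r : 0 < r -> cint (circ r) (dcirc r) (fun w => / w)%C = tpi.
Proof.
  intros hr.
  transitivity (CInt (fun _ => tpi)).
  - apply CInt_ext. intros s _. rewrite circ_eq. unfold tpi. field. now apply circ_neq0.
  - unfold CInt. rewrite RInt_const. unfold scal; simpl. unfold prod_scal, scal; simpl.
    unfold mult; simpl. rewrite Rminus_0_r, !Rmult_1_l. symmetry; apply surjective_pairing.
Qed.

Lemma loop_winding gam dgam p W : winding gam dgam p = W ->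
  cint gam dgam (fun w => / (w - p))%C = (W * tpi)%C.
Proof.
  intros <-. unfold winding, tpi. field. fold tpi.
  assert (h := tpi_neq0). unfold tpi in h. split; intros E; apply h; rewrite E; ring.
Qed.

Section Circle.
Context (r : R) (hr : 0 < r) (p : C) (hp : Cmod p <> r).
Let I := cint (circ r) (dcirc r).
Let D := trace (circ r).

Lemma circ_D w : D w -> Cmod w = r.
Proof. intros [s [_ <-]]. now apply Cmod_circ. Qed.

Lemma circ_D0 w : D w -> w <> RtoC 0.
Proof. intros h; apply Cmod_gt_0; rewrite (circ_D w h); assumption. Qed.

Lemma circ_li : lin_int D I.
Proof. apply lin_int_loop, circ_loop. Qed.

Let F := fun w : C => (/ (w - p))%C.

Lemma circ_nz w : D w -> (w - p)%C <> RtoC 0.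
Proof.
  intros hw E. apply hp. rewrite <- (circ_D w hw). f_equal.
  replace w with ((w - p) + p)%C by ring. rewrite E; ring.
Qed.

Lemma circ_cont : contD D F.
Proof.
  apply contD_inv; [apply circ_nz|]. intros w _.
  apply (cont_ext (fun w => w + - p)%C); [intros; ring|].
  apply cont_plus; [apply cont_id|apply cont_const].
Qed.

(** From w / (w - p) = 1 + p / (w - p). The inhomogeneous term is nonzero at k = -1 only. *)
Lemma circ_rec k : (I (fun w => F w * zpowC w (k + 1)) - p * I (fun w => F w * zpowC w k))%C
  = I (fun w => zpowC w k).
Proof.
  replace (I (fun w => F w * zpowC w (k + 1)) - p * I (fun w => F w * zpowC w k))%C with
    (I (fun w => F w * zpowC w (k + 1)) + - p * I (fun w => F w * zpowC w k))%C by ring.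
  rewrite <- (li_lin2 D I circ_li) by (apply contD_zpow; [apply circ_D0|apply circ_cont]).
  apply (li_ext _ _ circ_li). intros w hw. rewrite zpowC_S by now apply circ_D0.
  unfold F. field. now apply circ_nz.
Qed.

Lemma circ_mom_bound : exists B, 0 <= B /\ forall k, Cmod (I (fun w => F w * zpowC w k)%C) <= B * powerRZ r k.
Proof.
  destruct (li_cpt _ _ circ_li F circ_cont) as [B [B0 HB]].
  destruct (li_bound _ _ circ_li) as [L [L0 HL]].
  exists (L * B); split; [now apply Rmult_le_pos|]. intros k. rewrite Rmult_assoc. apply HL.
  - apply contD_zpow; [apply circ_D0|apply circ_cont].
  - intros w hw. rewrite Cmod_mult, Cmod_zpowC, (circ_D w hw) by now apply circ_D0.
    apply Rmult_le_compat_r; [apply Rlt_le, powerRZ_lt, hr|auto].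
Qed.

Lemma circ_zpow k : k <> (-1)%Z -> I (fun w => zpowC w k) = RtoC 0.
Proof. apply cint_zpowC; [apply circ_loop|intros; now apply circ_neq0]. Qed.

(** Upwards from k = 0 the recurrence is homogeneous, so p^n times the integral is the n-th moment,
    which is O(r^n) while r < |p|. *)
Lemma circ_winding_out : r < Cmod p -> I F = RtoC 0.
Proof.
  intros h. destruct circ_mom_bound as [B [B0 HB]].
  assert (p0 : p <> RtoC 0) by (apply Cmod_gt_0; lra).
  set (d := fun k => I (fun w => F w * zpowC w k)%C).
  assert (E : I F = d 0%Z) by (apply (li_ext _ _ circ_li); intros; simpl; ring).
  assert (it : forall n, (p ^ n * I F)%C = d (Z.of_nat n)).
  { induction n as [|n IH]; [rewrite E; simpl; ring|].
    rewrite Cpow_S, <- Cmult_assoc, IH. assert (hh := circ_rec (Z.of_nat n)).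
    rewrite circ_zpow in hh by lia. fold (d (Z.of_nat n)) (d (Z.of_nat n + 1)%Z) in hh.
    replace (Z.of_nat (S n)) with (Z.of_nat n + 1)%Z by lia.
    transitivity (d (Z.of_nat n + 1)%Z - (d (Z.of_nat n + 1)%Z - p * d (Z.of_nat n)))%C; [ring|].
    rewrite hh; ring. }
  apply Cmod_eq_0. apply Rle_antisym; [|apply Cmod_ge_0].
  apply (Rpow_lim0 B (r / Cmod p)).
  - split; [apply Rlt_le, Rdiv_lt_0_compat; lra|]. apply (Rdiv_lt_1 r (Cmod p)); lra.
  - intros n. assert (hB := HB (Z.of_nat n)). fold (d (Z.of_nat n)) in hB.
    rewrite <- it, Cmod_mult, Cmod_pow, powerRZ_of_nat in hB.
    assert (pp : 0 < Cmod p ^ n) by (apply pow_lt; lra).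
    apply (Rmult_le_reg_l (Cmod p ^ n)); [assumption|]. eapply Rle_trans; [exact hB|].
    right. unfold Rdiv. rewrite Rpow_mult_distr, pow_inv. field. lra.
Qed.

(** Downwards from k = -1 the recurrence is homogeneous and forces the moment at -1 to vanish, since
    |p| < r. The step from -1 to 0 then leaves the integral of 1/w. *)
Lemma circ_winding_in : Cmod p < r -> I F = tpi.
Proof.
  intros h. destruct circ_mom_bound as [B [B0 HB]].
  set (d := fun k => I (fun w => F w * zpowC w k)%C).
  assert (E : I F = d 0%Z) by (apply (li_ext _ _ circ_li); intros; simpl; ring).
  assert (it : forall n, d (-1)%Z = (p ^ n * d (-1 - Z.of_nat n)%Z)%C).
  { induction n as [|n IH]; [simpl; ring|].
    rewrite IH, Cpow_S. assert (hh := circ_rec (-1 - Z.of_nat (S n))%Z).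
    rewrite circ_zpow in hh by lia.
    replace (-1 - Z.of_nat (S n) + 1)%Z with (-1 - Z.of_nat n)%Z in hh by lia.
    fold (d (-1 - Z.of_nat n)%Z) (d (-1 - Z.of_nat (S n))%Z) in hh.
    transitivity (p ^ n * ((d (-1 - Z.of_nat n)%Z - p * d (-1 - Z.of_nat (S n))%Z) + p * d (-1 - Z.of_nat (S n))%Z))%C;
      [ring|]. rewrite hh. ring. }
  assert (d1 : d (-1)%Z = RtoC 0).
  { apply Cmod_eq_0. apply Rle_antisym; [|apply Cmod_ge_0].
    assert (p0 := Cmod_ge_0 p).
    apply (Rpow_lim0 (B * / r) (Cmod p / r)).
    - split; [now apply Rle_mult_inv_pos|]. apply (Rdiv_lt_1 (Cmod p) r); lra.
    - intros n. rewrite (it n), Cmod_mult, Cmod_pow.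
      replace (B * / r * (Cmod p / r) ^ n) with (Cmod p ^ n * (B * powerRZ r (-1 - Z.of_nat n))).
      + apply Rmult_le_compat_l; [now apply pow_le|apply HB].
      + replace (-1 - Z.of_nat n)%Z with (- Z.of_nat (S n))%Z by lia.
        rewrite powerRZ_neg', powerRZ_of_nat. unfold Rdiv. rewrite Rpow_mult_distr, pow_inv.
        simpl. field. split; [apply pow_nonzero|]; lra. }
  assert (hh := circ_rec (-1)%Z). simpl Z.add in hh. fold (d 0%Z) (d (-1)%Z) in hh.
  rewrite d1, <- E in hh.
  transitivity (I F - p * 0)%C; [ring|]. rewrite hh.
  rewrite <- (circ_inv r hr). apply (li_ext _ _ circ_li). intros w hw.
  simpl. now rewrite Cmult_1_r.
Qed.
End Circle.

(** * The symbol and its Laurent moments *)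

(** Common shape of the two symbols: the arguments a_i w and b_i / w give psi in this order and Phi
    in the opposite one. [Gj] keeps J factors of each infinite product. *)
Definition Gq (q : R) (N : nat) (x y : nat -> C) : C :=
  prodC N (fun i => / qpoch (x i) q * qpoch (y i) q)%C.
Definition Gj (q : R) (N J : nat) (x y : nat -> C) : C :=
  prodC N (fun i => / qprod q J (x i) * qprod q J (y i))%C.

Lemma Cinv_mult x y : x <> RtoC 0 -> y <> RtoC 0 -> (/ (x * y))%C = (/ x * / y)%C.
Proof. intros; field; auto. Qed.

Section Gfun.
Context (q : R) (hq : 0 < q < 1) (N : nat).

Lemma Gq_split J x y : (forall i, (i < N)%nat -> forall j, (x i * RtoC (q ^ j))%C <> RtoC 1) ->
  Gq q N x y = (Gj q N J x y * Gq q N (fun i => x i * RtoC (q ^ J)) (fun i => y i * RtoC (q ^ J)))%C.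
Proof.
  intros H. unfold Gq, Gj. rewrite <- prodC_mult. apply prodC_ext. intros i hi.
  rewrite (qpoch_split q hq J (x i)), (qpoch_split q hq J (y i)).
  assert (h1 : qprod q J (x i) <> RtoC 0) by (apply qprod_neq0, H, hi).
  assert (h2 : qpoch (x i * RtoC (q ^ J)) q <> RtoC 0).
  { apply qpoch_neq0; [assumption|]. intros j. rewrite <- Cmult_assoc, <- RtoC_mult, <- pow_add. now apply H. }
  field. auto.
Qed.

(** The arguments enter through the bound [X] alone, so the estimate is uniform along a contour. *)
Lemma Gq_near1 X : 0 <= X -> exists K J0, 0 <= K /\ (forall J, (J0 <= J)%nat -> K * q ^ J <= / 2) /\
  forall J x y, (J0 <= J)%nat -> (forall i, (i < N)%nat -> Cmod (x i) <= X /\ Cmod (y i) <= X) ->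
  Cmod (Gq q N (fun i => x i * RtoC (q ^ J)) (fun i => y i * RtoC (q ^ J)) - 1)%C <= K * q ^ J.
Proof.
  intros X0. set (L := qlip q 1). assert (L0 : 0 < L) by now apply qlip_pos.
  (* With e = L X q^J, a factor v / u is within 2 e * 2 + e = 5 e of 1; the constant 10 leaves room,
     and the summands 1 ensure A >= 1 and X q^J <= 1. *)
  set (A := 10 * (L + 1) * (X + 1)). assert (A0 : 1 <= A) by (unfold A; nra).
  set (K := 2 ^ N * A). assert (P1 : 1 <= 2 ^ N) by (apply pow_R1_Rle; lra).
  destruct (qpow_small q hq (/ (2 * K))) as [J0 HJ0].
  { apply Rinv_0_lt_compat. unfold K. nra. }
  assert (K1 : 1 <= K) by (unfold K; nra).
  assert (small : forall J, (J0 <= J)%nat -> K * q ^ J <= / 2).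
  { intros J hJ. specialize (HJ0 J hJ). apply Rlt_le.
    apply (Rmult_lt_compat_l K) in HJ0; [|lra]. eapply Rlt_le_trans; [exact HJ0|].
    right. field. lra. }
  exists K, J0; split; [lra|split; [exact small|]].
  intros J x y hJ hxy. specialize (small J hJ).
  assert (qJ : 0 < q ^ J) by (apply pow_lt; lra).
  assert (AK : A * q ^ J <= K * q ^ J) by (apply Rmult_le_compat_r; [lra|unfold K; nra]).
  assert (near : forall z, Cmod z <= X -> Cmod (qpoch (z * RtoC (q ^ J)) q - 1) <= L * (X * q ^ J) /\ L * (X * q ^ J) <= A * q ^ J / 10).
  { intros z hz. assert (c0 := Cmod_ge_0 z).
    assert (hz' : Cmod (z * RtoC (q ^ J)) <= X * q ^ J).
    { rewrite Cmod_mult, Cmod_R, Rabs_pos_eq by lra. apply Rmult_le_compat_r; lra. }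
    assert (X * q ^ J <= 1).
    { apply Rle_trans with (A * q ^ J); [apply Rmult_le_compat_r; [lra|unfold A; nra]|lra]. }
    split.
    - eapply Rle_trans; [apply qpoch_near1; [assumption|lra]|]. fold L.
      apply Rmult_le_compat_l; lra.
    - replace (A * q ^ J / 10) with (((L + 1) * (X + 1)) * q ^ J) by (unfold A; field).
      rewrite <- Rmult_assoc. apply Rmult_le_compat_r; [lra|nra]. }
  assert (AJ : 0 <= A * q ^ J <= / 2) by (split; [apply Rmult_le_pos; lra|lra]).
  eapply Rle_trans; [apply (prodC_near1 N _ (A * q ^ J)); [lra|]|].
  - intros i hi. destruct (hxy i hi) as [hx hy].
    destruct (near _ hx) as [n1 n2]. destruct (near _ hy) as [n3 _].
    set (e := L * (X * q ^ J)) in *.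
    assert (e0 : 0 <= e) by (apply Rmult_le_pos; [lra|apply Rmult_le_pos; lra]).
    destruct (Cinv_near1 _ e ltac:(lra) n1) as [u0 u1].
    set (u := qpoch (x i * RtoC (q ^ J)) q) in *. set (v := qpoch (y i * RtoC (q ^ J)) q) in *.
    replace (/ u * v - 1)%C with ((/ u - 1) * v + (v - 1))%C by (field; assumption).
    eapply Rle_trans; [apply Cmod_triangle|]. rewrite Cmod_mult.
    assert (v2 : Cmod v <= 2).
    { assert (h := Cmod_sub_ge v 1). rewrite Cmod_1 in h. lra. }
    assert (Cmod (/ u - 1) * Cmod v <= 2 * e * 2) by (apply Rmult_le_compat; auto using Cmod_ge_0).
    lra.
  - unfold K. rewrite Rmult_assoc. apply Rmult_le_compat_r; lra.
Qed.

Context (D : C -> Prop) (I : (C -> C) -> C) (HI : lin_int D I).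
Context (x y : nat -> C -> C).
Hypothesis Hx : forall i, contD D (x i).
Hypothesis Hy : forall i, contD D (y i).
Hypothesis Hnz : forall i w j, (i < N)%nat -> D w -> (x i w * RtoC (q ^ j))%C <> RtoC 1.

Lemma contD_qprod J f : contD D f -> contD D (fun w => qprod q J (f w)).
Proof.
  intros Hf w hw. apply (cont_prodC J (fun w j => 1 - f w * RtoC (q ^ j))%C). intros j _.
  apply (cont_ext (fun w => 1 + - (1) * (f w * RtoC (q ^ j)))%C); [intros; ring|].
  apply cont_plus; [apply cont_const|apply cont_mult; [apply cont_const|]].
  apply cont_mult; [now apply Hf|apply cont_const].
Qed.

Lemma contD_qpoch f : contD D f -> contD D (fun w => qpoch (f w) q).
Proof. intros Hf w hw. apply (cont_comp (fun z => qpoch z q)); [now apply Hf|now apply cont_qpoch]. Qed.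

Lemma contD_Gq : contD D (fun w => Gq q N (fun i => x i w) (fun i => y i w)).
Proof.
  intros w hw. apply (cont_prodC N (fun w i => / qpoch (x i w) q * qpoch (y i w) q)%C). intros i hi.
  apply cont_mult; [|now apply contD_qpoch].
  apply cont_inv; [apply qpoch_neq0; auto|now apply contD_qpoch].
Qed.

Lemma contD_Gj J : contD D (fun w => Gj q N J (fun i => x i w) (fun i => y i w)).
Proof.
  intros w hw. apply (cont_prodC N (fun w i => / qprod q J (x i w) * qprod q J (y i w))%C). intros i hi.
  apply cont_mult; [|now apply contD_qprod].
  apply cont_inv; [apply qprod_neq0; auto|now apply contD_qprod].
Qed.

Lemma contD_finite_bound (f : nat -> C -> C) n : (forall i, contD D (f i)) ->
  exists B, 0 <= B /\ forall i w, (i < n)%nat -> D w -> Cmod (f i w) <= B.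
Proof.
  intros Hf. induction n as [|n [B [B0 HB]]]; [exists 0; split; [lra|intros; lia]|].
  destruct (li_cpt _ _ HI (f n) (Hf n)) as [B' [B'0 HB']].
  exists (Rmax B B'); split; [eapply Rle_trans; [exact B0|apply Rmax_l]|].
  intros i w hi hw. destruct (Nat.eq_dec i n) as [->|].
  - eapply Rle_trans; [now apply HB'|apply Rmax_r].
  - eapply Rle_trans; [apply HB; [lia|assumption]|apply Rmax_l].
Qed.

Lemma Gq_tail : exists K J0, 0 <= K /\ forall J w, (J0 <= J)%nat -> D w ->
  Cmod (Gq q N (fun i => x i w * RtoC (q ^ J)) (fun i => y i w * RtoC (q ^ J)) - 1)%C <= K * q ^ J.
Proof.
  destruct (contD_finite_bound x N Hx) as [X1 [p1 b1]]. destruct (contD_finite_bound y N Hy) as [X2 [p2 b2]].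
  destruct (Gq_near1 (Rmax X1 X2)) as [K [J0 [K0 [_ HK]]]]; [eapply Rle_trans; [exact p1|apply Rmax_l]|].
  exists K, J0; split; [assumption|]. intros J w hJ hw. apply (HK J (fun i => x i w) (fun i => y i w) hJ). intros i hi; split.
  - eapply Rle_trans; [now apply b1|apply Rmax_l].
  - eapply Rle_trans; [now apply b2|apply Rmax_r].
Qed.

Lemma Gq_Gj_close : exists K J0, forall J w, (J0 <= J)%nat -> D w ->
  Cmod (Gq q N (fun i => x i w) (fun i => y i w) - Gj q N J (fun i => x i w) (fun i => y i w)) <= K * q ^ J.
Proof.
  destruct (contD_finite_bound x N Hx) as [X1 [p1 b1]]. destruct (contD_finite_bound y N Hy) as [X2 [p2 b2]].
  destruct (Gq_near1 (Rmax X1 X2)) as [K [J0 [K0 [Ks HK]]]]; [eapply Rle_trans; [exact p1|apply Rmax_l]|].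
  destruct (li_cpt _ _ HI _ contD_Gq) as [B [B0 HB]].
  exists (B * (2 * K)), J0. intros J w hJ hw.
  assert (qJ : 0 < q ^ J) by (apply pow_lt; lra).
  assert (h := HK J (fun i => x i w) (fun i => y i w) hJ (fun i hi => conj (Rle_trans _ _ _ (b1 i w hi hw) (Rmax_l _ _))
     (Rle_trans _ _ _ (b2 i w hi hw) (Rmax_r _ _)))).
  assert (Kq : 0 <= K * q ^ J <= / 2) by (split; [apply Rmult_le_pos; lra|now apply Ks]).
  destruct (Cinv_near1 _ _ Kq h) as [t0 t1].
  assert (E := Gq_split J (fun i => x i w) (fun i => y i w) (fun i hi j => Hnz i w j hi hw)).
  specialize (HB w hw).
  set (G := Gq q N (fun i => x i w) (fun i => y i w)) in *. set (H := Gj q N J _ _) in *.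
  set (T := Gq q N (fun i => x i w * RtoC (q ^ J))%C _) in *.
  (* With G = H T, the error is expressed through G, which has a bound independent of J. *)
  replace (G - H)%C with (- (G * (/ T - 1)))%C by (rewrite E; field; assumption).
  rewrite Cmod_opp, Cmod_mult.
  replace (B * (2 * K) * q ^ J) with (B * (2 * (K * q ^ J))) by ring.
  apply Rmult_le_compat; auto using Cmod_ge_0.
Qed.
End Gfun.

(** * Vanishing moments of Phi and psi *)

Section ZintG.
Context (q : R) (hq : 0 < q < 1) (N : nat).
Context (D : C -> Prop) (I : (C -> C) -> C) (HI : lin_int D I) (D0 : forall w, D w -> w <> RtoC 0).
Context (a b : nat -> R).

Lemma contD_scal_id c : contD D (fun w => c * w)%C.
Proof. intros w _; apply cont_mult; [apply cont_const|apply cont_id]. Qed.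

Lemma contD_scal_inv c : contD D (fun w => c * / w)%C.
Proof.
  intros w hw; apply cont_mult; [apply cont_const|]. apply (cont_inv (fun z => z)); [auto|apply cont_id].
Qed.

Lemma Zint_mul_qprod_inv F c J : contD D F -> Zint I F -> Zint I (fun w => F w * qprod q J (c * / w))%C.
Proof.
  intros HF HZ. induction J as [|J IH].
  - apply (Zint_ext D I HI F); [|assumption]. intros w _. unfold qprod; simpl; ring.
  - apply (Zint_ext D I HI (fun w => (F w * qprod q J (c * / w)) * (1 - (c * RtoC (q ^ J)) * / w))%C).
    + intros w _. rewrite qprod_S; ring.
    + apply (Zint_mul_linv D I HI D0); [|assumption]. apply contD_mult; [assumption|].
      apply contD_qprod, contD_scal_inv.
Qed.

Lemma Zint_mul_qprod F c J : contD D F -> Zint I F -> Zint I (fun w => F w * qprod q J (c * w))%C.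
Proof.
  intros HF HZ. induction J as [|J IH].
  - apply (Zint_ext D I HI F); [|assumption]. intros w _. unfold qprod; simpl; ring.
  - apply (Zint_ext D I HI (fun w => (F w * qprod q J (c * w)) * (1 - (c * RtoC (q ^ J)) * w))%C).
    + intros w _. rewrite qprod_S; ring.
    + apply (Zint_mul_lin D I HI D0); [|assumption]. apply contD_mult; [assumption|].
      apply contD_qprod, contD_scal_id.
Qed.

Lemma scal_inv_neq1 c r0 w j : 0 < c < r0 -> r0 <= Cmod w -> (RtoC c * / w * RtoC (q ^ j))%C <> RtoC 1.
Proof.
  intros hc hw E. apply (f_equal Cmod) in E.
  assert (0 < q ^ j) by (apply pow_lt; lra).
  assert (q ^ j <= 1) by (rewrite <- (pow1 j); apply pow_incr; lra).
  assert (w0 : w <> RtoC 0) by (apply Cmod_gt_0; lra).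
  rewrite !Cmod_mult, Cmod_inv, !Cmod_R, Rabs_R1, !Rabs_pos_eq in E by (auto; lra).
  assert (c * / Cmod w < 1) by (apply (Rdiv_lt_1 c (Cmod w)); lra).
  assert (0 < c * / Cmod w) by (apply Rmult_lt_0_compat; [lra|apply Rinv_0_lt_compat; lra]).
  nra.
Qed.

Lemma Zint_div_qprod_inv F c r0 J : 0 < c < r0 -> (forall w, D w -> r0 <= Cmod w) ->
  contD D F -> Zint I F -> Zint I (fun w => F w * / qprod q J (RtoC c * / w))%C.
Proof.
  intros hc hD HF HZ.
  assert (nz : forall K w, D w -> qprod q K (RtoC c * / w) <> RtoC 0).
  { intros K w hw. apply qprod_neq0. intros j. apply (scal_inv_neq1 c r0); auto. }
  induction J as [|J IH].
  - apply (Zint_ext D I HI F); [|assumption]. intros w _. unfold qprod; simpl prodC. field.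
  - apply (Zint_ext D I HI (fun w => (F w * / qprod q J (RtoC c * / w)) * / (1 - RtoC (c * q ^ J) * / w))%C).
    + intros w hw. assert (h := nz (S J) w hw). rewrite qprod_S in h |- *.
      replace (1 - RtoC c * / w * RtoC (q ^ J))%C with (1 - RtoC (c * q ^ J) * / w)%C in h |- * by (rewrite RtoC_mult; ring).
      rewrite Cinv_mult; [ring|now apply nz|]. intros E; apply h; rewrite E; ring.
    + apply (Zint_growth D I HI D0 _ _ r0); [|assumption| |assumption].
      * assert (0 < q ^ J) by (apply pow_lt; lra).
        assert (q ^ J <= 1) by (rewrite <- (pow1 J); apply pow_incr; lra).
        rewrite Cmod_R, Rabs_pos_eq by nra. nra.
      * apply contD_mult; [assumption|]. apply contD_inv; [apply nz|]. apply contD_qprod, contD_scal_inv.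
Qed.

(** At finite J the denominators 1 - b_j q^i / w have their zeros inside |w| < r0 and are divided
    out by growth, while the numerators 1 - a_i q^j w only shift moments. Uniform convergence gives
    the infinite product. *)
Lemma Zint_Phi r0 : (forall j, (j < N)%nat -> 0 < b j < r0) -> (forall w, D w -> r0 <= Cmod w) ->
  Zint I (fun _ => RtoC 1) ->
  Zint I (fun w => Gq q N (fun j => RtoC (b j) * / w) (fun i => RtoC (a i) * w))%C.
Proof.
  intros hb hD H1.
  assert (nz : forall i w j, (i < N)%nat -> D w -> (RtoC (b i) * / w * RtoC (q ^ j))%C <> RtoC 1).
  { intros i w j hi hw. apply (scal_inv_neq1 _ r0); auto. }
  assert (ZJ : forall J, Zint I (fun w => Gj q N J (fun j => RtoC (b j) * / w) (fun i => RtoC (a i) * w))%C).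
  { intros J. unfold Gj.
    assert (st : forall n, (n <= N)%nat -> Zint I (fun w => prodC n (fun i =>
       / qprod q J (RtoC (b i) * / w) * qprod q J (RtoC (a i) * w))%C) /\
       contD D (fun w => prodC n (fun i => / qprod q J (RtoC (b i) * / w) * qprod q J (RtoC (a i) * w))%C)).
    { induction n as [|n IH]; intros hn; [split; [exact H1|intros w _; exact (cont_const (RtoC 1) w)]|].
      destruct IH as [IZ IC]; [lia|]. simpl.
      assert (cinv : contD D (fun w => / qprod q J (RtoC (b n) * / w))%C).
      { apply contD_inv; [|apply contD_qprod, contD_scal_inv].
        intros w hw. apply qprod_neq0. intros j; apply nz; [lia|assumption]. }
      split; [|apply contD_mult; [assumption|]; apply contD_mult; [exact cinv|apply contD_qprod, contD_scal_id]].
      set (F := fun w => prodC n (fun i => / qprod q J (RtoC (b i) * / w) * qprod q J (RtoC (a i) * w))%C) in *.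
      apply (Zint_ext D I HI (fun w => (F w * / qprod q J (RtoC (b n) * / w)) * qprod q J (RtoC (a n) * w))%C).
      { intros w _. unfold F. ring. }
      apply Zint_mul_qprod; [apply contD_mult; assumption|].
      apply (Zint_div_qprod_inv F (b n) r0); auto. }
    apply (st N (Nat.le_refl N)). }
  destruct (Gq_Gj_close q hq N D I HI (fun j w => RtoC (b j) * / w)%C (fun i w => RtoC (a i) * w)%C) as [K [J0 HK]].
  - intros; apply contD_scal_inv.
  - intros; apply contD_scal_id.
  - exact nz.
  - apply (Zint_limit D I HI D0 _ (fun J w => Gj q N J (fun j => RtoC (b j) * / w) (fun i => RtoC (a i) * w))%C K q J0); auto.
    + lra.
    + apply (contD_Gq q hq N D (fun j w => RtoC (b j) * / w)%C (fun i w => RtoC (a i) * w)%C); auto.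
      * intros; apply contD_scal_inv.
      * intros; apply contD_scal_id.
    + intros J. apply (contD_Gj q N D (fun j w => RtoC (b j) * / w)%C (fun i w => RtoC (a i) * w)%C); auto.
      * intros; apply contD_scal_inv.
      * intros; apply contD_scal_id.
Qed.

Definition poles (J : nat) : list C :=
  flat_map (fun i => map (fun j => RtoC (a i * q ^ j)) (seq 0 J)) (seq 0 N).

Lemma lprodinv_app l1 l2 w : lprodinv (l1 ++ l2) w = (lprodinv l1 w * lprodinv l2 w)%C.
Proof. induction l1 as [|p l1 IH]; simpl; [ring|rewrite IH; ring]. Qed.

Lemma lprodinv_qprod c J w : (forall j, (RtoC c * w * RtoC (q ^ j))%C <> RtoC 1) ->
  lprodinv (map (fun j => RtoC (c * q ^ j)) (seq 0 J)) w = (/ qprod q J (RtoC c * w))%C.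
Proof.
  intros H. induction J as [|J IH].
  - unfold qprod; simpl. field.
  - rewrite seq_S, map_app, lprodinv_app, IH, qprod_S. simpl.
    rewrite Cinv_mult.
    + rewrite RtoC_mult. replace (RtoC c * w * RtoC (q ^ J))%C with (RtoC c * RtoC (q ^ J) * w)%C by ring. ring.
    + now apply qprod_neq0.
    + intros E. apply (H J). replace (RtoC c * w * RtoC (q ^ J))%C with (1 - (1 - RtoC c * w * RtoC (q ^ J)))%C by ring.
      rewrite E; ring.
Qed.

Lemma lprodinv_poles J w : (forall i j, (i < N)%nat -> (RtoC (a i) * w * RtoC (q ^ j))%C <> RtoC 1) ->
  lprodinv (poles J) w = prodC N (fun i => / qprod q J (RtoC (a i) * w))%C.
Proof.
  intros H. unfold poles. induction N as [|n IH]; [easy|].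
  rewrite seq_S, flat_map_app, lprodinv_app, IH by (intros; apply H; lia). simpl.
  rewrite app_nil_r, lprodinv_qprod by (intros; apply H; lia). reflexivity.
Qed.

Lemma NoDup_poles J : (forall i i' j j', (i < N)%nat -> (i' < N)%nat -> a i * q ^ j = a i' * q ^ j' -> i = i' /\ j = j') ->
  NoDup (poles J).
Proof.
  intros H. unfold poles. induction N as [|n IH]; [constructor|].
  rewrite seq_S, flat_map_app. simpl. rewrite app_nil_r. apply NoDup_app.
  - apply IH. intros; apply H; auto.
  - apply Injective_map_NoDup_in; [|apply seq_NoDup].
    intros j j' _ _ E. injection E as E1. destruct (H n n j j') as [_ h]; auto.
  - intros p hp hp'. apply in_flat_map in hp as [i [hi hp]]. apply in_seq in hi.
    apply in_map_iff in hp as [j [<- _]]. apply in_map_iff in hp' as [j' [E _]].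
    injection E as E1. destruct (H n i j' j) as [h _]; [lia|lia|assumption|]. lia.
Qed.

(** At finite J the denominators are treated by partial fractions, which need the distinctness of
    all a_i q^j, and the numerators 1 - b_i q^j / w shift moments. Then J goes to infinity. *)
Lemma Zint_psi : (forall i i' j j', (i < N)%nat -> (i' < N)%nat -> a i * q ^ j = a i' * q ^ j' -> i = i' /\ j = j') ->
  (forall i, (i < N)%nat -> 0 < a i) ->
  (forall i w j, (i < N)%nat -> D w -> (RtoC (a i) * w * RtoC (q ^ j))%C <> RtoC 1) ->
  Zint I (fun _ => RtoC 1) ->
  (forall i j, (i < N)%nat -> I (fun w => / (1 - RtoC (a i * q ^ j) * w))%C = RtoC 0) ->
  Zint I (fun w => Gq q N (fun i => RtoC (a i) * w) (fun j => RtoC (b j) * / w))%C.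
Proof.
  intros inj ha nz H1 H0.
  assert (pin : forall J p, In p (poles J) -> exists i j, (i < N)%nat /\ p = RtoC (a i * q ^ j)).
  { intros J p hp. apply in_flat_map in hp as [i [hi hp]]. apply in_seq in hi.
    apply in_map_iff in hp as [j [<- _]]. exists i, j; split; [lia|reflexivity]. }
  assert (nz1 : forall i j w, (i < N)%nat -> D w -> (1 - RtoC (a i * q ^ j) * w)%C <> RtoC 0).
  { intros i j w hi hw E. apply (nz i w j hi hw).
    replace (RtoC (a i) * w * RtoC (q ^ j))%C with (1 - (1 - RtoC (a i * q ^ j) * w))%C by (rewrite RtoC_mult; ring).
    rewrite E; ring. }
  assert (c1 : forall J, contD D (lprodinv (poles J))).
  { intros J. apply contD_lprodinv. intros p w hp hw. destruct (pin J p hp) as [i [j [hi ->]]]. now apply nz1. }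
  assert (ZJ : forall J, Zint I (fun w => Gj q N J (fun i => RtoC (a i) * w) (fun j => RtoC (b j) * / w))%C).
  { intros J.
    apply (Zint_ext D I HI (fun w => lprodinv (poles J) w * prodC N (fun j => qprod q J (RtoC (b j) * / w)))%C).
    { intros w hw. rewrite lprodinv_poles by (intros; now apply nz). unfold Gj. now rewrite prodC_mult. }
    assert (st : forall n, Zint I (fun w => lprodinv (poles J) w * prodC n (fun j => qprod q J (RtoC (b j) * / w)))%C /\
       contD D (fun w => lprodinv (poles J) w * prodC n (fun j => qprod q J (RtoC (b j) * / w)))%C).
    { induction n as [|n [IZ IC]].
      - assert (Z0 : Zint I (lprodinv (poles J))).
        { apply (Zint_lprodinv D I HI D0); [now apply NoDup_poles|assumption|].
          intros p hp. destruct (pin J p hp) as [i [j [hi ->]]].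
          split; [|split; [intros; now apply nz1|now apply H0]].
          intros E. injection E as E1. specialize (ha i hi). assert (0 < q ^ j) by (apply pow_lt; lra). nra. }
        split; [apply (Zint_ext D I HI (lprodinv (poles J))); [intros; simpl; ring|exact Z0]|].
        apply contD_mult; [apply c1|intros w _; exact (cont_const (RtoC 1) w)].
      - split.
        + apply (Zint_ext D I HI (fun w => (lprodinv (poles J) w * prodC n (fun j => qprod q J (RtoC (b j) * / w))) *
             qprod q J (RtoC (b n) * / w))%C); [intros; simpl; ring|].
          now apply Zint_mul_qprod_inv.
        + intros w hw. apply (cont_ext (fun w => (lprodinv (poles J) w * prodC n (fun j => qprod q J (RtoC (b j) * / w))) *
             qprod q J (RtoC (b n) * / w))%C); [intros; simpl; ring|].
          apply cont_mult; [now apply IC|].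
          apply (contD_qprod q D J (fun w => RtoC (b n) * / w)%C); [apply contD_scal_inv|exact hw]. }
    apply st. }
  destruct (Gq_Gj_close q hq N D I HI (fun i w => RtoC (a i) * w)%C (fun j w => RtoC (b j) * / w)%C) as [K [J0 HK]].
  - intros; apply contD_scal_id.
  - intros; apply contD_scal_inv.
  - exact nz.
  - apply (Zint_limit D I HI D0 _ (fun J w => Gj q N J (fun i => RtoC (a i) * w) (fun j => RtoC (b j) * / w))%C K q J0); auto.
    + lra.
    + apply (contD_Gq q hq N D (fun i w => RtoC (a i) * w)%C (fun j w => RtoC (b j) * / w)%C); auto.
      * intros; apply contD_scal_id.
      * intros; apply contD_scal_inv.
    + intros J. apply (contD_Gj q N D (fun i w => RtoC (a i) * w)%C (fun j w => RtoC (b j) * / w)%C); auto.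
      * intros; apply contD_scal_id.
      * intros; apply contD_scal_inv.
Qed.
End ZintG.

(** * Expansion of the double integral *)

(** On a circle this is the n-th Laurent coefficient. For a general functional the same formula lets
    an integral along D be compared with coefficients on circles. *)
Definition Imom (I : (C -> C) -> C) (F : C -> C) (n : Z) : C :=
  (I (fun w => F w * zpowC w (- n - 1))%C * / tpi)%C.

Definition Icirc (s : R) : (C -> C) -> C := cint (circ s) (dcirc s).
Definition Dcirc (s : R) : C -> Prop := trace (circ s).

Lemma Icirc_li s : lin_int (Dcirc s) (Icirc s).
Proof. exact (circ_li s). Qed.

Lemma Icirc_inv s : 0 < s -> Icirc s (fun w => / w)%C = tpi.
Proof. exact (circ_inv s). Qed.

Lemma Icirc_zpow s k : 0 < s -> k <> (-1)%Z -> Icirc s (fun w => zpowC w k) = RtoC 0.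
Proof. intros hs; exact (circ_zpow s hs k). Qed.

Lemma Cmod_tpi : 0 < Cmod tpi.
Proof. apply Cmod_gt_0, tpi_neq0. Qed.

Lemma Dcirc_Cmod s w : 0 < s -> Dcirc s w -> Cmod w = s.
Proof. intros hs hw. exact (circ_D s hs w hw). Qed.

Lemma Dcirc_neq0 s w : 0 < s -> Dcirc s w -> w <> RtoC 0.
Proof. intros hs hw. exact (circ_D0 s hs w hw). Qed.

(** Cauchy's estimate. [L] is fixed before [F], so coefficients of a small function are small,
    uniformly. *)
Lemma Imom_circ_bound s : 0 < s -> exists L, 0 < L /\ forall F B n, contD (Dcirc s) F ->
  (forall w, Dcirc s w -> Cmod (F w) <= B) -> Cmod (Imom (Icirc s) F n) <= L * B * powerRZ s (- n).
Proof.
  intros hs. destruct (li_bound _ _ (Icirc_li s)) as [L [L0 HL]].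
  assert (t0 := Cmod_tpi).
  exists ((L + 1) * / s * / Cmod tpi); split.
  { repeat apply Rmult_lt_0_compat; try apply Rinv_0_lt_compat; lra. }
  intros F B n HF HB. unfold Imom. rewrite Cmod_mult, Cmod_inv by apply tpi_neq0.
  assert (h : Cmod (Icirc s (fun w => F w * zpowC w (- n - 1))%C) <= L * (B * powerRZ s (- n - 1))).
  { apply HL.
    - apply contD_zpow; [intros; now apply (Dcirc_neq0 s)|assumption].
    - intros w hw. rewrite Cmod_mult, Cmod_zpowC, (Dcirc_Cmod s w hs hw) by now apply (Dcirc_neq0 s).
      apply Rmult_le_compat_r; [apply Rlt_le, powerRZ_lt, hs|auto]. }
  assert (hp : powerRZ s (- n - 1) = powerRZ s (- n) * / s).
  { unfold Zminus. rewrite powerRZ_add by lra. f_equal. simpl. now rewrite Rmult_1_r. }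
  rewrite hp in h.
  assert (B0 : 0 <= B).
  { eapply Rle_trans; [apply Cmod_ge_0|]. apply (HB (circ s 0)). exists 0; split; [lra|reflexivity]. }
  assert (ps := powerRZ_lt s (- n) hs). assert (si := Rinv_0_lt_compat s hs).
  assert (ti := Rinv_0_lt_compat _ t0).
  eapply Rle_trans; [apply Rmult_le_compat_r; [lra|exact h]|].
  replace (L * (B * (powerRZ s (- n) * / s)) * / Cmod tpi) with
    (L * (/ s * / Cmod tpi * B * powerRZ s (- n))) by ring.
  replace ((L + 1) * / s * / Cmod tpi * B * powerRZ s (- n)) with
    ((L + 1) * (/ s * / Cmod tpi * B * powerRZ s (- n))) by ring.
  apply Rmult_le_compat_r; [|lra]. repeat apply Rmult_le_pos; lra.
Qed.

Lemma Imom_circ_bound_ex s F : 0 < s -> contD (Dcirc s) F -> exists K, 0 < K /\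
  forall n, Cmod (Imom (Icirc s) F n) <= K * powerRZ s (- n).
Proof.
  intros hs HF. destruct (Imom_circ_bound s hs) as [L [L0 HL]].
  destruct (li_cpt _ _ (Icirc_li s) F HF) as [B [B0 HB]].
  exists (L * (B + 1)); split; [apply Rmult_lt_0_compat; lra|]. intros n. apply HL; [assumption|].
  intros w hw. eapply Rle_trans; [now apply HB|lra].
Qed.

Section Linear.
Context (D : C -> Prop) (I : (C -> C) -> C) (HI : lin_int D I) (D0 : forall w, D w -> w <> RtoC 0).

Lemma Imom_ext F G n : (forall w, D w -> F w = G w) -> Imom I F n = Imom I G n.
Proof. intros E. unfold Imom. f_equal. apply (li_ext _ _ HI). intros w hw; now rewrite E. Qed.

Lemma Imom_plus F G n : contD D F -> contD D G ->
  Imom I (fun w => F w + G w)%C n = (Imom I F n + Imom I G n)%C.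
Proof.
  intros HF HG. unfold Imom.
  rewrite (li_ext _ _ HI _ (fun w => F w * zpowC w (- n - 1) + G w * zpowC w (- n - 1))%C) by (intros; ring).
  rewrite (li_plus _ _ HI) by now apply contD_zpow. ring.
Qed.

Lemma Imom_lin F p n : contD D F ->
  Imom I (fun w => F w * (1 - p * w))%C n = (Imom I F n - p * Imom I F (n - 1))%C.
Proof.
  intros HF. unfold Imom.
  rewrite (li_ext _ _ HI _ (fun w => F w * zpowC w (- n - 1) + - p * (F w * zpowC w (- (n - 1) - 1)))%C).
  - rewrite (li_lin2 D I HI) by now apply contD_zpow. ring.
  - intros w hw. replace (- (n - 1) - 1)%Z with (- n - 1 + 1)%Z by lia. rewrite zpowC_S by auto. cbv beta; ring.
Qed.

Lemma Imom_linv F p n : contD D F ->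
  Imom I (fun w => F w * (1 - p * / w))%C n = (Imom I F n - p * Imom I F (n + 1))%C.
Proof.
  intros HF. unfold Imom.
  rewrite (li_ext _ _ HI _ (fun w => F w * zpowC w (- n - 1) + - p * (F w * zpowC w (- (n + 1) - 1)))%C).
  - rewrite (li_lin2 D I HI) by now apply contD_zpow. ring.
  - intros w hw. replace (- (n + 1) - 1)%Z with (- n - 1 - 1)%Z by lia. rewrite (zpowC_pred w (- n - 1)) by auto. cbv beta; ring.
Qed.
End Linear.

Lemma Imom_circ_1 s n : 0 < s -> Imom (Icirc s) (fun _ => RtoC 1) n = if Z.eqb n 0 then RtoC 1 else RtoC 0.
Proof.
  intros hs. unfold Imom.
  rewrite (li_ext _ _ (Icirc_li s) _ (fun w => zpowC w (- n - 1))) by (intros; ring).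
  destruct (Z.eqb_spec n 0) as [->|hn].
  - rewrite (li_ext _ _ (Icirc_li s) _ (fun w => / w)%C).
    + rewrite (Icirc_inv s hs). apply Cinv_r, tpi_neq0.
    + intros w hw. simpl. now rewrite Cmult_1_r.
  - rewrite (Icirc_zpow s _ hs) by lia. ring.
Qed.

(* [1/(z-w) = - sum_(l<L) z^l w^(-l-1) + (z/w)^L / (z-w)], integrated in both variables. *)
Section Double.
Context (D1 D2 : C -> Prop) (I1 I2 : (C -> C) -> C) (H1 : lin_int D1 I1) (H2 : lin_int D2 I2).
Context (A B : C -> C) (HA : contD D1 A) (HB : contD D2 B) (r : R) (hr : 0 < r).
Hypothesis D1r : forall z, D1 z -> Cmod z = r.
Hypothesis D2r : forall w, D2 w -> r < Cmod w.

(** A positive distance between the contours, obtained by applying [li_cpt] to 1/(|w| - r). *)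
Lemma double_gap : exists rh, r < rh /\ forall w, D2 w -> rh <= Cmod w.
Proof.
  destruct (li_cpt _ _ H2 (fun w => / (RtoC (Cmod w) - RtoC r))%C) as [M [M0 HM]].
  { apply contD_inv.
    - intros w hw E. specialize (D2r w hw). rewrite <- RtoC_minus in E. injection E; lra.
    - intros w hw. apply (cont_lipschitz _ w 1 1); [lra|lra|]. intros w' _.
      replace (RtoC (Cmod w') - RtoC r - (RtoC (Cmod w) - RtoC r))%C with (RtoC (Cmod w' - Cmod w))
        by (rewrite RtoC_minus; ring).
      rewrite Cmod_R, Rmult_1_l. apply Rabs_le; split.
      + assert (h := Cmod_sub_ge w w'). rewrite Cmod_minus_sym in h. lra.
      + apply Cmod_sub_ge. }
  exists (r + / (M + 1)); split; [assert (0 < / (M + 1)) by (apply Rinv_0_lt_compat; lra); lra|].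
  intros w hw. specialize (HM w hw). specialize (D2r w hw).
  rewrite <- RtoC_minus, Cmod_inv, Cmod_R, Rabs_pos_eq in HM by
    (try lra; intros E; injection E; lra).
  assert (d0 : 0 < Cmod w - r) by lra.
  apply Rmult_le_compat_r with (r := Cmod w - r) in HM; [|lra].
  rewrite Rinv_l in HM by lra.
  assert (/ (M + 1) <= Cmod w - r); [|lra].
  apply (Rmult_le_reg_l (M + 1)); [lra|]. rewrite Rinv_r by lra. nra.
Qed.

Lemma contD_double_inner rh z : r < rh -> (forall w, D2 w -> rh <= Cmod w) -> Cmod z < rh ->
  contD D2 (fun w => B w * / (z - w))%C.
Proof.
  intros h1 h2 hz. apply contD_mult; [exact HB|]. apply contD_inv.
  - intros w hw E. specialize (h2 w hw). assert (e : z = w).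
    { replace z with ((z - w) + w)%C by ring. rewrite E; ring. } subst; lra.
  - intros w _. apply (cont_ext (fun w => z + - (1) * w)%C); [intros; ring|].
    apply cont_plus; [apply cont_const|]. apply cont_mult; [apply cont_const|apply cont_id].
Qed.

(** Linearity of the outer integral is available for continuous integrands only. Continuity comes
    from the difference of 1/(z' - w) and 1/(z - w), with z' restricted to stay at distance de/2
    from the w-contour. *)
Lemma contD_double : contD D1 (fun z => I2 (fun w => B w * / (z - w))%C).
Proof.
  destruct double_gap as [rh [h1 h2]].
  destruct (li_bound _ _ H2) as [L [L0 HL]]. destruct (li_cpt _ _ H2 B HB) as [M [M0 HM]].
  set (de := rh - r). assert (de0 : 0 < de) by (unfold de; lra).
  intros z hz. assert (zr := D1r z hz).
  apply (cont_lipschitz _ z (de / 2) (L * (M * (/ (de / 2) * / de)))); [lra| |].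
  { apply Rmult_le_pos; [assumption|]. apply Rmult_le_pos; [assumption|].
    apply Rlt_le, Rmult_lt_0_compat; apply Rinv_0_lt_compat; lra. }
  intros z' hz'.
  assert (zr' : Cmod z' < r + de / 2).
  { assert (h := Cmod_sub_ge z' z). lra. }
  assert (c1 : contD D2 (fun w => B w * / (z - w))%C) by (apply (contD_double_inner rh); auto; lra).
  assert (c2 : contD D2 (fun w => B w * / (z' - w))%C) by (apply (contD_double_inner rh); auto; unfold de in zr'; lra).
  replace (I2 (fun w => B w * / (z' - w)) - I2 (fun w => B w * / (z - w)))%C with
    (I2 (fun w => B w * / (z' - w)) + - (1) * I2 (fun w => B w * / (z - w)))%C by ring.
  rewrite <- (li_lin2 D2 I2 H2) by assumption.
  replace (L * (M * (/ (de / 2) * / de)) * Cmod (z' - z)) with (L * (M * (Cmod (z' - z) * (/ (de / 2) * / de)))) by ring.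
  apply HL.
  { intros w hw. apply cont_plus; [now apply c2|]. apply cont_mult; [apply cont_const|now apply c1]. }
  intros w hw. specialize (h2 w hw).
  assert (g1 : de <= Cmod (z - w)).
  { assert (h := Cmod_sub_ge w z). rewrite Cmod_minus_sym in h. unfold de; lra. }
  assert (g2 : de / 2 <= Cmod (z' - w)).
  { assert (h := Cmod_sub_ge w z'). rewrite Cmod_minus_sym in h. unfold de in *; lra. }
  assert (n1 : (z - w)%C <> RtoC 0) by (apply Cmod_gt_0; lra).
  assert (n2 : (z' - w)%C <> RtoC 0) by (apply Cmod_gt_0; lra).
  replace (B w * / (z' - w) + - (1) * (B w * / (z - w)))%C with
    (B w * (- (z' - z) * (/ (z' - w) * / (z - w))))%C by (field; auto).
  rewrite !Cmod_mult, Cmod_opp, !Cmod_inv by assumption.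
  apply Rmult_le_compat; [apply Cmod_ge_0| |now apply HM|].
  - apply Rmult_le_pos; [apply Cmod_ge_0|]. apply Rmult_le_pos; apply Rlt_le, Rinv_0_lt_compat; lra.
  - apply Rmult_le_compat_l; [apply Cmod_ge_0|].
    apply Rmult_le_compat; try (apply Rlt_le, Rinv_0_lt_compat; lra); apply Rinv_le_contravar; lra.
Qed.

Lemma double_expand : Clim (fun L => csum L (fun l =>
    I1 (fun z => A z * z ^ l)%C * I2 (fun w => B w * (/ w) ^ S l)%C)%C)
  (- I1 (fun z => A z * I2 (fun w => B w * / (z - w)))%C)%C.
Proof.
  destruct double_gap as [rh [h1 h2]].
  destruct (li_bound _ _ H2) as [L [L0 HL]]. destruct (li_cpt _ _ H2 B HB) as [M [M0 HM]].
  destruct (li_bound _ _ H1) as [L' [L'0 HL']]. destruct (li_cpt _ _ H1 A HA) as [M' [M'0 HM']].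
  assert (D20 : forall w, D2 w -> w <> RtoC 0) by (intros w hw; apply Cmod_gt_0; specialize (D2r w hw); lra).
  set (h := fun z => I2 (fun w => B w * / (z - w))%C).
  set (P := fun (n : nat) => I2 (fun w => B w * (/ w) ^ S n)%C).
  assert (cw : forall n, contD D2 (fun w => B w * (/ w) ^ n)%C).
  { intros n. apply contD_mult; [assumption|]. intros w hw. apply (cont_comp (fun x => x ^ n)%C (fun w => / w)%C).
    - apply (cont_inv (fun z => z)); [auto|apply cont_id].
    - apply cont_pow. }
  assert (cz : forall n, contD D1 (fun z => A z * z ^ n)%C).
  { intros n. apply contD_mult; [assumption|]. intros z hz; apply cont_pow. }
  assert (ch : contD D1 h) by apply contD_double.
  set (x := r / rh). assert (hx : 0 <= x < 1).
  { unfold x; split; [apply Rlt_le, Rdiv_lt_0_compat; lra|apply (Rdiv_lt_1 r rh); lra]. }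
  set (K := L' * (M' * (L * (M * / (rh - r))))).
  (* Exact remainder of the geometric expansion, integrated in w; on the contours it is of order (r
     / rh)^n. *)
  assert (rem : forall n z, D1 z -> (h z + csum n (fun l => z ^ l * P l))%C =
     (z ^ n * I2 (fun w => (B w * (/ w) ^ n) * / (z - w)))%C).
  { intros n z hz. assert (zr := D1r z hz). induction n as [|n IH].
    - simpl csum. rewrite Cplus_0_r. replace (z ^ 0)%C with (RtoC 1) by reflexivity. rewrite Cmult_1_l.
      apply (li_ext _ _ H2). intros w _. replace ((/ w) ^ 0)%C with (RtoC 1) by reflexivity. ring.
    - simpl csum. rewrite Cplus_assoc, IH.
      assert (e : I2 (fun w => (B w * (/ w) ^ n) * / (z - w))%C =
         (- (1) * P n + z * I2 (fun w => (B w * (/ w) ^ S n) * / (z - w)))%C).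
      { unfold P.
        assert (cc : contD D2 (fun w => (B w * (/ w) ^ S n) * / (z - w))%C).
        { apply contD_mult; [apply cw|]. apply contD_inv.
          - intros w hw E. specialize (D2r w hw). assert (ez : z = w).
            { replace z with ((z - w) + w)%C by ring. rewrite E; ring. } subst; lra.
          - intros w _. apply (cont_ext (fun w => z + - (1) * w)%C); [intros; ring|].
            apply cont_plus; [apply cont_const|]. apply cont_mult; [apply cont_const|apply cont_id]. }
        rewrite <- (li_scal _ _ H2 (- (1))%C) by apply cw.
        rewrite <- (li_lin2 D2 I2 H2 (fun w => - (1) * (B w * (/ w) ^ S n))%C) by
          (first [assumption | apply contD_mult; [intros w _; apply cont_const|apply cw]]).
        apply (li_ext _ _ H2). intros w hw. rewrite Cpow_S.
        assert (w0 := D20 w hw). specialize (D2r w hw).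
        assert (zw : (z - w)%C <> RtoC 0).
        { intros E. assert (ez : z = w) by (replace z with ((z - w) + w)%C by ring; rewrite E; ring).
          subst; lra. }
        field; auto. }
      rewrite e, Cpow_S. ring. }
  apply Clim_squeeze with (fun n => K * x ^ n); [|now apply is_lim_geom0]. intros n.
  replace (csum n (fun l => I1 (fun z => A z * z ^ l) * I2 (fun w => B w * (/ w) ^ S l))%C -
     - I1 (fun z => A z * I2 (fun w => B w * / (z - w))))%C with
     (I1 (fun z => A z * h z) + csum n (fun l => I1 (fun z => A z * z ^ l) * P l)%C)%C by (unfold h, P; ring).
  (* Continuity of the accumulated integrand is proved in the same induction, being needed for
     linearity at the next step. *)
  assert (e : (I1 (fun z => A z * h z) + csum n (fun l => I1 (fun z => A z * z ^ l) * P l)%C)%C =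
     I1 (fun z => A z * (h z + csum n (fun l => z ^ l * P l)))%C /\
     contD D1 (fun z => A z * (h z + csum n (fun l => z ^ l * P l)))%C).
  { induction n as [|n [IH IC]].
    - split.
      + simpl csum. rewrite Cplus_0_r. apply (li_ext _ _ H1). intros; ring.
      + apply contD_mult; [assumption|]. intros z hz. apply cont_plus; [now apply ch|exact (cont_const (RtoC 0) z)].
    - split.
      + simpl csum. rewrite Cplus_assoc, IH, Cmult_comm.
        replace (I1 (fun z => A z * (h z + csum n (fun l => z ^ l * P l))) + I1 (fun z => A z * z ^ n) * P n)%C
          with (I1 (fun z => A z * (h z + csum n (fun l => z ^ l * P l))) + P n * I1 (fun z => A z * z ^ n))%C by ring.
        rewrite <- (li_lin2 D1 I1 H1) by auto. apply (li_ext _ _ H1). intros; ring.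
      + intros z hz. apply (cont_ext (fun z => A z * (h z + csum n (fun l => z ^ l * P l)) + (A z * z ^ n) * P n)%C).
        * intros; simpl csum; ring.
        * apply cont_plus; [now apply IC|]. apply cont_mult; [now apply cz|apply cont_const]. }
  destruct e as [-> IC].
  unfold K. rewrite Rmult_assoc. apply HL'; [exact IC|].
  intros z hz. rewrite rem, Cmod_mult by assumption. assert (zr := D1r z hz).
  replace (M' * (L * (M * / (rh - r))) * x ^ n) with (M' * (L * (M * / (rh - r)) * x ^ n)) by ring.
  apply Rmult_le_compat; [apply Cmod_ge_0|apply Cmod_ge_0|now apply HM'|].
  rewrite Cmod_mult, Cmod_pow, zr.
  replace (L * (M * / (rh - r)) * x ^ n) with (r ^ n * (L * (M * (/ rh) ^ n * / (rh - r)))).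
  2: { unfold x, Rdiv. rewrite Rpow_mult_distr. ring. }
  apply Rmult_le_compat_l; [apply pow_le; lra|]. apply HL.
  - apply contD_mult; [apply cw|]. apply contD_inv.
    + intros w hw E. specialize (D2r w hw). assert (ez : z = w).
      { replace z with ((z - w) + w)%C by ring. rewrite E; ring. } subst; lra.
    + intros w _. apply (cont_ext (fun w => z + - (1) * w)%C); [intros; ring|].
      apply cont_plus; [apply cont_const|]. apply cont_mult; [apply cont_const|apply cont_id].
  - intros w hw. specialize (h2 w hw).
    assert (g1 : rh - r <= Cmod (z - w)).
    { assert (hh := Cmod_sub_ge w z). rewrite Cmod_minus_sym in hh. lra. }
    rewrite !Cmod_mult, Cmod_pow, !Cmod_inv by (first [now apply D20|apply Cmod_gt_0; lra]).
    apply Rmult_le_compat.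
    + apply Rmult_le_pos; [apply Cmod_ge_0|apply pow_le, Rlt_le, Rinv_0_lt_compat; lra].
    + apply Rlt_le, Rinv_0_lt_compat; lra.
    + apply Rmult_le_compat; [apply Cmod_ge_0|apply pow_le, Rlt_le, Rinv_0_lt_compat; lra|now apply HM|].
      apply pow_incr; split; [apply Rlt_le, Rinv_0_lt_compat; lra|apply Rinv_le_contravar; lra].
    + apply Rinv_le_contravar; lra.
Qed.
End Double.

(** * The symbols are inverse to each other *)

Lemma powerRZ_plus_nat x k (M : nat) : 0 < x -> powerRZ x (k + Z.of_nat M) = powerRZ x k * x ^ M.
Proof. intros; rewrite powerRZ_add, powerRZ_of_nat; lra. Qed.

Lemma powerRZ_minus_nat x k (M : nat) : 0 < x -> powerRZ x (k + - Z.of_nat M) = powerRZ x k * (/ x) ^ M.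
Proof. intros; rewrite powerRZ_add, powerRZ_neg', powerRZ_of_nat, pow_inv; lra. Qed.

Lemma cbox_telescope M (H : Z -> C) :
  cbox M (fun m => H m - H (m + 1)%Z)%C = (H (- Z.of_nat M)%Z - H (Z.of_nat M + 1)%Z)%C.
Proof.
  induction M as [|M IH].
  - unfold cbox; simpl. ring.
  - rewrite cbox_S, IH. replace (- Z.of_nat (S M) + 1)%Z with (- Z.of_nat M)%Z by lia.
    replace (Z.of_nat (S M)) with (Z.of_nat M + 1)%Z by lia. ring.
Qed.

Lemma cbox_at M (a : nat) (g : Z -> C) : (a <= M)%nat ->
  cbox M (fun m => (if Z.eqb (Z.of_nat a - m) 0 then RtoC 1 else RtoC 0) * g m)%C = g (Z.of_nat a).
Proof.
  intros ha. unfold cbox.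
  rewrite (csum_ext _ _ (fun i => dltC (a + M) i * g (Z.of_nat i - Z.of_nat M)%Z)%C).
  - rewrite csum_dlt_l by lia. f_equal; lia.
  - intros i hi. f_equal. unfold dltC.
    destruct (Z.eqb_spec (Z.of_nat a - (Z.of_nat i - Z.of_nat M)) 0);
      destruct (Nat.eqb_spec (a + M) i); try reflexivity; lia.
Qed.

Section Pair.
Context (s0 s1 s2 : R) (hs2 : 0 < s2) (hs20 : s2 < s0) (hs01 : s0 < s1).

Definition D12 (w : C) : Prop := Dcirc s1 w \/ Dcirc s2 w.
(** When all moments for this difference vanish, F has the same coefficients on s1 and on s2, so
    they can be estimated by s1^(-n) for n > 0 and by s2^(-n) for n < 0, on either side of s0. *)
Definition I12 (F : C -> C) : C := (Icirc s1 F + - (1) * Icirc s2 F)%C.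

Lemma I12_li : lin_int D12 I12.
Proof. exact (lin_int_comb _ _ _ _ (- (1))%C (Icirc_li s1) (Icirc_li s2)). Qed.

Lemma D12_0 w : D12 w -> w <> RtoC 0.
Proof. intros [h|h]; [apply (Dcirc_neq0 s1)|apply (Dcirc_neq0 s2)]; auto; lra. Qed.

Lemma D12_1 F : contD D12 F -> contD (Dcirc s1) F.
Proof. intros H w hw; apply H; now left. Qed.

Lemma D12_2 F : contD D12 F -> contD (Dcirc s2) F.
Proof. intros H w hw; apply H; now right. Qed.

Lemma Imom12 F n : Zint I12 F -> Imom (Icirc s1) F n = Imom (Icirc s2) F n.
Proof.
  intros H. specialize (H (- n - 1)%Z). unfold I12 in H. unfold Imom. f_equal.
  set (x := Icirc s1 _) in *. set (y := Icirc s2 _) in *.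
  replace x with ((x + - (1) * y) + y)%C by ring. rewrite H; ring.
Qed.

Lemma Zint12_1 : Zint I12 (fun _ => RtoC 1).
Proof.
  intros k. assert (h1 := Imom_circ_1 s1 (- k - 1) ltac:(lra)). assert (h2 := Imom_circ_1 s2 (- k - 1) hs2).
  unfold Imom in *. replace (- (- k - 1) - 1)%Z with k in * by lia.
  unfold I12. set (x := Icirc s1 _) in *. set (y := Icirc s2 _) in *.
  assert (e : (x * / tpi = y * / tpi)%C) by now rewrite h1, h2.
  assert (t := tpi_neq0).
  replace x with (x * / tpi * tpi)%C by (field; assumption). rewrite e. field; assumption.
Qed.

Lemma Zint12_plus F c : contD D12 F -> Zint I12 F -> Zint I12 (fun w => F w + c * 1)%C.
Proof.
  intros HF HZ k.
  rewrite (li_ext _ _ I12_li _ (fun w => F w * zpowC w k + c * (1 * zpowC w k))%C) by (intros; ring).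
  rewrite (li_lin2 D12 I12 I12_li), (HZ k), (Zint12_1 k); [ring| |].
  - apply contD_zpow; [exact D12_0|assumption].
  - apply (contD_zpow D12 D12_0 (fun _ => RtoC 1)). intros w _; apply cont_const.
Qed.

(* Truncated entry [(a, b)] of the product of the Toeplitz matrices of [F] and [G]. It depends only on [F * G] in the
   limit: factors [1 - p w], [1 - p / w] can be moved from [F] to [G] one at a time, so shifting [a_i], [b_j] to [a_i q],
   [b_j q] repeatedly deforms [psi, Phi] into [1, 1]. *)
Definition Tbox (a b : Z) (F G : C -> C) (M : nat) : C :=
  cbox M (fun m => Imom (Icirc s1) F (a - m) * Imom (Icirc s0) G (m - b))%C.

Lemma Tbox_ext a b F F' G G' M : (forall w, D12 w -> F w = F' w) -> (forall w, Dcirc s0 w -> G w = G' w) ->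
  Tbox a b F G M = Tbox a b F' G' M.
Proof.
  intros HF HG. apply cbox_ext; intros m.
  rewrite (Imom_ext _ _ (Icirc_li s1) F F'), (Imom_ext _ _ (Icirc_li s0) G G'); auto.
  intros w hw; apply HF; now left.
Qed.

(** Boundary terms of a summation by parts. At m = -M the circle s1 gives the rate s0 / s1; at m = M
    the coefficients of F are moved to s2, with rate s2 / s0. *)
Lemma Tbox_ends a b F G : contD D12 F -> contD (Dcirc s0) G -> Zint I12 F ->
  Clim (fun M => Imom (Icirc s1) F (a + Z.of_nat M) * Imom (Icirc s0) G (- Z.of_nat M - 1 - b) -
     Imom (Icirc s1) F (a - (Z.of_nat M + 1)) * Imom (Icirc s0) G (Z.of_nat M - b))%C (RtoC 0).
Proof.
  intros HF HG HZ.
  destruct (Imom_circ_bound_ex s1 F ltac:(lra) (D12_1 F HF)) as [K1 [k1 B1]].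
  destruct (Imom_circ_bound_ex s2 F hs2 (D12_2 F HF)) as [K2 [k2 B2]].
  destruct (Imom_circ_bound_ex s0 G ltac:(lra) HG) as [K0 [k0 B0]].
  assert (x1 : 0 <= s0 / s1 < 1).
  { split; [apply Rlt_le, Rdiv_lt_0_compat; lra|apply (Rdiv_lt_1 s0 s1); lra]. }
  assert (x2 : 0 <= s2 / s0 < 1).
  { split; [apply Rlt_le, Rdiv_lt_0_compat; lra|apply (Rdiv_lt_1 s2 s0); lra]. }
  apply Clim_squeeze0 with (fun M => (K1 * powerRZ s1 (- a) * (K0 * powerRZ s0 (1 + b))) * (s0 / s1) ^ M +
     (K2 * powerRZ s2 (1 - a) * (K0 * powerRZ s0 b)) * (s2 / s0) ^ M).
  - intros M. eapply Rle_trans; [apply Cmod_triangle|]. rewrite Cmod_opp, !Cmod_mult.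
    apply Rplus_le_compat.
    + apply Rle_trans with ((K1 * powerRZ s1 (- (a + Z.of_nat M))) * (K0 * powerRZ s0 (- (- Z.of_nat M - 1 - b)))).
      * apply Rmult_le_compat; auto using Cmod_ge_0.
      * right. replace (- (- Z.of_nat M - 1 - b))%Z with (1 + b + Z.of_nat M)%Z by lia.
        replace (- (a + Z.of_nat M))%Z with (- a + - Z.of_nat M)%Z by lia.
        rewrite powerRZ_plus_nat, powerRZ_minus_nat by lra.
        unfold Rdiv. rewrite Rpow_mult_distr. ring.
    + rewrite (Imom12 F _ HZ).
      apply Rle_trans with ((K2 * powerRZ s2 (- (a - (Z.of_nat M + 1)))) * (K0 * powerRZ s0 (- (Z.of_nat M - b)))).
      * apply Rmult_le_compat; auto using Cmod_ge_0.
      * right. replace (- (a - (Z.of_nat M + 1)))%Z with (1 - a + Z.of_nat M)%Z by lia.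
        replace (- (Z.of_nat M - b))%Z with (b + - Z.of_nat M)%Z by lia.
        rewrite powerRZ_plus_nat, powerRZ_minus_nat by lra.
        unfold Rdiv. rewrite Rpow_mult_distr. ring.
  - replace (Finite 0) with (Finite (0 + 0)) by (f_equal; ring).
    apply is_lim_seq_plus'; now apply is_lim_geom0.
Qed.

Definition Teqv (F G F' G' : C -> C) : Prop := forall a b,
  Clim (fun M => Tbox a b F G M - Tbox a b F' G' M)%C (RtoC 0).

Lemma Teqv_trans F G F' G' F'' G'' : Teqv F G F' G' -> Teqv F' G' F'' G'' -> Teqv F G F'' G''.
Proof.
  intros H1 H2 a b. apply (Clim_ext (fun M => (Tbox a b F G M - Tbox a b F' G' M) + (Tbox a b F' G' M - Tbox a b F'' G'' M))%C).
  - intros; ring.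
  - replace (RtoC 0) with (0 + 0)%C by ring. now apply Clim_plus.
Qed.

Lemma Teqv_ext F G F' G' : (forall w, D12 w -> F w = F' w) -> (forall w, Dcirc s0 w -> G w = G' w) ->
  Teqv F G F' G'.
Proof.
  intros HF HG a b. apply (Clim_ext (fun _ => RtoC 0)); [|apply Clim_const].
  intros M. rewrite (Tbox_ext a b F F' G G') by assumption. ring.
Qed.

(** Moving the factor changes the summand by p (H(m) - H(m + 1)) with H(m) = F_(a-m) G_(m-1-b), so
    only boundary terms remain. *)
Lemma Teqv_lin F G p : contD D12 F -> contD (Dcirc s0) G -> Zint I12 F ->
  Teqv (fun w => F w * (1 - p * w))%C G F (fun w => G w * (1 - p * w))%C.
Proof.
  intros HF HG HZ a b.
  apply (Clim_ext (fun M => p * (Imom (Icirc s1) F (a + Z.of_nat M) * Imom (Icirc s0) G (- Z.of_nat M - 1 - b) -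
     Imom (Icirc s1) F (a - (Z.of_nat M + 1)) * Imom (Icirc s0) G (Z.of_nat M - b)))%C).
  - intros M. set (H := fun m => (Imom (Icirc s1) F (a - m) * Imom (Icirc s0) G (m - 1 - b))%C).
    replace (Imom (Icirc s1) F (a + Z.of_nat M) * Imom (Icirc s0) G (- Z.of_nat M - 1 - b) -
     Imom (Icirc s1) F (a - (Z.of_nat M + 1)) * Imom (Icirc s0) G (Z.of_nat M - b))%C
      with (H (- Z.of_nat M)%Z - H (Z.of_nat M + 1)%Z)%C.
    2: { unfold H. apply (f_equal2 Cminus); apply (f_equal2 Cmult); apply f_equal; lia. }
    rewrite <- cbox_telescope, <- cbox_scal. unfold Tbox.
    replace (cbox M (fun m => Imom (Icirc s1) (fun w => F w * (1 - p * w)) (a - m) * Imom (Icirc s0) G (m - b)) -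
       cbox M (fun m => Imom (Icirc s1) F (a - m) * Imom (Icirc s0) (fun w => G w * (1 - p * w)) (m - b)))%C with
      (cbox M (fun m => Imom (Icirc s1) (fun w => F w * (1 - p * w)) (a - m) * Imom (Icirc s0) G (m - b)) + - (1) *
       cbox M (fun m => Imom (Icirc s1) F (a - m) * Imom (Icirc s0) (fun w => G w * (1 - p * w)) (m - b)))%C by ring.
    rewrite <- cbox_scal, <- cbox_plus. apply cbox_ext; intros m.
    rewrite (Imom_lin _ _ (Icirc_li s1)), (Imom_lin _ _ (Icirc_li s0));
      [|intros w hw; apply (Dcirc_neq0 s0); auto; lra|assumption|intros w hw; apply (Dcirc_neq0 s1); auto; lra|now apply D12_1].
    unfold H. replace (a - (m + 1))%Z with (a - m - 1)%Z by lia.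
    replace (m + 1 - 1 - b)%Z with (m - b)%Z by lia. replace (m - 1 - b)%Z with (m - b - 1)%Z by lia. ring.
  - replace (RtoC 0) with (p * 0)%C by ring. apply Clim_scal. now apply Tbox_ends.
Qed.

Lemma Teqv_linv F G p : contD D12 F -> contD (Dcirc s0) G -> Zint I12 F ->
  Teqv (fun w => F w * (1 - p * / w))%C G F (fun w => G w * (1 - p * / w))%C.
Proof.
  intros HF HG HZ a b.
  (* The same boundary terms as for 1 - p w, taken at the indices a + 1 and b - 1. *)
  apply (Clim_ext (fun M => - p * (Imom (Icirc s1) F (a + 1 + Z.of_nat M) * Imom (Icirc s0) G (- Z.of_nat M - 1 - (b - 1)) -
     Imom (Icirc s1) F (a + 1 - (Z.of_nat M + 1)) * Imom (Icirc s0) G (Z.of_nat M - (b - 1))))%C).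
  - intros M. set (H := fun m => (Imom (Icirc s1) F (a - m + 1) * Imom (Icirc s0) G (m - b))%C).
    replace (Imom (Icirc s1) F (a + 1 + Z.of_nat M) * Imom (Icirc s0) G (- Z.of_nat M - 1 - (b - 1)) -
     Imom (Icirc s1) F (a + 1 - (Z.of_nat M + 1)) * Imom (Icirc s0) G (Z.of_nat M - (b - 1)))%C
      with (H (- Z.of_nat M)%Z - H (Z.of_nat M + 1)%Z)%C.
    2: { unfold H. apply (f_equal2 Cminus); apply (f_equal2 Cmult); apply f_equal; lia. }
    rewrite <- cbox_telescope, <- cbox_scal. unfold Tbox.
    replace (cbox M (fun m => Imom (Icirc s1) (fun w => F w * (1 - p * / w)) (a - m) * Imom (Icirc s0) G (m - b)) -
       cbox M (fun m => Imom (Icirc s1) F (a - m) * Imom (Icirc s0) (fun w => G w * (1 - p * / w)) (m - b)))%C with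
      (cbox M (fun m => Imom (Icirc s1) (fun w => F w * (1 - p * / w)) (a - m) * Imom (Icirc s0) G (m - b)) + - (1) *
       cbox M (fun m => Imom (Icirc s1) F (a - m) * Imom (Icirc s0) (fun w => G w * (1 - p * / w)) (m - b)))%C by ring.
    rewrite <- cbox_scal, <- cbox_plus. apply cbox_ext; intros m.
    rewrite (Imom_linv _ _ (Icirc_li s1)), (Imom_linv _ _ (Icirc_li s0));
      [|intros w hw; apply (Dcirc_neq0 s0); auto; lra|assumption|intros w hw; apply (Dcirc_neq0 s1); auto; lra|now apply D12_1].
    unfold H. replace (a - (m + 1) + 1)%Z with (a - m)%Z by lia.
    replace (m + 1 - b)%Z with (m - b + 1)%Z by lia. ring.
  - replace (RtoC 0) with (- p * 0)%C by ring. apply Clim_scal. now apply Tbox_ends.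
Qed.

Lemma contD_prod_lin (D : C -> Prop) n (p : nat -> C) : contD D (fun w => prodC n (fun i => 1 - p i * w)%C).
Proof.
  intros w hw. apply (cont_prodC n (fun w i => 1 - p i * w)%C). intros i _. exact (contD_lin D (p i) w hw).
Qed.

Lemma contD_prod_linv (D : C -> Prop) n (p : nat -> C) : (forall w, D w -> w <> RtoC 0) ->
  contD D (fun w => prodC n (fun i => 1 - p i * / w)%C).
Proof.
  intros D0 w hw. apply (cont_prodC n (fun w i => 1 - p i * / w)%C). intros i _. exact (contD_linv D (p i) D0 w hw).
Qed.

Lemma D0_0 w : Dcirc s0 w -> w <> RtoC 0.
Proof. apply Dcirc_neq0; lra. Qed.

(** [G] is quantified after [F] because it is enlarged by each factor moved across. *)
Lemma Teqv_prod_lin n (p : nat -> C) F : contD D12 F -> Zint I12 F -> forall G, contD (Dcirc s0) G ->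
  Teqv (fun w => F w * prodC n (fun i => 1 - p i * w))%C G F (fun w => G w * prodC n (fun i => 1 - p i * w))%C.
Proof.
  intros HF HZ.
  assert (Zn : forall n, Zint I12 (fun w => F w * prodC n (fun i => 1 - p i * w))%C).
  { induction n0 as [|k IH].
    - apply (Zint_ext _ _ I12_li F); [intros; simpl; ring|assumption].
    - apply (Zint_ext _ _ I12_li (fun w => (F w * prodC k (fun i => 1 - p i * w)) * (1 - p k * w))%C); [intros; simpl; ring|].
      apply (Zint_mul_lin _ _ I12_li D12_0); [|exact IH]. apply contD_mult; [assumption|apply contD_prod_lin]. }
  induction n as [|n IH]; intros G HG.
  - apply Teqv_ext; intros; simpl; ring.
  - apply (Teqv_trans _ _ (fun w => (F w * prodC n (fun i => 1 - p i * w)) * (1 - p n * w))%C G);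
      [apply Teqv_ext; intros; simpl; ring|].
    eapply Teqv_trans; [apply Teqv_lin; [apply contD_mult; [assumption|apply contD_prod_lin]|assumption|apply Zn]|].
    eapply Teqv_trans; [apply IH|apply Teqv_ext; intros; simpl; ring].
    apply contD_mult; [assumption|apply contD_lin].
Qed.

Lemma Teqv_prod_linv n (p : nat -> C) F : contD D12 F -> Zint I12 F -> forall G, contD (Dcirc s0) G ->
  Teqv (fun w => F w * prodC n (fun i => 1 - p i * / w))%C G F (fun w => G w * prodC n (fun i => 1 - p i * / w))%C.
Proof.
  intros HF HZ.
  assert (Zn : forall n, Zint I12 (fun w => F w * prodC n (fun i => 1 - p i * / w))%C).
  { induction n0 as [|k IH].
    - apply (Zint_ext _ _ I12_li F); [intros; simpl; ring|assumption].
    - apply (Zint_ext _ _ I12_li (fun w => (F w * prodC k (fun i => 1 - p i * / w)) * (1 - p k * / w))%C); [intros; simpl; ring|].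
      apply (Zint_mul_linv _ _ I12_li D12_0); [|exact IH].
      apply contD_mult; [assumption|apply contD_prod_linv, D12_0]. }
  induction n as [|n IH]; intros G HG.
  - apply Teqv_ext; intros; simpl; ring.
  - apply (Teqv_trans _ _ (fun w => (F w * prodC n (fun i => 1 - p i * / w)) * (1 - p n * / w))%C G);
      [apply Teqv_ext; intros; simpl; ring|].
    eapply Teqv_trans; [apply Teqv_linv; [apply contD_mult; [assumption|apply contD_prod_linv, D12_0]|assumption|apply Zn]|].
    eapply Teqv_trans; [apply IH|apply Teqv_ext; intros; simpl; ring].
    apply contD_mult; [assumption|apply contD_linv, D0_0].
Qed.

(** Uniform in M and proportional to both sup bounds. The terms m >= 0 are summed with the circle
    s2, those with m < 0 with s1. *)
Lemma Tbox_bound a b : exists K, 0 <= K /\ forall F G B1 B2 M, 0 <= B1 -> 0 <= B2 ->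
  contD D12 F -> contD (Dcirc s0) G -> Zint I12 F ->
  (forall w, D12 w -> Cmod (F w) <= B1) -> (forall w, Dcirc s0 w -> Cmod (G w) <= B2) ->
  Cmod (Tbox a b F G M) <= K * (B1 * B2).
Proof.
  destruct (Imom_circ_bound s1 ltac:(lra)) as [L1 [l1 H1]].
  destruct (Imom_circ_bound s2 hs2) as [L2 [l2 H2]].
  destruct (Imom_circ_bound s0 ltac:(lra)) as [L0 [l0 H0]].
  set (x := Rmax (s0 / s1) (s2 / s0)).
  assert (x1 : 0 < s0 / s1 < 1).
  { split; [apply Rdiv_lt_0_compat; lra|apply (Rdiv_lt_1 s0 s1); lra]. }
  assert (x2 : 0 < s2 / s0 < 1).
  { split; [apply Rdiv_lt_0_compat; lra|apply (Rdiv_lt_1 s2 s0); lra]. }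
  assert (e1 : s0 / s1 <= x) by apply Rmax_l. assert (e2 : s2 / s0 <= x) by apply Rmax_r.
  assert (hx : 0 <= x < 1) by (split; [lra|apply Rmax_lub_lt; lra]).
  set (K1 := L1 * powerRZ s1 (- a) * (L0 * powerRZ s0 b)). set (K2 := L2 * powerRZ s2 (- a) * (L0 * powerRZ s0 b)).
  assert (K10 : 0 < K1) by (repeat apply Rmult_lt_0_compat; try assumption; apply powerRZ_lt; lra).
  assert (K20 : 0 < K2) by (repeat apply Rmult_lt_0_compat; try assumption; apply powerRZ_lt; lra).
  exists ((K1 + K2) * (2 / (1 - x))); split.
  { apply Rmult_le_pos; [lra|]. apply Rlt_le, Rdiv_lt_0_compat; lra. }
  intros F G B1 B2 M b1 b2 HF HG HZ hF hG.
  assert (B12 : 0 <= B1 * B2) by now apply Rmult_le_pos.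
  eapply Rle_trans; [apply (Cmod_cbox_le _ _ (fun m => (B1 * B2 * (K1 + K2)) * x ^ Z.abs_nat m))|].
  - intros m. rewrite Cmod_mult.
    assert (g0 := H0 G B2 (m - b)%Z HG hG).
    destruct (Z_le_gt_dec 0 m) as [hm|hm].
    + destruct (Z_of_nat_complete m hm) as [n ->]. rewrite Zabs2Nat.id.
      rewrite (Imom12 F _ HZ). assert (f0 := H2 F B1 (a - Z.of_nat n)%Z (D12_2 F HF) (fun w hw => hF w (or_intror hw))).
      eapply Rle_trans; [apply Rmult_le_compat; [apply Cmod_ge_0|apply Cmod_ge_0|exact f0|exact g0]|].
      replace (- (a - Z.of_nat n))%Z with (- a + Z.of_nat n)%Z by lia.
      replace (- (Z.of_nat n - b))%Z with (b + - Z.of_nat n)%Z by lia.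
      rewrite powerRZ_plus_nat, powerRZ_minus_nat by lra.
      apply Rle_trans with (B1 * B2 * K2 * (s2 / s0) ^ n).
      * right. unfold K2, Rdiv. rewrite Rpow_mult_distr. ring.
      * apply Rmult_le_compat; [apply Rmult_le_pos; lra|apply pow_le; lra| |apply pow_incr; lra].
        apply Rmult_le_compat_l; lra.
    + assert (hm' : (0 <= - m)%Z) by lia. destruct (Z_of_nat_complete _ hm') as [n hn].
      replace m with (- Z.of_nat n)%Z in * by lia. replace (Z.abs_nat (- Z.of_nat n)) with n by lia.
      assert (f0 := H1 F B1 (a - - Z.of_nat n)%Z (D12_1 F HF) (fun w hw => hF w (or_introl hw))).
      eapply Rle_trans; [apply Rmult_le_compat; [apply Cmod_ge_0|apply Cmod_ge_0|exact f0|exact g0]|].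
      replace (- (a - - Z.of_nat n))%Z with (- a + - Z.of_nat n)%Z by lia.
      replace (- (- Z.of_nat n - b))%Z with (b + Z.of_nat n)%Z by lia.
      rewrite powerRZ_plus_nat, powerRZ_minus_nat by lra.
      apply Rle_trans with (B1 * B2 * K1 * (s0 / s1) ^ n).
      * right. unfold K1, Rdiv. rewrite Rpow_mult_distr. ring.
      * apply Rmult_le_compat; [apply Rmult_le_pos; lra|apply pow_le; lra| |apply pow_incr; lra].
        apply Rmult_le_compat_l; lra.
  - rewrite box_scal. replace ((K1 + K2) * (2 / (1 - x)) * (B1 * B2)) with (B1 * B2 * (K1 + K2) * (2 / (1 - x))) by ring.
    apply Rmult_le_compat_l; [apply Rmult_le_pos; lra|now apply box_geom].
Qed.

Lemma Tbox_11 (a b M : nat) : (a <= M)%nat -> Tbox (Z.of_nat a) (Z.of_nat b) (fun _ => RtoC 1) (fun _ => RtoC 1) M = dltC a b.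
Proof.
  intros ha. unfold Tbox.
  rewrite (cbox_ext _ _ (fun m => (if Z.eqb (Z.of_nat a - m) 0 then RtoC 1 else RtoC 0) *
     (if Z.eqb (m - Z.of_nat b) 0 then RtoC 1 else RtoC 0))%C).
  - rewrite cbox_at by assumption. unfold dltC.
    destruct (Z.eqb_spec (Z.of_nat a - Z.of_nat b) 0); destruct (Nat.eqb_spec a b); try reflexivity; lia.
  - intros m. rewrite !Imom_circ_1 by lra. reflexivity.
Qed.
End Pair.

(** * Deformation of the pair psi, Phi to the pair 1, 1 *)

Definition psiF (q : R) (N : nat) (a b : nat -> R) (w : C) : C :=
  Gq q N (fun i => RtoC (a i) * w)%C (fun j => RtoC (b j) * / w)%C.
Definition PhiF (q : R) (N : nat) (a b : nat -> R) (z : C) : C :=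
  Gq q N (fun j => RtoC (b j) * / z)%C (fun i => RtoC (a i) * z)%C.

Lemma Gq_ext q N x y x' y' : (forall i, (i < N)%nat -> x i = x' i) -> (forall i, (i < N)%nat -> y i = y' i) ->
  Gq q N x y = Gq q N x' y'.
Proof. intros hx hy; apply prodC_ext; intros i hi; now rewrite hx, hy. Qed.

Lemma small_neq1 q x j : 0 < q < 1 -> Cmod x < 1 -> (x * RtoC (q ^ j))%C <> RtoC 1.
Proof.
  intros hq hx E. apply (f_equal Cmod) in E.
  assert (0 < q ^ j) by (apply pow_lt; lra).
  assert (q ^ j <= 1) by (rewrite <- (pow1 j); apply pow_incr; lra).
  rewrite Cmod_mult, !Cmod_R, Rabs_R1, Rabs_pos_eq in E by lra.
  assert (h := Cmod_ge_0 x). nra.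
Qed.

Lemma scal_lt1 c s w : 0 < c < / s -> 0 < s -> Cmod w <= s -> Cmod (RtoC c * w) < 1.
Proof.
  intros hc hs hw. rewrite Cmod_mult, Cmod_R, Rabs_pos_eq by lra.
  apply Rle_lt_trans with (c * s); [apply Rmult_le_compat_l; lra|].
  apply (Rmult_lt_reg_r (/ s)); [apply Rinv_0_lt_compat; lra|].
  rewrite Rmult_assoc, Rinv_r by lra. lra.
Qed.

Lemma scal_inv_lt1 c s w : 0 < c < s -> s <= Cmod w -> Cmod (RtoC c * / w) < 1.
Proof.
  intros hc hw. assert (w0 : w <> RtoC 0) by (apply Cmod_gt_0; lra).
  rewrite Cmod_mult, Cmod_inv, Cmod_R, Rabs_pos_eq by (auto; lra).
  apply (Rdiv_lt_1 c (Cmod w)); lra.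
Qed.

Lemma qpoch_small_neq0 q x : 0 < q < 1 -> Cmod x < 1 -> qpoch x q <> RtoC 0.
Proof. intros hq hx; apply qpoch_neq0; [assumption|]. intros j; now apply small_neq1. Qed.

Section Inv.
Context (q : R) (hq : 0 < q < 1) (N : nat) (s0 s1 s2 : R) (hs2 : 0 < s2) (hs20 : s2 < s0) (hs01 : s0 < s1).

(** The conditions that survive replacing a_i, b_i by a_i q, b_i q: the poles 1/(a_i q^j) of psi
    remain outside s1, those of Phi inside s0, and the former remain distinct. *)
Definition okab (a b : nat -> R) : Prop :=
  (forall i, (i < N)%nat -> 0 < a i < / s1 /\ 0 < b i < s0) /\
  (forall i i' j j', (i < N)%nat -> (i' < N)%nat -> a i * q ^ j = a i' * q ^ j' -> i = i' /\ j = j').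

Lemma okab_scal a b : okab a b -> okab (fun i => a i * q) (fun i => b i * q).
Proof.
  intros [H1 H2]; split.
  - intros i hi. destruct (H1 i hi). split; nra.
  - intros i i' j j' hi hi' E. apply H2; auto.
    apply (Rmult_eq_reg_r q); [|lra]. lra.
Qed.

Lemma D12_le w : D12 s1 s2 w -> Cmod w <= s1.
Proof. intros [h|h]; [rewrite (Dcirc_Cmod s1 w)|rewrite (Dcirc_Cmod s2 w)]; auto; lra. Qed.

Lemma psiF_contD a b : okab a b -> contD (D12 s1 s2) (psiF q N a b).
Proof.
  intros [H _].
  apply (contD_Gq q hq N _ (fun i w => RtoC (a i) * w)%C (fun j w => RtoC (b j) * / w)%C).
  - intros; apply contD_scal_id.
  - intros; apply contD_scal_inv. apply (D12_0 s0 s1 s2 hs2 hs20 hs01).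
  - intros i w j hi hw. apply small_neq1; [assumption|]. apply (scal_lt1 _ s1); [now apply H|lra|now apply D12_le].
Qed.

(** All poles of psi lie outside both circles, so each circle alone gives 0 there; for the powers of
    w the two circles cancel. *)
Lemma psiF_Zint a b : okab a b -> Zint (I12 s1 s2) (psiF q N a b).
Proof.
  intros [H inj].
  assert (D0 := D12_0 s0 s1 s2 hs2 hs20 hs01).
  apply (Zint_psi q hq N (D12 s1 s2) (I12 s1 s2) (I12_li s1 s2) D0 a b inj).
  - intros i hi; now apply H.
  - intros i w j hi hw. apply small_neq1; [assumption|]. apply (scal_lt1 _ s1); [now apply H|lra|now apply D12_le].
  - apply (Zint12_1 s0); assumption.
  - intros i j hi. destruct (H i hi) as [ha _].
    assert (qj : 0 < q ^ j) by (apply pow_lt; lra).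
    assert (qj1 : q ^ j <= 1) by (rewrite <- (pow1 j); apply pow_incr; lra).
    set (c := a i * q ^ j). assert (c0 : 0 < c) by (apply Rmult_lt_0_compat; lra).
    assert (c1 : s1 < / c).
    { apply (Rmult_lt_reg_r c); [assumption|]. rewrite Rinv_l by lra.
      apply Rle_lt_trans with (s1 * a i); [apply Rmult_le_compat_l; [lra|unfold c; nra]|].
      destruct ha as [_ ha]. apply (Rmult_lt_compat_l s1) in ha; [|lra]. rewrite Rinv_r in ha; lra. }
    assert (cm : Cmod (RtoC (/ c)) = / c) by (rewrite Cmod_R; apply Rabs_pos_eq, Rlt_le, Rinv_0_lt_compat, c0).
    assert (one : forall s, 0 < s -> s <= s1 -> Icirc s (fun w => / (1 - RtoC c * w))%C = RtoC 0).
    { intros s hs hs'.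
      assert (nw : forall w, Dcirc s w -> (w - RtoC (/ c))%C <> RtoC 0).
      { intros w hw E. assert (e : w = RtoC (/ c)) by (replace w with ((w - RtoC (/ c)) + RtoC (/ c))%C by ring; rewrite E; ring).
        assert (h := Dcirc_Cmod s w hs hw). rewrite e, cm in h. lra. }
      rewrite (li_ext _ _ (Icirc_li s) _ (fun w => - RtoC (/ c) * / (w - RtoC (/ c)))%C).
      - rewrite (li_scal _ _ (Icirc_li s)).
        + assert (h := circ_winding_out s hs (RtoC (/ c)) ltac:(lra) ltac:(lra)).
          unfold Icirc. rewrite h. ring.
        + apply (circ_cont s hs (RtoC (/ c)) ltac:(lra)).
      - intros w hw. specialize (nw w hw).
        assert (cc : RtoC c <> RtoC 0) by (intros E; injection E; lra).
        rewrite RtoC_inv in nw |- * by lra.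
        assert (nn : (1 - RtoC c * w)%C <> RtoC 0).
        { intros E. apply nw. replace (w - / RtoC c)%C with (- / RtoC c * (1 - RtoC c * w))%C by (field; assumption).
          rewrite E; ring. }
        assert (nn2 : (w * RtoC c - 1)%C <> RtoC 0).
        { intros E. apply nn. replace (1 - RtoC c * w)%C with (- (w * RtoC c - 1))%C by ring. rewrite E; ring. }
        assert (nn3 : (RtoC c * w - 1)%C <> RtoC 0) by (rewrite Cmult_comm; assumption).
        field. auto. }
    unfold I12. rewrite !one by lra. ring.
Qed.

Lemma PhiF_contD a b : okab a b -> contD (Dcirc s0) (PhiF q N a b).
Proof.
  intros [H _].
  assert (D0 : forall w, Dcirc s0 w -> w <> RtoC 0) by (intros; apply (Dcirc_neq0 s0); auto; lra).
  apply (contD_Gq q hq N _ (fun j w => RtoC (b j) * / w)%C (fun i w => RtoC (a i) * w)%C).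
  - intros; now apply contD_scal_inv.
  - intros; apply contD_scal_id.
  - intros i w j hi hw. apply small_neq1; [assumption|]. apply (scal_inv_lt1 _ s0); [now apply H|].
    rewrite (Dcirc_Cmod s0 w) by (auto; lra). lra.
Qed.

(** The pair passes through G1 = (a q z)_oo / (b / z)_oo. The factors 1 - a_i z leave Phi and cancel
    against psi; what is left of psi is the shifted psi times the factors 1 - b_i / w, and moving
    these across turns G1 into the shifted Phi. *)
Lemma Teqv_step a b : okab a b ->
  Teqv s0 s1 (psiF q N a b) (PhiF q N a b)
    (psiF q N (fun i => a i * q) (fun i => b i * q)) (PhiF q N (fun i => a i * q) (fun i => b i * q)).
Proof.
  intros ok. assert (ok' := okab_scal a b ok). destruct ok as [H inj]. 
  set (aq := fun i => a i * q) in *. set (bq := fun i => b i * q) in *.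
  set (G1 := fun z : C => Gq q N (fun j => RtoC (b j) * / z)%C (fun i => RtoC (aq i) * z)%C).
  assert (D0 : forall w, Dcirc s0 w -> w <> RtoC 0) by (intros; apply (Dcirc_neq0 s0); auto; lra).
  assert (c1 : contD (Dcirc s0) G1).
  { apply (contD_Gq q hq N _ (fun j w => RtoC (b j) * / w)%C (fun i w => RtoC (aq i) * w)%C).
    - intros; now apply contD_scal_inv.
    - intros; apply contD_scal_id.
    - intros i w j hi hw. apply small_neq1; [assumption|]. apply (scal_inv_lt1 _ s0); [now apply H|].
      rewrite (Dcirc_Cmod s0 w) by (auto; lra). lra. }
  assert (t1 := Teqv_prod_lin s0 s1 s2 hs2 hs20 hs01 N (fun i => RtoC (a i)) (psiF q N a b)
     (psiF_contD a b (conj H inj)) (psiF_Zint a b (conj H inj)) G1 c1).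
  assert (t2 := Teqv_prod_linv s0 s1 s2 hs2 hs20 hs01 N (fun i => RtoC (b i)) (psiF q N aq bq)
     (psiF_contD aq bq ok') (psiF_Zint aq bq ok') G1 c1).
  assert (sym : forall F G F' G', Teqv s0 s1 F G F' G' -> Teqv s0 s1 F' G' F G).
  { intros F G F' G' h x y. apply (Clim_ext (fun M => - (1) * (Tbox s0 s1 x y F G M - Tbox s0 s1 x y F' G' M))%C); [intros; ring|].
    replace (RtoC 0) with (- (1) * 0)%C by ring. now apply Clim_scal. }
  eapply Teqv_trans; [|eapply Teqv_trans; [apply sym, t1|eapply Teqv_trans; [|eapply Teqv_trans; [apply t2|]]]].
  - apply (Teqv_ext s0 s1 s2); [reflexivity|]. intros z hz. unfold PhiF, G1, Gq. rewrite <- prodC_mult. apply prodC_ext; intros i hi.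
    rewrite (qpoch_1step q hq (RtoC (a i) * z)). unfold aq. rewrite RtoC_mult.
    replace (RtoC (a i) * RtoC q * z)%C with (RtoC (a i) * z * RtoC q)%C by ring. ring.
  - apply (Teqv_ext s0 s1 s2); [|reflexivity]. intros w hw. unfold psiF, Gq. rewrite <- !prodC_mult. apply prodC_ext; intros i hi.
    assert (n0 : qpoch (RtoC (a i) * w) q <> RtoC 0).
    { apply qpoch_small_neq0; [assumption|]. apply (scal_lt1 _ s1); [now apply H|lra|now apply D12_le]. }
    assert (e := qpoch_1step q hq (RtoC (a i) * w)). rewrite e in n0 |- *.
    rewrite (qpoch_1step q hq (RtoC (b i) * / w)). unfold aq, bq. rewrite !RtoC_mult.
    replace (RtoC (a i) * RtoC q * w)%C with (RtoC (a i) * w * RtoC q)%C by ring.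
    replace (RtoC (b i) * RtoC q * / w)%C with (RtoC (b i) * / w * RtoC q)%C by ring.
    set (u := (1 - RtoC (a i) * w)%C) in *. set (v := qpoch (RtoC (a i) * w * RtoC q) q) in *.
    assert (u0 : u <> RtoC 0) by (intros E; apply n0; rewrite E; ring).
    assert (v0 : v <> RtoC 0) by (intros E; apply n0; rewrite E; ring).
    rewrite Cinv_mult by assumption.
    replace (/ u * / v * ((1 - RtoC (b i) * / w) * qpoch (RtoC (b i) * / w * RtoC q) q) * u)%C with
      ((u * / u) * (/ v * ((1 - RtoC (b i) * / w) * qpoch (RtoC (b i) * / w * RtoC q) q)))%C by ring.
    rewrite Cinv_r by assumption. ring.
  - apply (Teqv_ext s0 s1 s2); [reflexivity|]. intros z hz. unfold PhiF, G1, Gq. rewrite <- prodC_mult. apply prodC_ext; intros i hi.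
    assert (n0 : qpoch (RtoC (b i) * / z) q <> RtoC 0).
    { apply qpoch_small_neq0; [assumption|]. apply (scal_inv_lt1 _ s0); [now apply H|].
      rewrite (Dcirc_Cmod s0 z) by (auto; lra). lra. }
    assert (e := qpoch_1step q hq (RtoC (b i) * / z)). rewrite e in n0 |- *. unfold bq. rewrite RtoC_mult.
    replace (RtoC (b i) * RtoC q * / z)%C with (RtoC (b i) * / z * RtoC q)%C by ring.
    set (u := (1 - RtoC (b i) * / z)%C) in *. set (v := qpoch (RtoC (b i) * / z * RtoC q) q) in *.
    assert (u0 : u <> RtoC 0) by (intros E; apply n0; rewrite E; ring).
    assert (v0 : v <> RtoC 0) by (intros E; apply n0; rewrite E; ring).
    rewrite Cinv_mult by assumption.
    replace (/ u * / v * qpoch (RtoC (aq i) * z) q * u)%C with ((u * / u) * (/ v * qpoch (RtoC (aq i) * z) q))%C by ring.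
    rewrite Cinv_r by assumption. ring.
Qed.

Lemma okab_pow J : forall a b, okab a b -> okab (fun i => a i * q ^ J) (fun i => b i * q ^ J).
Proof.
  intros a b [H1 H2]; split.
  - intros i hi. destruct (H1 i hi).
    assert (0 < q ^ J) by (apply pow_lt; lra).
    assert (q ^ J <= 1) by (rewrite <- (pow1 J); apply pow_incr; lra). split; nra.
  - intros i i' j j' hi hi' E. apply H2; auto.
    apply (Rmult_eq_reg_r (q ^ J)); [lra|]. apply pow_nonzero; lra.
Qed.

Lemma Teqv_iter J : forall a b, okab a b ->
  Teqv s0 s1 (psiF q N a b) (PhiF q N a b)
    (psiF q N (fun i => a i * q ^ J) (fun i => b i * q ^ J)) (PhiF q N (fun i => a i * q ^ J) (fun i => b i * q ^ J)).
Proof.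
  induction J as [|J IH]; intros a b ok.
  - apply (Teqv_ext s0 s1 s2); intros w _; apply Gq_ext; intros; simpl; now rewrite Rmult_1_r.
  - eapply Teqv_trans; [now apply Teqv_step|]. eapply Teqv_trans; [apply IH, okab_scal, ok|].
    apply (Teqv_ext s0 s1 s2); intros w _; apply Gq_ext; intros; simpl; now rewrite Rmult_assoc.
Qed.

(** J is fixed first, so that the deformed pair is within order q^J of 1, 1 with an error uniform in
    M; only then does M go to infinity. The product is split as F G = (F - 1) G + (G - 1) + 1. *)
Lemma psi_Phi_inverse a b (k l : nat) : okab a b ->
  Clim (Tbox s0 s1 (Z.of_nat k) (Z.of_nat l) (psiF q N a b) (PhiF q N a b)) (dltC k l).
Proof.
  intros ok.
  assert (D120 := D12_0 s0 s1 s2 hs2 hs20 hs01).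
  assert (D00 : forall w, Dcirc s0 w -> w <> RtoC 0) by (intros; apply (Dcirc_neq0 s0); auto; lra).
  destruct (Gq_tail q hq N (D12 s1 s2) (I12 s1 s2) (I12_li s1 s2) (fun i w => RtoC (a i) * w)%C (fun j w => RtoC (b j) * / w)%C)
    as [K1 [J1 [k1 HK1]]].
  { intros; apply contD_scal_id. }
  { intros; now apply contD_scal_inv. }
  destruct (Gq_tail q hq N (Dcirc s0) (Icirc s0) (Icirc_li s0) (fun j w => RtoC (b j) * / w)%C (fun i w => RtoC (a i) * w)%C)
    as [K2 [J2 [k2 HK2]]].
  { intros; now apply contD_scal_inv. }
  { intros; apply contD_scal_id. }
  destruct (Tbox_bound s0 s1 s2 hs2 hs20 hs01 (Z.of_nat k) (Z.of_nat l)) as [KT [kT HT]].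
  intros eps he.
  (* The two summands bound the contributions of (F - 1, G), where |G| <= 1 + K2, and of (1, G -
     1). *)
  set (A := KT * (K1 * (1 + K2)) + KT * (1 * K2)).
  assert (A0 : 0 <= A).
  { unfold A. apply Rplus_le_le_0_compat; repeat apply Rmult_le_pos; lra. }
  destruct (qpow_small q hq (eps / 2 / (A + 1))) as [J3 HJ3]; [repeat apply Rdiv_lt_0_compat; lra|].
  set (J := max J1 (max J2 J3)).
  assert (HJ := HJ3 J ltac:(lia)).
  assert (qJ : 0 < q ^ J) by (apply pow_lt; lra).
  assert (qJ1 : q ^ J <= 1) by (rewrite <- (pow1 J); apply pow_incr; lra).
  set (aJ := fun i => a i * q ^ J). set (bJ := fun i => b i * q ^ J).
  assert (okJ : okab aJ bJ) by now apply okab_pow.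
  set (F := psiF q N aJ bJ). set (G := PhiF q N aJ bJ).
  assert (hF : forall w, D12 s1 s2 w -> Cmod (F w + - (1) * 1) <= K1 * q ^ J).
  { intros w hw. replace (F w + - (1) * 1)%C with (F w - 1)%C by ring.
    rewrite <- (Rmult_1_r (K1 * q ^ J)). rewrite Rmult_1_r. eapply Rle_trans; [|apply (HK1 J w ltac:(lia) hw)].
    apply Req_le, (f_equal (fun u => Cmod (u - 1)%C)). unfold F, psiF. apply Gq_ext; intros i _; cbv beta; unfold aJ, bJ; rewrite RtoC_mult; ring. }
  assert (hG : forall w, Dcirc s0 w -> Cmod (G w + - (1) * 1) <= K2 * q ^ J).
  { intros w hw. replace (G w + - (1) * 1)%C with (G w - 1)%C by ring.
    eapply Rle_trans; [|apply (HK2 J w ltac:(lia) hw)].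
    apply Req_le, (f_equal (fun u => Cmod (u - 1)%C)). unfold G, PhiF. apply Gq_ext; intros i _; cbv beta; unfold aJ, bJ; rewrite RtoC_mult; ring. }
  assert (cF : contD (D12 s1 s2) F) by now apply psiF_contD.
  assert (cG : contD (Dcirc s0) G) by now apply PhiF_contD.
  assert (zF : Zint (I12 s1 s2) F) by now apply psiF_Zint.
  assert (cF1 : contD (D12 s1 s2) (fun w => F w + - (1) * 1)%C).
  { intros w hw; apply cont_plus; [now apply cF|apply cont_const]. }
  assert (cG1 : contD (Dcirc s0) (fun w => G w + - (1) * 1)%C).
  { intros w hw; apply cont_plus; [now apply cG|apply cont_const]. }
  assert (hG2 : forall w, Dcirc s0 w -> Cmod (G w) <= 1 + K2).
  { intros w hw. replace (G w) with (1 + (G w + - (1) * 1))%C by ring.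
    eapply Rle_trans; [apply Cmod_triangle|]. rewrite Cmod_1. specialize (hG w hw).
    assert (K2 * q ^ J <= K2 * 1) by (apply Rmult_le_compat_l; lra). lra. }
  destruct (Teqv_iter J a b ok (Z.of_nat k) (Z.of_nat l) (eps / 2) ltac:(lra)) as [M0 HM0].
  exists (max M0 k); intros M hM. specialize (HM0 M ltac:(lia)). fold aJ bJ F G in HM0.
  replace (Tbox s0 s1 (Z.of_nat k) (Z.of_nat l) (psiF q N a b) (PhiF q N a b) M -
     Tbox s0 s1 (Z.of_nat k) (Z.of_nat l) F G M - 0)%C with
    (Tbox s0 s1 (Z.of_nat k) (Z.of_nat l) (psiF q N a b) (PhiF q N a b) M -
     Tbox s0 s1 (Z.of_nat k) (Z.of_nat l) F G M)%C in HM0 by ring.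
  assert (split : Tbox s0 s1 (Z.of_nat k) (Z.of_nat l) F G M =
     (Tbox s0 s1 (Z.of_nat k) (Z.of_nat l) (fun w => F w + - (1) * 1)%C G M
     + (Tbox s0 s1 (Z.of_nat k) (Z.of_nat l) (fun _ => RtoC 1) (fun w => G w + - (1) * 1)%C M
     + Tbox s0 s1 (Z.of_nat k) (Z.of_nat l) (fun _ => RtoC 1) (fun _ => RtoC 1) M))%C).
  { unfold Tbox. rewrite <- !cbox_plus. apply cbox_ext; intros m.
    rewrite (Imom_ext _ _ (Icirc_li s1) F (fun w => (F w + - (1) * 1) + 1)%C) by (intros; ring).
    rewrite (Imom_plus _ _ (Icirc_li s1) (fun w => Dcirc_neq0 s1 w ltac:(lra))); [|exact (D12_1 s1 s2 _ cF1)|intros w _; apply cont_const].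
    rewrite (Imom_ext _ _ (Icirc_li s0) G (fun w => (G w + - (1) * 1) + 1)%C) by (intros; ring).
    rewrite (Imom_plus _ _ (Icirc_li s0) D00); [|exact cG1|intros w _; apply cont_const].
    ring. }
  rewrite (Tbox_11 s0 s1 s2) in split by (auto; lia).
  assert (b1 := HT (fun w => F w + - (1) * 1)%C G (K1 * q ^ J) (1 + K2) M ltac:(apply Rmult_le_pos; lra) ltac:(lra) cF1 cG
    (Zint12_plus s0 s1 s2 hs2 hs20 hs01 F (- (1))%C cF zF) hF hG2).
  assert (b2 := HT (fun _ => RtoC 1) (fun w => G w + - (1) * 1)%C 1 (K2 * q ^ J) M ltac:(lra) ltac:(apply Rmult_le_pos; lra)
    (fun w _ => cont_const _ w) cG1 (Zint12_1 s0 s1 s2 hs2 hs20 hs01) (fun w _ => Req_le _ _ Cmod_1) hG).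
  set (T := Tbox s0 s1 (Z.of_nat k) (Z.of_nat l)) in *.
  replace (T (psiF q N a b) (PhiF q N a b) M - dltC k l)%C with
    ((T (psiF q N a b) (PhiF q N a b) M - T F G M) + (T F G M - dltC k l))%C by ring.
  eapply Rle_lt_trans; [apply Cmod_triangle|].
  assert (b3 : Cmod (T F G M - dltC k l) <= A * q ^ J).
  { rewrite split. 
    match goal with |- Cmod (?x + (?y + ?z) - ?z) <= _ => replace (x + (y + z) - z)%C with (x + y)%C by ring end.
    eapply Rle_trans; [apply Cmod_triangle|]. unfold A. lra. }
  assert (A * q ^ J <= A * (eps / 2 / (A + 1))) by (apply Rmult_le_compat_l; lra).
  assert (A * (eps / 2 / (A + 1)) < eps / 2).
  { apply (Rmult_lt_reg_r (A + 1)); [lra|]. field_simplify; [|lra]. nra. }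
  lra.
Qed.
End Inv.

(** * The q-difference equation *)

(* [c] are the coefficients of [f] in powers of [/ w] on [|w| = R], with a geometric remainder estimate. *)
Definition xpand (om R : R) (f : C -> C) (c : nat -> C) : Prop := exists K, 0 <= K /\
  (forall s, Cmod (c s) <= K * om ^ s) /\
  forall w, Cmod w = R -> forall S, Cmod (f w - csum S (fun s => c s * (/ w) ^ s)%C) <= K * (om / R) ^ S.

(** Coefficients after multiplication by 1/(1 - p / w): convolution with the geometric sequence p^s,
    in Horner form. *)
Fixpoint poleseq (p : C) (c : nat -> C) (s : nat) : C :=
  match s with O => c O | S s' => (p * poleseq p c s' + c (S s'))%C end.

(** Coefficients after multiplication by al / w. *)
Definition shiftseq (al : C) (c : nat -> C) (s : nat) : C :=
  match s with O => RtoC 0 | S s' => (al * c s')%C end.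

Section Xpand.
Context (om R : R) (hom : 0 < om) (homR : om < R).

Lemma xp_om : 0 < om / R < 1.
Proof. split; [apply Rdiv_lt_0_compat; lra|apply (Rdiv_lt_1 om R); lra]. Qed.

Lemma Cmod_inv_R w : Cmod w = R -> Cmod (/ w) = / R.
Proof. intros h; rewrite Cmod_inv, h; [reflexivity|apply Cmod_gt_0; lra]. Qed.

Lemma xpand_1 : xpand om R (fun _ => RtoC 1) (fun s => match s with O => RtoC 1 | S _ => RtoC 0 end).
Proof.
  assert (h := xp_om).
  exists 1; split; [lra|split].
  - intros [|s]; [rewrite Cmod_1; simpl; lra|].
    rewrite Cmod_0. rewrite Rmult_1_l. apply pow_le; lra.
  - intros w hw [|S].
    + simpl. replace (1 - 0)%C with (RtoC 1) by ring. rewrite Cmod_1. lra.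
    + rewrite csum_head. rewrite (csum_ext _ _ (fun _ => RtoC 0)) by (intros; ring). rewrite csum_0.
      replace (1 - (1 * (/ w) ^ 0 + 0))%C with (RtoC 0) by (simpl; ring). rewrite Cmod_0, Rmult_1_l. apply pow_le; lra.
Qed.

Lemma csum_pole p c x S : ((1 - p * x) * csum (Datatypes.S S) (fun s => poleseq p c s * x ^ s))%C =
  (csum (Datatypes.S S) (fun s => c s * x ^ s) - p * poleseq p c S * x ^ Datatypes.S S)%C.
Proof.
  induction S as [|S IH].
  - simpl. ring.
  - cbn [csum] in *. rewrite Cmult_plus_distr_l, IH. cbn [poleseq]. rewrite !Cpow_S. ring.
Qed.

Lemma xpand_pole f c p : Cmod p < om -> xpand om R f c ->
  xpand om R (fun w => f w * / (1 - p * / w))%C (poleseq p c).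
Proof.
  intros hp [K [K0 [Hc Hf]]]. assert (p0 := Cmod_ge_0 p). assert (ho := xp_om).
  (* The solution of |p| K' + K om = K' om, which makes a bound K' om^s stable under the recursion
     of [poleseq]. *)
  set (K' := K * om * / (om - Cmod p)).
  assert (i0 : 0 < / (om - Cmod p)) by (apply Rinv_0_lt_compat; lra).
  assert (K'0 : 0 <= K') by (unfold K'; apply Rmult_le_pos; [apply Rmult_le_pos; lra|lra]).
  assert (eK : Cmod p * K' + K * om = K' * om) by (unfold K'; field; lra).
  assert (KK : K <= K').
  { apply (Rmult_le_reg_r om); [assumption|]. rewrite <- eK. assert (0 <= Cmod p * K') by now apply Rmult_le_pos. lra. }
  assert (Hb : forall s, Cmod (poleseq p c s) <= K' * om ^ s).
  { induction s as [|s IH]; cbn [poleseq].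
    - eapply Rle_trans; [apply Hc|]. simpl. lra.
    - eapply Rle_trans; [apply Cmod_triangle|]. rewrite Cmod_mult.
      replace (K' * om ^ S s) with (Cmod p * (K' * om ^ s) + K * om ^ S s).
      + apply Rplus_le_compat; [now apply Rmult_le_compat_l|apply Hc].
      + simpl. rewrite <- !Rmult_assoc, <- eK. ring. }
  set (pr := 1 - Cmod p / R).
  assert (hpr : 0 < pr <= 1).
  { unfold pr. assert (Cmod p / R < 1) by (apply (Rdiv_lt_1 (Cmod p) R); lra).
    assert (0 <= Cmod p / R) by (apply Rle_mult_inv_pos; lra). lra. }
  assert (ipr : 1 <= / pr) by (rewrite <- Rinv_1; apply Rinv_le_contravar; lra).
  exists ((K + K') * / pr); split; [apply Rmult_le_pos; lra|split].
  - intros s. eapply Rle_trans; [apply Hb|]. apply Rmult_le_compat_r; [apply pow_le; lra|].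
    apply Rle_trans with ((K + K') * 1); [lra|apply Rmult_le_compat_l; lra].
  - intros w hw S. assert (iw := Cmod_inv_R w hw).
    assert (g : pr <= Cmod (1 - p * / w)).
    { assert (h := Cmod_sub_ge 1 (p * / w)). rewrite Cmod_1, Cmod_mult, iw in h. exact h. }
    assert (nz : (1 - p * / w)%C <> RtoC 0) by (apply Cmod_gt_0; lra).
    assert (ig : Cmod (/ (1 - p * / w)) <= / pr) by (rewrite Cmod_inv by assumption; apply Rinv_le_contravar; lra).
    replace ((K + K') * / pr * (om / R) ^ S) with (((K + K') * (om / R) ^ S) * / pr) by ring.
    destruct S as [|S].
    + specialize (Hf w hw O). cbn [csum] in *. rewrite pow_O, !Rmult_1_r in *.
      replace (f w * / (1 - p * / w) - 0)%C with ((f w - 0) * / (1 - p * / w))%C by ring.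
      rewrite Cmod_mult. apply Rmult_le_compat; auto using Cmod_ge_0. lra.
    + replace (f w * / (1 - p * / w) - csum (Datatypes.S S) (fun s => poleseq p c s * (/ w) ^ s))%C with
        ((f w - (1 - p * / w) * csum (Datatypes.S S) (fun s => poleseq p c s * (/ w) ^ s)) * / (1 - p * / w))%C
        by (set (u := (1 - p * / w)%C) in *; set (v := csum _ _); field; exact nz).
      rewrite Cmod_mult. apply Rmult_le_compat; auto using Cmod_ge_0.
      rewrite csum_pole.
      replace (f w - (csum (Datatypes.S S) (fun s => c s * (/ w) ^ s) - p * poleseq p c S * (/ w) ^ Datatypes.S S))%C with
        ((f w - csum (Datatypes.S S) (fun s => c s * (/ w) ^ s)) + p * poleseq p c S * (/ w) ^ Datatypes.S S)%C by ring.
      eapply Rle_trans; [apply Cmod_triangle|]. rewrite Rmult_plus_distr_r.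
      apply Rplus_le_compat; [now apply Hf|].
      rewrite !Cmod_mult, Cmod_pow, iw. unfold Rdiv. rewrite Rpow_mult_distr.
      rewrite <- Rmult_assoc. apply Rmult_le_compat_r; [apply pow_le, Rlt_le, Rinv_0_lt_compat; lra|].
      apply Rle_trans with (om * (K' * om ^ S)); [|right; simpl; ring].
      apply Rmult_le_compat; auto using Cmod_ge_0; lra.
Qed.

Lemma xpand_shift f c al : xpand om R f c -> xpand om R (fun w => f w * (al * / w))%C (shiftseq al c).
Proof.
  intros [K [K0 [Hc Hf]]]. assert (a0 := Cmod_ge_0 al). assert (ho := xp_om).
  assert (io : 0 < / om) by (now apply Rinv_0_lt_compat).
  exists (K * Cmod al * / om); split; [repeat apply Rmult_le_pos; lra|split].
  - intros [|s]; cbn [shiftseq].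
    + rewrite Cmod_0. simpl. rewrite Rmult_1_r. repeat apply Rmult_le_pos; lra.
    + rewrite Cmod_mult. apply Rle_trans with (Cmod al * (K * om ^ s)); [now apply Rmult_le_compat_l|].
      right; simpl; field; lra.
  - intros w hw S. assert (iw := Cmod_inv_R w hw).
    assert (hR : / R <= / om) by (apply Rinv_le_contravar; lra).
    assert (Ri : 0 < / R) by (apply Rinv_0_lt_compat; lra).
    destruct S as [|S].
    + specialize (Hf w hw O). cbn [csum] in *. rewrite pow_O, Rmult_1_r in *.
      replace (f w * (al * / w) - 0)%C with ((f w - 0) * (al * / w))%C by ring.
      rewrite !Cmod_mult, iw, Rmult_assoc. apply Rmult_le_compat; auto using Cmod_ge_0; [apply Rmult_le_pos; lra|].
      apply Rmult_le_compat_l; lra.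
    + rewrite csum_head. cbn [shiftseq].
      rewrite (csum_ext S _ (fun s => (al * / w) * (c s * (/ w) ^ s))%C) by (intros; rewrite Cpow_S; ring).
      rewrite csum_scal.
      match goal with |- Cmod ?t <= _ => replace t with ((al * / w) * (f w - csum S (fun s => c s * (/ w) ^ s)))%C by ring end.
      rewrite !Cmod_mult, iw.
      replace (K * Cmod al * / om * (om / R) ^ Datatypes.S S) with ((Cmod al * / R) * (K * (om / R) ^ S)) by (simpl; field; lra).
      apply Rmult_le_compat_l; [apply Rmult_le_pos; lra|now apply Hf].
Qed.

Lemma xpand_ext f g c : (forall w, Cmod w = R -> f w = g w) -> xpand om R f c -> xpand om R g c.
Proof.
  intros E [K [K0 [Hc Hf]]]. exists K; split; [assumption|split; [assumption|]].
  intros w hw S. rewrite <- E by assumption. now apply Hf.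
Qed.

(** Outside the pole, 1/(1 - a w) = -(1/(a w)) / (1 - 1/(a w)): a shift followed by a pole at 1/a.
    The shift makes the constant coefficient vanish as soon as one factor is present. *)
Lemma xpand_rho q N (a b : nat -> Rdefinitions.R) : 0 < q ->
  (forall i, (i < N)%nat -> 0 < a i /\ / a i < om /\ 0 < b i / q < om) ->
  exists c, xpand om R (fun w => prodC N (fun i => / (1 - RtoC (a i) * w) * / (1 - RtoC (b i / q) * / w)))%C c /\
    ((0 < N)%nat -> c O = RtoC 0).
Proof.
  intros hq H. induction N as [|N IH].
  - exists (fun s => match s with O => RtoC 1 | S _ => RtoC 0 end); split; [exact xpand_1|lia].
  - destruct IH as [c [Hc _]]; [intros; apply H; lia|].
    destruct (H N ltac:(lia)) as [ha [ha2 hb]].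
    assert (ai : 0 < / a N) by now apply Rinv_0_lt_compat.
    exists (poleseq (RtoC (b N / q)) (poleseq (RtoC (/ a N)) (shiftseq (- RtoC (/ a N))%C c))); split; [|reflexivity].
    apply (xpand_ext (fun w => ((prodC N (fun i => / (1 - RtoC (a i) * w) * / (1 - RtoC (b i / q) * / w)) *
       (- RtoC (/ a N) * / w)) * / (1 - RtoC (/ a N) * / w)) * / (1 - RtoC (b N / q) * / w))%C).
    + intros w hw. cbn [prodC].
      assert (w0 : w <> RtoC 0) by (apply Cmod_gt_0; lra).
      assert (nz : (w - RtoC (/ a N))%C <> RtoC 0).
      { apply Cmod_gt_0. assert (h := Cmod_sub_ge w (RtoC (/ a N))). rewrite Cmod_R, Rabs_pos_eq in h; lra. }
      assert (ca : RtoC (a N) <> RtoC 0) by (intros E; injection E; lra).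
      rewrite RtoC_inv in nz |- * by lra.
      assert (n1 : (1 - RtoC (a N) * w)%C <> RtoC 0).
      { intros E. apply nz. replace (w - / RtoC (a N))%C with (- / RtoC (a N) * (1 - RtoC (a N) * w))%C by (field; assumption).
        rewrite E; ring. }
      assert (n2 : (1 - / RtoC (a N) * / w)%C <> RtoC 0).
      { intros E. apply n1. replace (1 - RtoC (a N) * w)%C with (- RtoC (a N) * w * (1 - / RtoC (a N) * / w))%C by (field; auto).
        rewrite E; ring. }
      assert (key : (/ (1 - RtoC (a N) * w))%C = (- / RtoC (a N) * / w * / (1 - / RtoC (a N) * / w))%C).
      { transitivity (/ (1 - RtoC (a N) * w) * ((1 - / RtoC (a N) * / w) * / (1 - / RtoC (a N) * / w)))%C.
        - rewrite Cinv_r by assumption. ring.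
        - replace (1 - / RtoC (a N) * / w)%C with ((1 - RtoC (a N) * w) * (- / RtoC (a N) * / w))%C at 1 by (field; auto).
          set (u := (1 - RtoC (a N) * w)%C) in *.
          transitivity ((u * / u) * (- / RtoC (a N) * / w * / (1 - / RtoC (a N) * / w)))%C; [ring|].
          rewrite Cinv_r by assumption. ring. }
      rewrite key. ring.
    + apply xpand_pole; [rewrite Cmod_R, Rabs_pos_eq; lra|].
      apply xpand_pole; [rewrite Cmod_R, Rabs_pos_eq; lra|]. now apply xpand_shift.
Qed.
End Xpand.

Lemma powerRZ_zpowC q w k : 0 < q -> w <> RtoC 0 -> zpowC (RtoC q * w) k = (RtoC (powerRZ q k) * zpowC w k)%C.
Proof.
  intros hq hw.
  assert (q0 : RtoC q <> RtoC 0) by (intros E; injection E; lra).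
  assert (pn : forall n, RtoC (q ^ n) = (RtoC q ^ n)%C) by (intros; apply RtoC_pow).
  assert (hn : forall n, ((RtoC q * w) ^ n)%C = (RtoC (q ^ n) * w ^ n)%C).
  { intros n; rewrite pn. induction n as [|n IH]; [simpl; ring|]. rewrite !Cpow_S, IH. ring. }
  destruct k as [|p|p]; simpl; [ring| |].
  - apply hn.
  - rewrite hn, RtoC_inv by (apply pow_nonzero; lra).
    apply Cinv_mult; [intros E; injection E; apply pow_nonzero; lra|now apply Cpow_nz].
Qed.

(** Substitution w -> q w on the circle; it is the source of the powers q^(k+s) in the
    recurrence. *)
Lemma Imom_scale q s F n : 0 < q -> 0 < s -> contD (Dcirc (q * s)) F ->
  Imom (Icirc s) (fun w => F (RtoC q * w)%C) n = (RtoC (powerRZ q n) * Imom (Icirc (q * s)) F n)%C.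
Proof.
  intros hq hs HF. unfold Imom. rewrite Cmult_assoc. f_equal.
  assert (qs : 0 < q * s) by now apply Rmult_lt_0_compat.
  rewrite <- (li_scal _ _ (Icirc_li (q * s))).
  2: { apply contD_zpow; [intros w hw; now apply (Dcirc_neq0 (q * s))|assumption]. }
  unfold Icirc, cint. apply CInt_ext. intros u _.
  assert (w0 := circ_neq0 s u hs).
  assert (ec : circ (q * s) u = (RtoC q * circ s u)%C).
  { unfold circ, RtoC, Cmult; simpl; f_equal; ring. }
  rewrite !circ_eq, ec, powerRZ_zpowC by assumption.
  replace (RtoC (powerRZ q n) * (F (RtoC q * circ s u) * (RtoC (powerRZ q (- n - 1)) * zpowC (circ s u) (- n - 1))) *
     (RtoC (2 * PI) * Ci * (RtoC q * circ s u)))%C with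
    ((RtoC (powerRZ q n) * RtoC (powerRZ q (- n - 1)) * RtoC q) *
     (F (RtoC q * circ s u) * zpowC (circ s u) (- n - 1) * (RtoC (2 * PI) * Ci * circ s u)))%C by ring.
  replace (RtoC (powerRZ q n) * RtoC (powerRZ q (- n - 1)) * RtoC q)%C with (RtoC 1); [ring|].
  rewrite <- !RtoC_mult. f_equal. rewrite <- powerRZ_add by lra.
  replace (n + (- n - 1))%Z with (-1)%Z by lia. simpl. field. lra.
Qed.

Lemma Imom_shift s F n k : 0 < s ->
  Imom (Icirc s) (fun w => F w * (/ w) ^ k)%C n = Imom (Icirc s) F (n + Z.of_nat k).
Proof.
  intros hs. unfold Imom. f_equal. apply (li_ext _ _ (Icirc_li s)). intros w hw.
  assert (w0 := Dcirc_neq0 s w hs hw). rewrite <- Cmult_assoc. f_equal.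
  replace (- (n + Z.of_nat k) - 1)%Z with (- Z.of_nat k + (- n - 1))%Z by lia.
  rewrite zpowC_add, zpowC_opp_nat, Cpow_inv by assumption. reflexivity.
Qed.

(** * The recurrence for the outer coefficients *)

Section Rec.
Context (q : R) (hq : 0 < q < 1) (N : nat) (a b : nat -> R) (rr om : R).
Context (hom : 0 < om) (homR : om < rr).
Hypothesis Hab : forall i, (i < N)%nat -> 0 < a i /\ / a i < om /\ 0 < b i / q < om /\ q * a i * rr < 1.

Lemma rr_neq1 i w j : (i < N)%nat -> Dcirc rr w -> (RtoC (a i) * w * RtoC (q ^ j))%C <> RtoC 1.
Proof.
  intros hi hw E. destruct (Hab i hi) as [h1 [h2 [h3 h4]]].
  assert (hr : 0 < rr) by lra.
  apply (f_equal Cmod) in E. assert (qj : 0 < q ^ j) by (apply pow_lt; lra).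
  rewrite !Cmod_mult, !Cmod_R, (Dcirc_Cmod rr w hr hw), Rabs_R1, !Rabs_pos_eq in E by lra.
  destruct j as [|j].
  - rewrite pow_O in E. assert (a i * / a i < a i * rr) by (apply Rmult_lt_compat_l; lra).
    rewrite Rinv_r in H by lra. lra.
  - assert (q ^ j <= 1) by (rewrite <- (pow1 j); apply pow_incr; lra).
    assert (0 < q ^ j) by (apply pow_lt; lra).
    simpl in E. assert (0 < q * a i * rr) by (repeat apply Rmult_lt_0_compat; lra).
    assert (q * a i * rr * q ^ j <= q * a i * rr * 1) by (apply Rmult_le_compat_l; lra). lra.
Qed.

Lemma psiF_contD_rr : contD (Dcirc rr) (psiF q N a b).
Proof.
  apply (contD_Gq q hq N _ (fun i w => RtoC (a i) * w)%C (fun j w => RtoC (b j) * / w)%C).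
  - intros; apply contD_scal_id.
  - intros; apply contD_scal_inv. intros w; apply Dcirc_neq0; lra.
  - intros; now apply rr_neq1.
Qed.

Lemma psiF_contD_qrr : contD (Dcirc (q * rr)) (psiF q N a b).
Proof.
  assert (h : 0 < q * rr) by (apply Rmult_lt_0_compat; lra).
  apply (contD_Gq q hq N _ (fun i w => RtoC (a i) * w)%C (fun j w => RtoC (b j) * / w)%C).
  - intros; apply contD_scal_id.
  - intros; apply contD_scal_inv. intros w; apply Dcirc_neq0; lra.
  - intros i w j hi hw. apply small_neq1; [assumption|]. destruct (Hab i hi) as [h1 [h2 [h3 h4]]].
    rewrite Cmod_mult, Cmod_R, (Dcirc_Cmod _ w h hw), Rabs_pos_eq by lra. lra.
Qed.

Lemma Dcirc_scal w : Dcirc rr w -> Dcirc (q * rr) (RtoC q * w)%C.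
Proof.
  intros [u [hu <-]]. exists u; split; [assumption|]. unfold circ, RtoC, Cmult; simpl; f_equal; ring.
Qed.

Lemma psiF_qw w : Dcirc rr w ->
  psiF q N a b w = (prodC N (fun i => / (1 - RtoC (a i) * w) * / (1 - RtoC (b i / q) * / w)) *
    psiF q N a b (RtoC q * w))%C.
Proof.
  intros hw. assert (hr : 0 < rr) by lra. assert (w0 := Dcirc_neq0 rr w hr hw).
  assert (wm := Dcirc_Cmod rr w hr hw).
  assert (q0 : RtoC q <> RtoC 0) by (intros E; injection E; lra).
  unfold psiF, Gq. rewrite <- prodC_mult. apply prodC_ext; intros i hi.
  destruct (Hab i hi) as [h1 [h2 [h3 h4]]].
  assert (n0 : qpoch (RtoC (a i) * w) q <> RtoC 0).
  { apply qpoch_neq0; [assumption|]. intros j; now apply rr_neq1. }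
  assert (n1 : (1 - RtoC (b i / q) * / w)%C <> RtoC 0).
  { apply Cmod_gt_0. assert (h := Cmod_sub_ge 1 (RtoC (b i / q) * / w)).
    rewrite Cmod_1, Cmod_mult, Cmod_inv, wm, Cmod_R, Rabs_pos_eq in h by (first [assumption|lra]).
    assert (b i / q * / rr < 1) by (apply (Rdiv_lt_1 (b i / q) rr); lra). lra. }
  rewrite (qpoch_1step q hq (RtoC (a i) * w)) in n0 |- *.
  replace (RtoC (b i) * / (RtoC q * w))%C with (RtoC (b i / q) * / w)%C.
  2: { rewrite RtoC_div by lra. field; auto. }
  rewrite (qpoch_1step q hq (RtoC (b i / q) * / w)).
  replace (RtoC (b i / q) * / w * RtoC q)%C with (RtoC (b i) * / w)%C.
  2: { rewrite RtoC_div by lra. field; auto. }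
  replace (RtoC (a i) * (RtoC q * w))%C with (RtoC (a i) * w * RtoC q)%C by ring.
  set (u := (1 - RtoC (a i) * w)%C) in *. set (v := qpoch (RtoC (a i) * w * RtoC q) q) in *.
  set (x := (1 - RtoC (b i / q) * / w)%C) in *.
  assert (u0 : u <> RtoC 0) by (intros E; apply n0; rewrite E; ring).
  assert (v0 : v <> RtoC 0) by (intros E; apply n0; rewrite E; ring).
  field. auto.
Qed.

(** The q-difference equation is integrated on the circle rr with rho replaced by its partial sums
    in 1/w. The moments of psi(q w) there are moments of psi on the circle q rr. *)
Lemma psi_rec : (0 < N)%nat -> exists rho K, 0 < K /\ rho O = RtoC 0 /\
  (forall s, Cmod (rho s) <= K * om ^ s) /\
  forall k S, Cmod (Imom (Icirc rr) (psiF q N a b) k -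
     csum S (fun s => rho s * RtoC (powerRZ q (k + Z.of_nat s)) * Imom (Icirc (q * rr)) (psiF q N a b) (k + Z.of_nat s))%C)
   <= K * powerRZ rr (- k) * (om / rr) ^ S.
Proof.
  intros hN. assert (hr : 0 < rr) by lra.
  destruct (xpand_rho om rr hom homR q N a b ltac:(lra)) as [rho [[K [K0 [Hc Hf]]] r0]].
  { intros i hi. destruct (Hab i hi) as [h1 [h2 [h3 h4]]]. auto. }
  destruct (Imom_circ_bound rr hr) as [L [L0 HL]].
  set (ph := fun w => psiF q N a b (RtoC q * w)%C).
  assert (cph : contD (Dcirc rr) ph).
  { intros w hw. apply (cont_comp (psiF q N a b) (fun w => RtoC q * w)%C).
    - apply cont_mult; [apply cont_const|apply cont_id].
    - now apply psiF_contD_qrr, Dcirc_scal. }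
  destruct (li_cpt _ _ (Icirc_li rr) ph cph) as [B [B0 HB]].
  assert (W0 : forall w, Dcirc rr w -> w <> RtoC 0) by (intros w; now apply Dcirc_neq0).
  assert (cw : forall s, contD (Dcirc rr) (fun w => ph w * (/ w) ^ s)%C).
  { intros s. apply contD_mult; [assumption|]. intros w hw.
    apply (cont_comp (fun x => x ^ s)%C (fun w => / w)%C).
    - apply (cont_inv (fun z => z)); [auto|apply cont_id].
    - apply cont_pow. }
  exists rho, (K + 1 + L * (K * B)); split; [|split; [now apply r0|split]].
  { assert (0 <= L * (K * B)) by (repeat apply Rmult_le_pos; lra). lra. }
  { intros s. eapply Rle_trans; [apply Hc|]. apply Rmult_le_compat_r; [apply pow_le; lra|].
    assert (0 <= L * (K * B)) by (repeat apply Rmult_le_pos; lra). lra. }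
  intros k S.
  (* Remainder after S terms. It equals rho minus its partial sum, times psi(q w), hence is of order
     (om / rr)^S uniformly on the circle. *)
  set (G := fun S w => (psiF q N a b w + - (1) * csum S (fun s => rho s * (ph w * (/ w) ^ s))%C)%C).
  assert (HG : forall S, contD (Dcirc rr) (G S) /\ (Imom (Icirc rr) (psiF q N a b) k -
     csum S (fun s => rho s * RtoC (powerRZ q (k + Z.of_nat s)) * Imom (Icirc (q * rr)) (psiF q N a b) (k + Z.of_nat s))%C)%C
     = Imom (Icirc rr) (G S) k).
  { clear S. induction S as [|S [IC IH]].
    - split.
      + intros w hw. apply cont_plus; [now apply psiF_contD_rr|]. exact (cont_const (- (1) * 0)%C w).
      + cbn [csum]. replace (Imom (Icirc rr) (psiF q N a b) k - 0)%C with (Imom (Icirc rr) (psiF q N a b) k) by ring.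
        apply (Imom_ext _ _ (Icirc_li rr)). intros w _; unfold G; cbn [csum]; ring.
    - assert (c1 : contD (Dcirc rr) (fun w => (- rho S) * (ph w * (/ w) ^ S))%C).
      { apply contD_mult; [intros w _; apply cont_const|apply cw]. }
      assert (eG : forall w, G (Datatypes.S S) w = (G S w + (- rho S) * (ph w * (/ w) ^ S))%C).
      { intros w; unfold G; cbn [csum]; ring. }
      split.
      + intros w hw. apply (cont_ext (fun w => G S w + (- rho S) * (ph w * (/ w) ^ S))%C); [intros; now rewrite eG|].
        apply cont_plus; [now apply IC|now apply c1].
      + rewrite (Imom_ext _ _ (Icirc_li rr) (G (Datatypes.S S)) (fun w => G S w + (- rho S) * (ph w * (/ w) ^ S))%C) by (intros; apply eG).
        rewrite (Imom_plus _ _ (Icirc_li rr) W0) by assumption.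
        rewrite <- IH. cbn [csum].
        assert (e2 : Imom (Icirc rr) (fun w => (- rho S) * (ph w * (/ w) ^ S))%C k =
          ((- rho S) * (RtoC (powerRZ q (k + Z.of_nat S)) * Imom (Icirc (q * rr)) (psiF q N a b) (k + Z.of_nat S)))%C).
        { rewrite <- Imom_scale by (first [apply psiF_contD_qrr|lra]). fold ph. rewrite <- Imom_shift by lra.
          unfold Imom. rewrite Cmult_assoc. f_equal. rewrite <- (li_scal _ _ (Icirc_li rr)).
          - apply (li_ext _ _ (Icirc_li rr)); intros; ring.
          - apply contD_zpow; [assumption|apply cw]. }
        rewrite e2. ring. }
  destruct (HG S) as [IC ->].
  eapply Rle_trans; [apply (HL (G S) (K * (om / rr) ^ S * B) k IC)|].
  - intros w hw. unfold G. rewrite psiF_qw by assumption. fold (ph w).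
    rewrite (csum_ext S _ (fun s => (rho s * (/ w) ^ s) * ph w)%C) by (intros; ring). rewrite csum_scal_r.
    match goal with |- Cmod ?t <= _ => replace t with ((prodC N (fun i => / (1 - RtoC (a i) * w) * / (1 - RtoC (b i / q) * / w)) -
      csum S (fun s => rho s * (/ w) ^ s)%C) * ph w)%C by ring end.
    rewrite Cmod_mult. apply Rmult_le_compat; auto using Cmod_ge_0.
    apply Hf. now apply Dcirc_Cmod.
  - assert (p1 := powerRZ_lt rr (- k) hr). assert (p2 : 0 <= (om / rr) ^ S) by (apply pow_le, Rlt_le, Rdiv_lt_0_compat; lra).
    replace (L * (K * (om / rr) ^ S * B) * powerRZ rr (- k)) with (L * (K * B) * (powerRZ rr (- k) * (om / rr) ^ S)) by ring.
    rewrite (Rmult_assoc _ (powerRZ rr (- k))). apply Rmult_le_compat_r; [apply Rmult_le_pos; lra|lra].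
Qed.
End Rec.

(** * The kernels on their contours *)

(** Passes from 1/(w - 1/c), which winding numbers evaluate, to the factors 1/(1 - c w) of the
    partial fractions; they differ by the constant -c. *)
Lemma Zint_psi_poles q (hq : 0 < q < 1) N (D : C -> Prop) (I : (C -> C) -> C) (a b : nat -> R) : lin_int D I ->
  (forall w, D w -> w <> RtoC 0) ->
  (forall i i' j j', (i < N)%nat -> (i' < N)%nat -> a i * q ^ j = a i' * q ^ j' -> i = i' /\ j = j') ->
  (forall i, (i < N)%nat -> 0 < a i) ->
  (forall i j w, (i < N)%nat -> D w -> w <> RtoC (/ (a i * q ^ j))) ->
  Zint I (fun _ => RtoC 1) ->
  (forall i j, (i < N)%nat -> I (fun w => / (w - RtoC (/ (a i * q ^ j))))%C = RtoC 0) ->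
  contD D (psiF q N a b) /\ Zint I (psiF q N a b).
Proof.
  intros HI D0 inj a0 nz H1 Hp.
  assert (c0 : forall i j, (i < N)%nat -> 0 < a i * q ^ j).
  { intros i j hi; apply Rmult_lt_0_compat; [now apply a0|apply pow_lt; lra]. }
  assert (nz1 : forall i j w, (i < N)%nat -> D w -> (w - RtoC (/ (a i * q ^ j)))%C <> RtoC 0).
  { intros i j w hi hw E. apply (nz i j w hi hw).
    replace w with ((w - RtoC (/ (a i * q ^ j))) + RtoC (/ (a i * q ^ j)))%C by ring. rewrite E; ring. }
  assert (eq : forall i j w, (i < N)%nat -> (1 - RtoC (a i * q ^ j) * w)%C =
     (- RtoC (a i * q ^ j) * (w - RtoC (/ (a i * q ^ j))))%C).
  { intros i j w hi. assert (c := c0 i j hi). rewrite RtoC_inv by lra. field. intros E; injection E; lra. }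
  assert (cc : forall i j, (i < N)%nat -> (- RtoC (a i * q ^ j))%C <> RtoC 0).
  { intros i j hi E. assert (c := c0 i j hi). injection E; lra. }
  assert (nz2 : forall i w j, (i < N)%nat -> D w -> (RtoC (a i) * w * RtoC (q ^ j))%C <> RtoC 1).
  { intros i w j hi hw E. apply (Cmult_neq0 _ _ (cc i j hi) (nz1 i j w hi hw)). rewrite <- eq by assumption.
    rewrite RtoC_mult. replace (RtoC (a i) * RtoC (q ^ j) * w)%C with (RtoC (a i) * w * RtoC (q ^ j))%C by ring.
    rewrite E; ring. }
  split.
  - apply (contD_Gq q hq N _ (fun i w => RtoC (a i) * w)%C (fun j w => RtoC (b j) * / w)%C).
    + intros; apply contD_scal_id.
    + intros; now apply contD_scal_inv.
    + assumption.
  - apply (Zint_psi q hq N D I HI D0 a b inj a0 nz2 H1).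
    intros i j hi. rewrite (li_ext _ _ HI _ (fun w => / (- RtoC (a i * q ^ j)) * / (w - RtoC (/ (a i * q ^ j))))%C).
    + rewrite (li_scal _ _ HI), Hp by
        (first [assumption | apply contD_inv; [intros; now apply nz1|];
           intros w _; apply (cont_ext (fun w => w + - RtoC (/ (a i * q ^ j)))%C); [intros; ring|];
           apply cont_plus; [apply cont_id|apply cont_const]]). ring.
    + intros w hw. rewrite eq by assumption. apply Cinv_mult; [now apply cc|now apply nz1].
Qed.

(** The w of the kernel cancels against dw / w, which leaves a product of a function of z and a
    function of w over z - w. The sign is that of 1/(z - w) = - sum z^l w^(-l-1). *)
Lemma kernel_expand q (hq : 0 < q < 1) N (a b : nat -> R) r gam dgam m1 m2 : 0 < r ->
  (forall i, (i < N)%nat -> 0 < b i < r) ->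
  C1loop gam dgam -> (forall s, r < Cmod (gam s)) -> contD (trace gam) (psiF q N a b) ->
  Clim (fun L => csum L (fun l => Imom (Icirc r) (PhiF q N a b) (m1 - Z.of_nat l) *
     Imom (cint gam dgam) (psiF q N a b) (Z.of_nat l - m2))%C) (- kernel q N a b r gam dgam m1 m2)%C.
Proof.
  intros hr hb hl hg hc.
  assert (HI := lin_int_loop gam dgam hl).
  assert (Z0 : forall z, Dcirc r z -> z <> RtoC 0) by (intros z; now apply Dcirc_neq0).
  assert (gr : forall w, trace gam w -> r < Cmod w) by (intros w [s [_ <-]]; apply hg).
  assert (W0 : forall w, trace gam w -> w <> RtoC 0).
  { intros w hw. apply Cmod_gt_0. specialize (gr w hw). lra. }
  assert (cPhi : contD (Dcirc r) (PhiF q N a b)).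
  { apply (contD_Gq q hq N _ (fun j w => RtoC (b j) * / w)%C (fun i w => RtoC (a i) * w)%C).
    - intros; now apply contD_scal_inv.
    - intros; apply contD_scal_id.
    - intros i w j hi hw. apply small_neq1; [assumption|]. apply (scal_inv_lt1 _ r); [now apply hb|].
      rewrite (Dcirc_Cmod r w hr hw). lra. }
  set (A := fun z => (PhiF q N a b z * zpowC z (- m1 - 1))%C).
  set (B := fun w => (psiF q N a b w * zpowC w m2)%C).
  assert (cA : contD (Dcirc r) A) by now apply contD_zpow.
  assert (cB : contD (trace gam) B) by now apply contD_zpow.
  assert (t0 := tpi_neq0).
  assert (ek : kernel q N a b r gam dgam m1 m2 =
    (/ (tpi * tpi) * Icirc r (fun z => A z * cint gam dgam (fun w => B w * / (z - w)))%C)%C).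
  { unfold kernel. unfold Cdiv at 1. rewrite Cmult_comm. fold tpi. f_equal.
    apply (li_ext _ _ (Icirc_li r)). intros z hz.
    destruct (double_gap _ _ HI r gr) as [rh [h1 h2]].
    rewrite (li_ext _ _ HI _ (fun w => (zpowC z (- m1) * PhiF q N a b z) * (B w * / (z - w)))%C).
    - rewrite (li_scal _ _ HI).
      + unfold A, Zminus. rewrite zpowC_add by auto. unfold Cdiv. simpl (zpowC z (- (1))). rewrite Cmult_1_r. ring.
      + apply (contD_double_inner _ B cB r rh z h1 h2). rewrite (Dcirc_Cmod r z hr hz). assumption.
    - intros w hw. unfold gfun, B, PhiF, psiF, Gq, Cdiv. rewrite zpowC_opp by auto.
      rewrite <- (prodC_mult N).
      rewrite (prodC_ext N _ (fun i => (/ qpoch (RtoC (b i) * / z) q * qpoch (RtoC (a i) * z) q) *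
         (/ qpoch (RtoC (a i) * w) q * qpoch (RtoC (b i) * / w) q))%C) by (intros; ring).
      rewrite prodC_mult. set (P1 := prodC N _). set (P2 := prodC N _).
      transitivity ((w * / w) * (/ zpowC z m1 * P1 * (P2 * zpowC w m2 * / (z - w))))%C; [ring|].
      rewrite Cinv_r by auto. ring. }
  rewrite ek.
  assert (hd := double_expand (Dcirc r) (trace gam) (Icirc r) (cint gam dgam) (Icirc_li r) HI A B cA cB r hr
     (fun z => Dcirc_Cmod r z hr) gr).
  apply (Clim_scal (/ (tpi * tpi))%C) in hd.
  match goal with |- Clim _ ?l => match type of hd with Clim _ ?l' => replace l with l' by ring end end.
  eapply Clim_ext; [|exact hd]. intros L. cbv beta. rewrite <- csum_scal. apply csum_ext. intros l _.
  unfold Imom.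
  replace (/ (tpi * tpi))%C with (/ tpi * / tpi)%C by (field; assumption).
  match goal with |- (_ * (?x * ?y) = ?x' * _ * (?y' * _))%C => replace x' with x; [replace y' with y; [ring|]|] end.
  - apply (li_ext _ _ HI). intros w hw. unfold B. rewrite Cpow_inv by auto.
    rewrite <- zpowC_opp_nat, <- Cmult_assoc, <- zpowC_add by auto. do 2 f_equal. lia.
  - apply (li_ext _ _ (Icirc_li r)). intros z hz. unfold A.
    rewrite <- zpowC_nat, <- Cmult_assoc, <- zpowC_add by auto. do 2 f_equal. lia.
Qed.

(** The estimates hold for kernels conjugated by s0^m. Conjugation changes no Fredholm minor, so
    convergence and value transfer together. *)
Lemma is_fredholm_det_conj (A B : Z -> Z -> C) (u v : Z -> C) d : (forall m, (u m * v m)%C = RtoC 1) ->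
  (forall m m', B m m' = (u m * A m m' * v m')%C) -> is_fredholm_det B d -> is_fredholm_det A d.
Proof.
  intros uv E. assert (e : fred_minor B = fred_minor A).
  { apply functional_extensionality; intros n; apply functional_extensionality; intros x. unfold fred_minor.
    rewrite (@DetAlg.detC_ext n _ (fun i j => u (x i) * A (x i) (x j) * v (x j))%C) by (intros; apply E).
    exact (@DetAlg.detC_conj n (fun i j => A (x i) (x j)) (fun i => u (x i)) (fun i => v (x i)) (fun i _ => uv (x i))). }
  unfold is_fredholm_det. now rewrite e.
Qed.

Lemma fcoef_ffun q t k m : 0 < q -> fcoef q t k m = RtoC (ffun q (t * Rpower q (/ 2 + INR k)) m).
Proof.
  intros hq. unfold fcoef, ffun. rewrite Rpower_plus, <- powerRZ_Rpower, Rmult_assoc by assumption. reflexivity.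
Qed.

Lemma powerRZ_ratio s0 s n : 0 < s0 -> 0 < s -> powerRZ s (- n) * powerRZ s0 n = powerRZ (s0 / s) n.
Proof.
  intros h0 h. unfold Rdiv. rewrite powerRZ_mult, powerRZ_neg', powerRZ_inv'. ring.
Qed.

Lemma cint_zpow_winding gam dgam W k : C1loop gam dgam -> (forall s, gam s <> RtoC 0) -> winding gam dgam (RtoC 0) = W ->
  cint gam dgam (fun w => 1 * zpowC w k)%C = if Z.eqb k (-1) then (W * tpi)%C else RtoC 0.
Proof.
  intros hl h0 hW.
  assert (HI := lin_int_loop gam dgam hl).
  destruct (Z.eqb_spec k (-1)) as [->|hk].
  - rewrite <- (loop_winding gam dgam (RtoC 0) W hW). apply (li_ext _ _ HI). intros w _.
    simpl. rewrite Cmult_1_r, Cmult_1_l. f_equal. ring.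
  - rewrite <- (cint_zpowC gam dgam k hl h0 hk). apply (li_ext _ _ HI). intros; ring.
Qed.

Lemma Icirc_zpow1 s k : 0 < s ->
  Icirc s (fun w => 1 * zpowC w k)%C = if Z.eqb k (-1) then tpi else RtoC 0.
Proof.
  intros hs. rewrite (li_ext _ _ (Icirc_li s) _ (fun w => zpowC w k)) by (intros; ring).
  destruct (Z.eqb_spec k (-1)) as [->|hk]; [|now apply Icirc_zpow].
  rewrite <- (Icirc_inv s hs). apply (li_ext _ _ (Icirc_li s)). intros w _. simpl. now rewrite Cmult_1_r.
Qed.

(** * Contours replaced by circles *)

Section Contours.
Context (q : R) (hq : 0 < q < 1) (N : nat) (a b : nat -> R) (s1 rr : R) (hs1 : 0 < s1).
Hypothesis Ha : forall i, (i < N)%nat -> 0 < a i /\ s1 < / a i /\ / a i < rr /\ q * a i * rr < 1.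
Hypothesis inj : forall i i' j j', (i < N)%nat -> (i' < N)%nat -> a i * q ^ j = a i' * q ^ j' -> i = i' /\ j = j'.

Lemma pole_Cmod i j : (i < N)%nat -> Cmod (RtoC (/ (a i * q ^ j))) = / (a i * q ^ j).
Proof.
  intros hi. rewrite Cmod_R. apply Rabs_pos_eq, Rlt_le, Rinv_0_lt_compat, Rmult_lt_0_compat;
    [now apply Ha|apply pow_lt; lra].
Qed.

Lemma pole_ge i j : (i < N)%nat -> / a i <= / (a i * q ^ j).
Proof.
  intros hi. assert (qj : 0 < q ^ j) by (apply pow_lt; lra).
  assert (qj1 : q ^ j <= 1) by (rewrite <- (pow1 j); apply pow_incr; lra).
  destruct (Ha i hi) as [h _]. apply Rinv_le_contravar; [now apply Rmult_lt_0_compat|nra].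
Qed.

Lemma pole_gt i j : (i < N)%nat -> rr < / (a i * q ^ S j).
Proof.
  intros hi. assert (qj : 0 < q ^ j) by (apply pow_lt; lra).
  assert (qj1 : q ^ j <= 1) by (rewrite <- (pow1 j); apply pow_incr; lra).
  destruct (Ha i hi) as [h [h2 [h3 h4]]].
  assert (c0 : 0 < a i * q ^ S j) by (apply Rmult_lt_0_compat; [assumption|apply pow_lt; lra]).
  apply (Rmult_lt_reg_r (a i * q ^ S j)); [assumption|]. rewrite Rinv_l by lra.
  replace (rr * (a i * q ^ S j)) with (q * a i * rr * q ^ j) by (simpl; ring).
  assert (0 < / a i) by now apply Rinv_0_lt_compat.
  assert (0 < q * a i * rr) by (repeat apply Rmult_lt_0_compat; lra). nra.
Qed.

Lemma Icirc_s1_pole i j s : (i < N)%nat -> 0 < s -> s <= s1 -> Icirc s (fun w => / (w - RtoC (/ (a i * q ^ j))))%C = RtoC 0.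
Proof.
  intros hi h0 hs. assert (p1 := pole_ge i j hi). destruct (Ha i hi) as [h [h2 [h3 h4]]].
  assert (pc := pole_Cmod i j hi). exact (circ_winding_out s h0 (RtoC (/ (a i * q ^ j))) ltac:(rewrite pc; lra) ltac:(rewrite pc; lra)).
Qed.

Lemma circ_pole s i j w : (i < N)%nat -> 0 < s -> Dcirc s w -> s <> / (a i * q ^ j) -> w <> RtoC (/ (a i * q ^ j)).
Proof.
  intros hi hs hw ne E. apply ne. rewrite <- (Dcirc_Cmod s w hs hw), E. now apply pole_Cmod.
Qed.

Lemma s1_pole i j : (i < N)%nat -> s1 <> / (a i * q ^ j).
Proof. intros hi. assert (p1 := pole_ge i j hi). destruct (Ha i hi) as [h [h2 _]]. lra. Qed.

(** The contour minus the circle s1 has winding number 1 - 1 = 0 about the origin and 0 about every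
    pole of psi. *)
Lemma psi_moment_Dbar gam dgam n : C1loop gam dgam -> (forall s, gam s <> RtoC 0) ->
  (forall s i j, (i < N)%nat -> gam s <> RtoC (/ (a i * q ^ j))) ->
  winding gam dgam (RtoC 0) = RtoC 1 ->
  (forall i j, (i < N)%nat -> winding gam dgam (RtoC (/ (a i * q ^ j))) = RtoC 0) ->
  contD (trace gam) (psiF q N a b) /\
  Imom (cint gam dgam) (psiF q N a b) n = Imom (Icirc s1) (psiF q N a b) n.
Proof.
  intros hl h0 hp hw0 hwp.
  destruct (Zint_psi_poles q hq N _ _ a b (lin_int_comb _ _ _ _ (- (1))%C (lin_int_loop gam dgam hl) (Icirc_li s1))) as [hc hz].
  - intros w [[s [_ <-]]|h]; [apply h0|now apply (Dcirc_neq0 s1)].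
  - exact inj.
  - intros i hi; now apply Ha.
  - intros i j w hi [[s [_ <-]]|h]; [now apply hp|]. apply (circ_pole s1); auto using s1_pole.
  - intros k. cbv beta. rewrite (cint_zpow_winding gam dgam 1 k hl h0 hw0), Icirc_zpow1 by assumption.
    destruct (Z.eqb k (-1)); ring.
  - intros i j hi. cbv beta. rewrite (loop_winding _ _ _ _ (hwp i j hi)), Icirc_s1_pole by (auto; lra). ring.
  - split; [intros w hw; apply hc; now left|].
    specialize (hz (- n - 1)%Z). cbv beta in hz. unfold Imom. f_equal.
    set (x := cint gam dgam _) in *. set (y := Icirc s1 _) in *.
    transitivity ((x + - (1) * y) + y)%C; [ring|]. rewrite hz; ring.
Qed.

(** The contour plus the circle s1 minus the circle rr has winding numbers 0 + 1 - 1 about the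
    origin, 1 + 0 - 1 about 1/a_i, and 0 about the remaining poles, which lie beyond rr. *)
Lemma psi_moment_D gam dgam n : C1loop gam dgam -> (forall s, gam s <> RtoC 0) ->
  (forall s i j, (i < N)%nat -> gam s <> RtoC (/ (a i * q ^ j))) ->
  winding gam dgam (RtoC 0) = RtoC 0 ->
  (forall i, (i < N)%nat -> winding gam dgam (RtoC (/ a i)) = RtoC 1) ->
  (forall i j, (i < N)%nat -> (1 <= j)%nat -> winding gam dgam (RtoC (/ (a i * q ^ j))) = RtoC 0) ->
  (0 < N)%nat ->
  contD (trace gam) (psiF q N a b) /\
  Imom (cint gam dgam) (psiF q N a b) n = (Imom (Icirc rr) (psiF q N a b) n - Imom (Icirc s1) (psiF q N a b) n)%C.
Proof.
  intros hl h0 hp hw0 hw1 hwp hN.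
  assert (hr : 0 < rr) by (destruct (Ha 0%nat hN) as [h [h2 [h3 h4]]]; lra).
  destruct (Zint_psi_poles q hq N _ _ a b (lin_int_comb _ _ _ _ (- (1))%C
     (lin_int_comb _ _ _ _ 1%C (lin_int_loop gam dgam hl) (Icirc_li s1)) (Icirc_li rr))) as [hc hz].
  - intros w [[[s [_ <-]]|h]|h]; [apply h0|now apply (Dcirc_neq0 s1)|now apply (Dcirc_neq0 rr)].
  - exact inj.
  - intros i hi; now apply Ha.
  - intros i j w hi [[[s [_ <-]]|h]|h]; [now apply hp| |].
    + apply (circ_pole s1); auto using s1_pole.
    + apply (circ_pole rr); auto. destruct j as [|j].
      * rewrite pow_O, Rmult_1_r. destruct (Ha i hi) as [_ [_ [h3 _]]]. lra.
      * assert (h4 := pole_gt i j hi). lra.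
  - intros k. cbv beta. rewrite (cint_zpow_winding gam dgam 0 k hl h0 hw0), !Icirc_zpow1 by assumption.
    destruct (Z.eqb k (-1)); ring.
  - intros i j hi. cbv beta. rewrite Icirc_s1_pole by (auto; lra).
    destruct j as [|j].
    + assert (e : / (a i * q ^ 0) = / a i) by (rewrite pow_O; f_equal; ring).
      rewrite e, (loop_winding _ _ _ _ (hw1 i hi)).
      assert (pc := pole_Cmod i 0 hi). rewrite e in pc. destruct (Ha i hi) as [_ [_ [h3 _]]].
      assert (hw := circ_winding_in rr hr (RtoC (/ a i)) ltac:(rewrite pc; lra) ltac:(rewrite pc; lra)).
      unfold Icirc. rewrite hw. ring.
    + rewrite (loop_winding _ _ _ _ (hwp i (S j) hi ltac:(lia))).
      assert (h4 := pole_gt i j hi).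
      assert (pc := pole_Cmod i (S j) hi).
      assert (hw := circ_winding_out rr hr (RtoC (/ (a i * q ^ S j))) ltac:(rewrite pc; lra) ltac:(rewrite pc; lra)).
      unfold Icirc. rewrite hw. ring.
  - split; [intros w hw; apply hc; left; now left|].
    specialize (hz (- n - 1)%Z). cbv beta in hz. unfold Imom.
    set (x := cint gam dgam _) in *. set (y := Icirc s1 _) in *. set (z := Icirc rr _) in *.
    replace x with ((x + 1 * y + - (1) * z) + (z - y))%C by ring. rewrite hz; ring.
Qed.

(** Phi has no singularity in the finite plane outside the disc of radius max b_j, so the circle C
    can be enlarged to the working radius s0. *)
Lemma Phi_moment r s0 n : 0 < r -> r <= s0 -> (forall j, (j < N)%nat -> 0 < b j < r) ->
  Imom (Icirc r) (PhiF q N a b) n = Imom (Icirc s0) (PhiF q N a b) n.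
Proof.
  intros hr hs0 hb. assert (h0 : 0 < s0) by lra.
  assert (hz := Zint_Phi q hq N _ _ (lin_int_comb _ _ _ _ (- (1))%C (Icirc_li r) (Icirc_li s0))).
  assert (hZ : Zint (fun F => Icirc r F + - (1) * Icirc s0 F)%C (PhiF q N a b)).
  { apply (hz (fun w hw => match hw with or_introl h => Dcirc_neq0 r w hr h | or_intror h => Dcirc_neq0 s0 w h0 h end) a b r hb).
    - intros w [h|h]; [rewrite (Dcirc_Cmod r w hr h)|rewrite (Dcirc_Cmod s0 w h0 h)]; lra.
    - intros k. rewrite !Icirc_zpow1 by assumption. ring. }
  specialize (hZ (- n - 1)%Z). cbv beta in hZ. unfold Imom. f_equal.
  set (x := Icirc r _) in *. set (y := Icirc s0 _) in *.
  transitivity ((x + - (1) * y) + y)%C; [ring|]. rewrite hZ; ring.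
Qed.
End Contours.

(** All ratios a_i / a_i' lie strictly between q and 1/q, so no nonzero power of q can relate two of
    them. *)
Lemma poles_injective q N (a : nat -> R) : 0 < q < 1 ->
  (forall i, (i < N)%nat -> 0 < a i) ->
  (forall i j, (i < j)%nat -> (j < N)%nat -> a j < a i) ->
  q * a 0%nat < a (N - 1)%nat ->
  forall i i' j j', (i < N)%nat -> (i' < N)%nat -> a i * q ^ j = a i' * q ^ j' -> i = i' /\ j = j'.
Proof.
  intros hq a0 mono hqa.
  assert (le0 : forall i, (i < N)%nat -> a i <= a 0%nat).
  { intros [|i] hi; [lra|]. left; apply mono; lia. }
  assert (leN : forall i, (i < N)%nat -> a (N - 1)%nat <= a i).
  { intros i hi. destruct (Nat.eq_dec i (N - 1)) as [->|ne]; [lra|]. left; apply mono; lia. }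
  assert (lt : forall i i' j d, (i < N)%nat -> (i' < N)%nat -> a i * q ^ j = a i' * q ^ (j + S d) -> False).
  { intros i i' j d hi hi' E. rewrite pow_add, <- Rmult_assoc in E.
    assert (qj : 0 < q ^ j) by (apply pow_lt; lra).
    assert (E2 : a i = a i' * q ^ S d) by (apply (Rmult_eq_reg_r (q ^ j)); lra).
    assert (qd : q ^ d <= 1) by (rewrite <- (pow1 d); apply pow_incr; lra).
    assert (qd0 : 0 < q ^ d) by (apply pow_lt; lra).
    assert (h1 := le0 i' hi'). assert (h2 := leN i hi). assert (h3 := a0 i' hi').
    simpl in E2. assert (a i' * q * q ^ d <= a i' * q * 1) by (apply Rmult_le_compat_l; nra). nra. }
  intros i i' j j' hi hi' E.
  destruct (Nat.lt_trichotomy j j') as [h|[h|h]].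
  - exfalso. apply (lt i i' j (j' - j - 1)%nat hi hi'). rewrite E. do 2 f_equal; lia.
  - split; [|assumption]. subst j'.
    assert (qj : 0 < q ^ j) by (apply pow_lt; lra).
    assert (E2 : a i = a i') by (apply (Rmult_eq_reg_r (q ^ j)); lra).
    destruct (Nat.lt_trichotomy i i') as [h|[h|h]]; [|assumption|].
    + specialize (mono i i' h hi'). lra.
    + specialize (mono i' i h hi). lra.
  - exfalso. apply (lt i' i j' (j - j' - 1)%nat hi' hi). rewrite <- E. do 2 f_equal; lia.
Qed.

(** The exponent -1/2 + eps exceeds -1 and q < 1, so the assumption on the ratio gives q a_1 <
    a_N. *)
Lemma ratio_lt_inv q eps x y : 0 < q < 1 -> 0 < eps -> 0 < y -> x / y < Rpower q (- / 2 + eps) -> q * x < y.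
Proof.
  intros hq he hy h.
  assert (lq : ln q < 0) by (rewrite <- ln_1; apply ln_increasing; lra).
  assert (h1 : Rpower q (- / 2 + eps) < Rpower q (- (1))).
  { unfold Rpower. apply exp_increasing. nra. }
  rewrite Rpower_Ropp, Rpower_1 in h1 by lra.
  assert (h2 : x / y < / q) by lra.
  apply (Rmult_lt_compat_r (q * y)) in h2; [|now apply Rmult_lt_0_compat].
  field_simplify in h2; lra.
Qed.

(** * Choice of the radii and conclusion *)

Theorem theorem3p1
  (q : R) (N : nat) (a b : nat -> R) (eps t : R) (k : nat)
  (r : R) (gD dgD gDb dgDb : R -> C) :
  (* standing assumptions *)
  0 < q < 1 ->
  (1 <= N)%nat ->
  (forall i, (i < N)%nat -> 0 < a i < 1 /\ 0 < b i < 1) ->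
  (forall i j, (i < N)%nat -> (j < N)%nat -> i <> j -> b i <> b j) ->
  (forall i j, (i < N)%nat -> (j < N)%nat -> a i <> b j) ->
  (forall i j, (i < j)%nat -> (j < N)%nat -> a j < a i) ->
  0 < eps < / 2 ->
  a 0%nat / a (N - 1)%nat < Rpower q (- / 2 + eps) ->
  0 < t ->
  (* the circle C : |z| = r *)
  (forall j, (j < N)%nat -> b j < r) ->
  r < / a 0%nat ->
  (* the contour D *)
  closed_C1_curve gD dgD ->
  (forall s, r < Cmod (gD s)) ->
  (forall s i j, (i < N)%nat -> gD s <> RtoC (/ (a i * q ^ j))) ->
  (forall i, (i < N)%nat -> winding gD dgD (RtoC (/ a i)) = RtoC 1) ->
  (forall i j, (i < N)%nat -> (1 <= j)%nat ->
     winding gD dgD (RtoC (/ (a i * q ^ j))) = RtoC 0) ->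
  winding gD dgD (RtoC 0) = RtoC 0 ->
  (* the contour \bar D *)
  closed_C1_curve gDb dgDb ->
  (forall s, r < Cmod (gDb s)) ->
  (forall s i j, (i < N)%nat -> gDb s <> RtoC (/ (a i * q ^ j))) ->
  (forall p, Cmod p <= r -> winding gDb dgDb p = RtoC 1) ->
  (forall i j, (i < N)%nat ->
     winding gDb dgDb (RtoC (/ (a i * q ^ j))) = RtoC 0) ->
  (* det(1 - fK) = det(1 + fL) *)
  exists d : C,
    is_fredholm_det
      (fun m1 m2 => Copp (Cmult (fcoef q t k m1) (kernel q N a b r gD dgD m1 m2))) d /\
    is_fredholm_det
      (fun m1 m2 => Cmult (fcoef q t k m1) (kernel q N a b r gDb dgDb m1 m2)) d.
Proof.
  intros hq hN hab _ _ mono heps hratio ht hbr hra hD hDr hDp hDw1 hDw hDw0 hB hBr hBp hBw hBp0.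
  assert (a0 : forall i, (i < N)%nat -> 0 < a i) by (intros i hi; now apply hab).
  assert (b0 : forall i, (i < N)%nat -> 0 < b i < r) by (intros i hi; split; [now apply hab|now apply hbr]).
  assert (aN := a0 (N - 1)%nat ltac:(lia)). assert (a00 := a0 0%nat ltac:(lia)).
  assert (hqa : q * a 0%nat < a (N - 1)%nat) by (apply (ratio_lt_inv q eps); auto; lra).
  assert (inj := poles_injective q N a hq a0 mono hqa).
  assert (hr : 0 < r) by (destruct (b0 0%nat ltac:(lia)); lra).
  set (ia := / a 0%nat) in *.
  assert (le0 : forall i, (i < N)%nat -> ia <= / a i).
  { intros [|i] hi; [unfold ia; lra|]. apply Rinv_le_contravar; [now apply a0|]. left; apply mono; lia. }
  assert (leN : forall i, (i < N)%nat -> / a i <= / a (N - 1)%nat).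
  { intros i hi. apply Rinv_le_contravar; [assumption|].
    destruct (Nat.eq_dec i (N - 1)) as [->|ne]; [lra|]. left; apply mono; lia. }
  (* Lower limit for the inner circles: at least r, so that they stay outside C, and at least q /
     a_N, so that division by q carries them beyond all poles 1/a_i. It is below 1/a_1 because r <
     1/a_1 and q a_1 < a_N. *)
  set (mx := Rmax r (q * / a (N - 1)%nat)).
  assert (mx1 : r <= mx) by apply Rmax_l. assert (mx2 : q * / a (N - 1)%nat <= mx) by apply Rmax_r.
  assert (mx3 : mx < ia).
  { apply Rmax_lub_lt; [assumption|]. unfold ia.
    apply (Rmult_lt_reg_r (a 0%nat * a (N - 1)%nat)); [now apply Rmult_lt_0_compat|]. field_simplify; lra. }
  (* Midpoints producing mx < q rr < s2 < s0 < s1 < 1/a_1 and 1/a_N <= mx / q < w0 < rr < 1/(q a_1).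
     The radius w0 exceeds all poles 1/a_i and b_i / q of rho. *)
  set (s0 := (mx + ia) / 2). set (s1 := (s0 + ia) / 2).
  set (qR := (mx + s0) / 2). set (rr := qR / q). set (s2 := (qR + s0) / 2). set (w0 := (mx / q + rr) / 2).
  assert (e0 : mx < s0 < ia) by (unfold s0; lra).
  assert (e1 : s0 < s1 < ia) by (unfold s1; lra).
  assert (eR : mx < qR < s0) by (unfold qR; lra).
  assert (e2 : qR < s2 < s0) by (unfold s2; lra).
  assert (eqR : q * rr = qR) by (unfold rr; field; lra).
  assert (emx : q * (mx / q) = mx) by (field; lra).
  assert (eNr : / a (N - 1)%nat <= mx / q) by (apply (Rmult_le_reg_l q); lra).
  assert (erq : r / q <= mx / q) by (apply Rmult_le_compat_r; [apply Rlt_le, Rinv_0_lt_compat|]; lra).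
  assert (emr : mx / q < rr) by (apply (Rmult_lt_reg_l q); lra).
  assert (ew : mx / q < w0 < rr) by (unfold w0; lra).
  assert (iaN := leN 0%nat ltac:(lia)). fold ia in iaN.
  assert (Ha : forall i, (i < N)%nat -> 0 < a i /\ s1 < / a i /\ / a i < rr /\ q * a i * rr < 1).
  { intros i hi. assert (h1 := a0 i hi). assert (h2 := le0 i hi). assert (h3 := leN i hi).
    split; [assumption|split; [lra|split; [lra|]]].
    replace (q * a i * rr) with (a i * (q * rr)) by ring. rewrite eqR.
    apply Rlt_le_trans with (a i * ia); [apply Rmult_lt_compat_l; lra|].
    apply Rle_trans with (a i * / a i); [apply Rmult_le_compat_l; lra|]. rewrite Rinv_r; lra. }
  assert (qs : q * s1 < s0).
  { apply Rlt_le_trans with mx; [|lra]. eapply Rlt_le_trans; [|exact mx2]. apply Rmult_lt_compat_l; lra. }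
  assert (Hok : okab q N s0 s1 a b).
  { split; [|exact inj]. intros i hi. destruct (Ha i hi) as [h1 [h2 _]]. destruct (b0 i hi). split; [|lra].
    split; [assumption|]. rewrite <- (Rinv_inv (a i)). apply Rinv_lt_contravar; [|assumption].
    apply Rmult_lt_0_compat; lra. }
  assert (Hab : forall i, (i < N)%nat -> 0 < a i /\ / a i < w0 /\ 0 < b i / q < w0 /\ q * a i * rr < 1).
  { intros i hi. destruct (Ha i hi) as [h1 [h2 [h3 h4]]]. assert (h5 := leN i hi). destruct (b0 i hi) as [h6 h7].
    assert (iq : 0 < / q) by (apply Rinv_0_lt_compat; lra).
    assert (b i / q < r / q) by (apply Rmult_lt_compat_r; lra).
    assert (0 < b i / q) by (apply Rmult_lt_0_compat; lra).
    repeat split; try assumption; lra. }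
  assert (hs0 : 0 < s0) by lra. assert (hs1 : 0 < s1) by lra. assert (hs2 : 0 < s2) by lra. assert (hrr : 0 < rr) by lra.
  set (phi := Imom (Icirc s0) (PhiF q N a b)). set (psi := Imom (Icirc s1) (psiF q N a b)).
  set (psi' := Imom (Icirc rr) (psiF q N a b)).
  assert (cs2 := psiF_contD q hq N s0 s1 s2 hs2 ltac:(lra) ltac:(lra) a b Hok).
  assert (m2 : forall n, psi n = Imom (Icirc s2) (psiF q N a b) n).
  { intros n. apply (Imom12 s1 s2). apply (psiF_Zint q hq N s0 s1 s2); auto; lra. }
  (* The circle q rr lies in the inner annulus, so the recurrence expresses psi' through the
     coefficients psi themselves. *)
  assert (mq : forall n, psi n = Imom (Icirc (q * rr)) (psiF q N a b) n).
  { intros n. rewrite eqR. apply (Imom12 s1 qR). apply (psiF_Zint q hq N s0 s1 qR); auto; lra. }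
  assert (mphi : forall n, Imom (Icirc r) (PhiF q N a b) n = phi n).
  { intros n. apply (Phi_moment q hq N a b r s0); auto; lra. }
  assert (nzD : forall s, gD s <> RtoC 0) by (intros s; apply Cmod_gt_0; specialize (hDr s); lra).
  assert (nzB : forall s, gDb s <> RtoC 0) by (intros s; apply Cmod_gt_0; specialize (hBr s); lra).
  assert (lD := closed_C1_loop _ _ hD). assert (lB := closed_C1_loop _ _ hB).
  assert (MD := fun n => psi_moment_D q hq N a b s1 rr hs1 Ha inj gD dgD n lD nzD hDp hDw0 hDw1 hDw ltac:(lia)).
  (* The winding number 1 about 0 is the one prescribed for all points of the disc bounded by C. *)
  assert (MB := fun n => psi_moment_Dbar q hq N a b s1 rr hs1 Ha inj gDb dgDb n lB nzB hBp
     (hBw (RtoC 0) ltac:(rewrite Cmod_0; lra)) hBp0).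
  assert (KD := fun m1 m2 => kernel_expand q hq N a b r gD dgD m1 m2 hr b0 lD hDr (proj1 (MD 0%Z))).
  assert (KB := fun m1 m2 => kernel_expand q hq N a b r gDb dgDb m1 m2 hr b0 lB hBr (proj1 (MB 0%Z))).
  destruct (Imom_circ_bound_ex s0 (PhiF q N a b) hs0) as [K0 [k0 B0]].
  { apply (PhiF_contD q hq N s0 s1 s2); auto; lra. }
  destruct (Imom_circ_bound_ex s1 (psiF q N a b) hs1) as [K1 [k1 B1]].
  { exact (D12_1 s1 s2 _ cs2). }
  destruct (Imom_circ_bound_ex s2 (psiF q N a b) hs2) as [K2 [k2 B2]].
  { exact (D12_2 s1 s2 _ cs2). }
  destruct (Imom_circ_bound_ex rr (psiF q N a b) hrr) as [K3 [k3 B3]].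
  { apply (psiF_contD_rr q hq N a b rr w0); auto; lra. }
  destruct (psi_rec q hq N a b rr w0 ltac:(lra) ltac:(lra) Hab ltac:(lia)) as [rho [K4 [k4 [r0 [Br Hrec]]]]].
  (* Multiplication by s0^n turns a bound on the circle s into (s0 / s)^n, so the coefficients of
     Phi on s0 become bounded. *)
  set (z := fun n => RtoC (powerRZ s0 n)).
  assert (zadd : forall n m, z (n + m)%Z = (z n * z m)%C).
  { intros n m. unfold z. rewrite powerRZ_add by lra. apply RtoC_mult. }
  assert (z1 : forall n, (z n * z (- n)%Z)%C = RtoC 1).
  { intros n. rewrite <- zadd. replace (n + - n)%Z with 0%Z by lia. reflexivity. }
  assert (zm : forall n, Cmod (z n) = powerRZ s0 n).
  { intros n. unfold z. rewrite Cmod_R. apply Rabs_pos_eq, Rlt_le, powerRZ_lt, hs0. }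
  assert (zn : forall n, 0 < powerRZ s0 n) by (intros; now apply powerRZ_lt).
  set (K := K0 + K1 + K2 + K3 + K4).
  assert (bnd : forall s x n Ki, 0 < s -> Ki <= K -> Cmod x <= Ki * powerRZ s (- n) -> Cmod (x * z n) <= K * powerRZ (s0 / s) n).
  { intros s x n Ki hs hK hx. rewrite Cmod_mult, zm.
    eapply Rle_trans; [apply Rmult_le_compat_r; [apply Rlt_le, zn|exact hx]|].
    rewrite Rmult_assoc, powerRZ_ratio by assumption. apply Rmult_le_compat_r; [|assumption].
    apply Rlt_le, powerRZ_lt, Rdiv_lt_0_compat; assumption. }
  set (tau := t * Rpower q (/ 2 + INR k)).
  assert (htau : 0 < tau) by (apply Rmult_lt_0_compat; [assumption|apply exp_pos]).
  set (fD := fun m m' => (- (fcoef q t k m * kernel q N a b r gD dgD m m'))%C).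
  set (fB := fun m m' => (fcoef q t k m * kernel q N a b r gDb dgDb m m')%C).
  (* For these ratios the condition th2 q < et reads q rr < s2, and rho_s s0^(-s) grows at most like
     (rr / s0)^s because w0 < rr. *)
  destruct (fredholm_det_eq q tau (s0 / s1) (s0 / rr) (s0 / s2) (w0 / rr) K
    (fun n => phi n * z n)%C (fun n => psi n * z n)%C (fun n => psi' n * z n)%C
    (fun s => rho s * RtoC ((/ s0) ^ s))%C) with
    (A1 := fun m m' => (z m * fB m m' * z (- m')%Z)%C) (A2 := fun m m' => (z m * fD m m' * z (- m')%Z)%C) as [d [h1 h2]].
  - lra.
  - split; [|now apply (Rdiv_lt_1 s0 s1)].
    apply (Rmult_lt_reg_r s1); [assumption|]. unfold Rdiv. rewrite Rmult_assoc, Rinv_l; lra.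
  - split; [|apply (Rdiv_lt_1 s0 rr); lra].
    apply (Rmult_lt_reg_r rr); [assumption|]. unfold Rdiv. rewrite Rmult_assoc, Rinv_l; lra.
  - apply (Rmult_lt_reg_r s2); [assumption|]. unfold Rdiv. rewrite Rmult_assoc, Rinv_l; lra.
  - apply (Rmult_lt_reg_r (s2 * rr)); [now apply Rmult_lt_0_compat|].
    replace (s0 / s2 * q * (s2 * rr)) with (s0 * (q * rr)) by (field; lra).
    replace (s0 / rr * (s2 * rr)) with (s0 * s2) by (field; lra). rewrite eqR. apply Rmult_lt_compat_l; lra.
  - split; [apply Rdiv_lt_0_compat; lra|apply (Rdiv_lt_1 w0 rr); lra].
  - assumption.
  - unfold K; lra.
  - intros n. replace K with (K * powerRZ (s0 / s0) n).
    + apply (bnd s0 _ n K0); [assumption|unfold K; lra|apply B0].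
    + unfold Rdiv. rewrite Rinv_r, powerRZ_R1 by lra. ring.
  - intros n. apply (bnd s1 _ n K1); [assumption|unfold K; lra|apply B1].
  - intros n. rewrite m2. apply (bnd s2 _ n K2); [assumption|unfold K; lra|apply B2].
  - intros n. apply (bnd rr _ n K3); [assumption|unfold K; lra|apply B3].
  - rewrite r0. ring.
  - intros s. rewrite Cmod_mult, Cmod_R, Rabs_pos_eq by (apply pow_le, Rlt_le, Rinv_0_lt_compat; assumption).
    eapply Rle_trans; [apply Rmult_le_compat_r; [apply pow_le, Rlt_le, Rinv_0_lt_compat; assumption|apply Br]|].
    rewrite Rmult_assoc, <- Rpow_mult_distr. apply Rmult_le_compat; [lra| |unfold K; lra|].
    + apply pow_le, Rlt_le, Rmult_lt_0_compat; [lra|now apply Rinv_0_lt_compat].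
    + apply pow_incr; split.
      * apply Rlt_le, Rmult_lt_0_compat; [lra|now apply Rinv_0_lt_compat].
      * replace (/ (s0 / rr)) with (rr * / s0) by (field; lra).
        apply Rmult_le_compat_r; [apply Rlt_le, Rinv_0_lt_compat; assumption|lra].
  - intros n S. specialize (Hrec n S).
    rewrite (csum_ext S _ (fun s => z n * (rho s * RtoC (powerRZ q (n + Z.of_nat s)) *
      Imom (Icirc (q * rr)) (psiF q N a b) (n + Z.of_nat s)))%C).
    + rewrite csum_scal. fold psi' in Hrec.
      match goal with |- Cmod (_ - _ * ?t) <= _ => replace (psi' n * z n - z n * t)%C with ((psi' n - t) * z n)%C by ring end.
      rewrite Cmod_mult, zm.
      eapply Rle_trans; [apply Rmult_le_compat_r; [apply Rlt_le, zn|exact Hrec]|].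
      replace (K4 * powerRZ rr (- n) * (w0 / rr) ^ S * powerRZ s0 n) with (K4 * (powerRZ rr (- n) * powerRZ s0 n) * (w0 / rr) ^ S) by ring.
      rewrite powerRZ_ratio by assumption.
      apply Rmult_le_compat_r; [apply pow_le, Rlt_le, Rdiv_lt_0_compat; lra|].
      apply Rmult_le_compat_r; [apply Rlt_le, powerRZ_lt, Rdiv_lt_0_compat; lra|unfold K; lra].
    + intros s _. rewrite <- mq, zadd.
      assert (zs : (RtoC ((/ s0) ^ s) * z (Z.of_nat s))%C = RtoC 1).
      { unfold z. rewrite powerRZ_of_nat, <- RtoC_mult, <- Rpow_mult_distr, Rinv_l, pow1 by lra. reflexivity. }
      transitivity (z n * (rho s * RtoC (powerRZ q (n + Z.of_nat s)) * psi (n + Z.of_nat s)%Z) * (RtoC ((/ s0) ^ s) * z (Z.of_nat s)))%C; [ring|].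
      rewrite zs. ring.
  (* The conjugation contributes s0^(x - y), which is 1 on the diagonal, so the conjugated matrices
     are still inverse to each other. *)
  - intros x y. assert (inv := psi_Phi_inverse q hq N s0 s1 s2 hs2 ltac:(lra) ltac:(lra) a b x y Hok).
    apply (Clim_scal (z (Z.of_nat x - Z.of_nat y)%Z)) in inv.
    replace (dltC x y) with (z (Z.of_nat x - Z.of_nat y)%Z * dltC x y)%C.
    2: { unfold dltC. destruct (Nat.eqb_spec x y) as [->|]; [|ring]. rewrite Z.sub_diag. unfold z; simpl. ring. }
    eapply Clim_ext; [|exact inv]. intros M. cbv beta. unfold Tbox. rewrite <- cbox_scal. apply cbox_ext; intros m.
    fold psi phi. replace (Z.of_nat x - Z.of_nat y)%Z with ((Z.of_nat x - m) + (m - Z.of_nat y))%Z by lia. rewrite zadd. ring.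
  - intros m m'. specialize (KB m m'). apply (Clim_scal (- (z m * z (- m')%Z * fcoef q t k m))%C) in KB.
    match type of KB with Clim _ ?l => replace l with (z m * fB m m' * z (- m')%Z)%C in KB by (unfold fB; ring) end.
    eapply Clim_ext; [|exact KB]. intros L. cbv beta. rewrite <- csum_scal. apply csum_ext; intros l _.
    rewrite mphi, (proj2 (MB _)), fcoef_ffun by lra. fold tau psi.
    replace (z m * z (- m')%Z)%C with (z (m - Z.of_nat l)%Z * z (Z.of_nat l - m')%Z)%C by (rewrite <- !zadd; f_equal; lia). ring.
  - intros m m'. specialize (KD m m'). apply (Clim_scal (z m * z (- m')%Z * fcoef q t k m)%C) in KD.
    match type of KD with Clim _ ?l => replace l with (z m * fD m m' * z (- m')%Z)%C in KD by (unfold fD; ring) end.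
    eapply Clim_ext; [|exact KD]. intros L. cbv beta. rewrite <- csum_scal. apply csum_ext; intros l _.
    rewrite mphi, (proj2 (MD _)), fcoef_ffun by lra. fold tau psi psi'.
    replace (z m * z (- m')%Z)%C with (z (m - Z.of_nat l)%Z * z (Z.of_nat l - m')%Z)%C by (rewrite <- !zadd; f_equal; lia). ring.
  - exists d; split.
    + exact (is_fredholm_det_conj fD _ z (fun m => z (- m)%Z) d z1 (fun _ _ => eq_refl) h1).
    + exact (is_fredholm_det_conj fB _ z (fun m => z (- m)%Z) d z1 (fun _ _ => eq_refl) h2).
Qed.
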